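(* Let $2\le m<n$ be integers, let $D\subset\{0,\dots,n-1\}\times\{0,\dots,m-1\}$ be non-empty, and let $X\subset\mathbb{T}^2$ be the associated Bedford-McMullen set with $T:X\to X$, $T(x,y)=(nx,my)\bmod1$. Put $\eta=\frac{\log m}{\log n}$ and, for $0\le j<m$, $z(j)=\#\{0\le i<n:(i,j)\in D\}$. Let $\mu_{\max}$ denote the measure of maximal entropy for $T:X\to X$. Let $\nu$ be a $T$-invariant ergodic Borel probability measure with $\mathrm{supp}(\nu)=X$, and assume that if $(0,0)\in X$ then $\underline{\dim}_{\rm loc}(\pi_*(\nu))(0)>0$. Then: (1) If $z(j)\le1$ for all $j$, then for $\nu$-almost all $z\in X$ $$\lim_{\epsilon\to0}\frac{\dim_B(X)-\overline{\dim}_B(X_{B_\epsilon(z)})}{\mu_{\max}(B_\epsilon(z))}=\frac1{\log m}\left(\eta\, d_B(z)+(1-\eta)\,\tilde d_B(z)\right).$$ (2) If $z(j)>1$ for some $j$, then for $\nu$-almost all $z\in X$ $$\lim_{\epsilon\to0}\frac{\dim_B(X)-\overline{\dim}_B(X_{B_\epsilon(z)})}{\mu_{\max}(B_\epsilon(z))}=\frac{\eta\, d_B(z)}{\log m}.$$ The same statements hold with the upper box dimension $\overline{\dim}_B$ replaced by the lower box dimension $\underline{\dim}_B$.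
   Context: For $(i,j)\in D$ put $F_{(i,j)}(x,y)=\left(\frac{x+i}{n},\frac{y+j}{m}\right)$. The Bedford-McMullen set $X$ is the unique non-empty compact set with $X=\bigcup_{(i,j)\in D}F_{(i,j)}(X)$, regarded as a subset of the torus $\mathbb{T}^2$; it is invariant under $T(x,y)=(nx,my)\bmod 1$. The map $\pi:\mathbb{T}^2\to\mathbb{S}^1$ is projection onto the second coordinate and $S:\mathbb{S}^1\to\mathbb{S}^1$ is multiplication by $m$ mod $1$, so $\pi T=S\pi$; $\pi_D:D\to\{0,\dots,m-1\}$ is projection to the second coordinate. $\mu_{\max}$ is the unique Borel probability measure with $\mu_{\max}=(\#D)^{-1}\sum_{(i,j)\in D}(F_{(i,j)})_*(\mu_{\max})$. The box dimension of $X$ is $\dim_B(X)=\frac{\log\#D}{\log n}+(1-\eta)\frac{\log\#\pi_D(D)}{\log m}$. For $z\in X$, $B_\epsilon(z)$ is the open metric ball of radius $\epsilon$ about $z$, and $X_{B_\epsilon(z)}=\{x\in X:T^k(x)\notin B_\epsilon(z)\text{ for all }k\ge0\}$. For a measure $\rho$ and a point $x\in\mathrm{supp}(\rho)$, $\underline{\dim}_{\rm loc}(\rho)(x)=\liminf_{\epsilon\to0}\frac{\log\rho(B_\epsilon(x))}{\log\epsilon}$. The functions $d_B,\tilde d_B:X\to\mathbb{R}$ are: $d_B(z)=1$ if $z$ is not periodic under $T$ and $d_B(z)=1-(\#D)^{-p}$ if $z$ has prime period $p$ under $T$; $\tilde d_B(z)=1$ if $\pi(z)$ is not periodic under $S$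 and $\tilde d_B(z)=1-(\#\pi_D(D))^{-p}$ if $\pi(z)$ has prime period $p$ under $S$. (The symbol $z(j)$, $0\le j<m$, for the digit counts is unrelated to the point $z\in X$.) *)

(* Defs.v *)
From HB Require Import structures.
From mathcomp Require Import all_boot all_order all_algebra.
From mathcomp Require Import all_classical all_reals all_analysis.

Set Implicit Arguments.
Unset Strict Implicit.
Unset Printing Implicit Defensive.

Import Order.TTheory GRing.Theory Num.Theory.
Import numFieldNormedType.Exports.

Local Open Scope classical_set_scope.
Local Open Scope ring_scope.

(* The circle R/Z is represented by its fundamental domain [0, 1[ and the torus
   R^2/Z^2 by [0, 1[ x [0, 1[, with the quotient metrics. The Borel sets of the
   torus are then the Borel subsets of R x R contained in [0, 1[ x [0, 1[, and
   a Borel measure on the torus is a Borel measure on R x R that is carried by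
   [0, 1[ x [0, 1[. *)

Section Torus.
Variable R : realType.
Implicit Types (x y : R) (z w : R * R).

Definition frac x : R := x - (Num.floor x)%:~R.

Definition circle : set R := [set x | 0 <= x < 1].

Definition torus : set (R * R) := [set z | circle z.1 /\ circle z.2].

Definition toTorus z : R * R := (frac z.1, frac z.2).

(* distance from x - y to the nearest integer *)
Definition circle_dist x y : R := Num.min (frac (x - y)) (1 - frac (x - y)).

Definition torus_dist z w : R :=
  Num.sqrt (circle_dist z.1 w.1 ^+ 2 + circle_dist z.2 w.2 ^+ 2).

Definition circle_ball x (e : R) : set R :=
  [set y | circle y /\ circle_dist x y < e].

Definition torus_ball z (e : R) : set (R * R) :=
  [set w | torus w /\ torus_dist z w < e].

End Torus.

Section Dimensions.
Variable R : realType.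
Implicit Types A : set (R * R).

(* The least number of open balls of radius e that cover A; it is 0 for the
   empty set, whose box dimensions below are therefore 0, because ln 0 = 0. *)
Definition covering_number A (e : R) : R :=
  inf [set k%:R | k in [set k : nat | exists c : 'I_k -> R * R,
    A `<=` \bigcup_(i in [set: 'I_k]) torus_ball (c i) e]].

Definition box_ratio A (e : R) : \bar R :=
  (ln (covering_number A e) / - ln e)%:E.

Definition upper_box_dim A : \bar R := limf_esup (box_ratio A) 0^'+.

Definition lower_box_dim A : \bar R := limf_einf (box_ratio A) 0^'+.

Definition box_dim A : \bar R := lim (box_ratio A e @[e --> 0^'+]).

(* meaningful for x in the support of rho, where the balls about x are not
   null and the logarithm is genuine *)
Definition lower_local_dim (rho : set R -> \bar R) (x : R) : \bar R :=
  limf_einf (fun e : R => (ln (fine (rho (circle_ball x e))) / ln e)%:E) 0^'+.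

End Dimensions.

Section Dynamics.

Definition invariant_measure d (T : measurableType d) (R : realType)
    (nu : set T -> \bar R) (f : T -> T) : Prop :=
  forall A : set T, measurable A -> nu (f @^-1` A) = nu A.

Definition ergodic_measure d (T : measurableType d) (R : realType)
    (nu : set T -> \bar R) (f : T -> T) : Prop :=
  forall A : set T, measurable A -> f @^-1` A = A ->
    nu A = 0%E \/ nu A = 1%E.

Definition torus_support (R : realType) (nu : set (R * R) -> \bar R) :
    set (R * R) :=
  [set z | torus z /\ forall e : R, 0 < e -> (0 < nu (torus_ball z e))%E].

Definition is_prime_period (U : Type) (f : U -> U) (u : U) (p : nat) : Prop :=
  [/\ (0 < p)%N, iter p f u = u &
      forall q : nat, (0 < q < p)%N -> iter q f u <> u].

(* 0 when u is not periodic *)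
Definition prime_period (U : Type) (f : U -> U) (u : U) : nat :=
  xget 0%N [set p | is_prime_period f u p].

(* 1 when u is not periodic, and 1 - N^-p when u has prime period p *)
Definition period_factor (R : realType) (U : Type) (f : U -> U) (N : nat)
    (u : U) : R :=
  if prime_period f u == 0%N then 1 else 1 - N%:R ^- prime_period f u.

End Dynamics.

Section BedfordMcMullen.
Variables (R : realType) (n m : nat).
Implicit Types (D : {set 'I_n * 'I_m}) (z : R * R) (d : 'I_n * 'I_m).

Definition bm_map d z : R * R :=
  ((z.1 + d.1%:R) / n%:R, (z.2 + d.2%:R) / m%:R).

(* The attractor is characterized in the plane, where the maps bm_map d are
   contractions. It may contain points with a coordinate equal to 1, so its
   image under toTorus is the Bedford-McMullen set. *)
Definition is_attractor D (K : set (R * R)) : Prop :=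
  [/\ K !=set0, compact K & K = \bigcup_(d in [set` D]) (bm_map d @` K)].

(* likewise in the plane: mu_max is the pushforward under toTorus *)
Definition is_self_affine_measure D (mu : set (R * R) -> \bar R) : Prop :=
  forall A : set (R * R), measurable A ->
    mu A = ((#|D|%:R^-1 : R)%:E * \sum_(d in D) pushforward mu (bm_map d) A)%E.

Definition torus_map z : R * R := (frac (n%:R * z.1), frac (m%:R * z.2)).

Definition circle_map (y : R) : R := frac (m%:R * y).

Definition row_count D (j : 'I_m) : nat := #|[set i : 'I_n | (i, j) \in D]|.

Definition row_proj D : {set 'I_m} := [set d.2 | d in D].

Definition bm_eta : R := ln m%:R / ln n%:R.

Definition d_B D z : R := period_factor R torus_map #|D| z.

Definition d_B_tilde D z : R := period_factor R circle_map #|row_proj D| z.2.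

(* the points of X whose orbits avoid the hole B *)
Definition survivor (X B : set (R * R)) : set (R * R) :=
  [set x | X x /\ forall k : nat, ~ B (iter k torus_map x)].

End BedfordMcMullen.

(* [dim] is meant to be upper_box_dim or lower_box_dim. *)
Definition dimension_drop_ratio (R : realType) (n m : nat)
    (dim : set (R * R) -> \bar R) (X : set (R * R))
    (mumax : set (R * R) -> \bar R) (z : R * R) (e : R) : \bar R :=
  ((box_dim X - dim (survivor n m X (torus_ball z e)))
   * ((fine (mumax (torus_ball z e)))^-1)%:E)%E.

(* Main.v *)
(* Since nu is ergodic with support X, it gives no mass to a periodic orbit or to a grid
   line unless X is contained in it. Hence, apart from the case #D = 1, where both sides
   vanish, almost every z is not periodic, so that all period factors are 1, and its
   orbit meets no grid line across which X extends.

   Approximate the ball B about z from inside and outside by unions of cylinders of a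
   level N proportional to log (1/e). Cylinders meeting the circle are negligible, because
   a thin annulus is covered by horizontal strips after zooming in, the cells being
   thinner than high. For a set U of words of length N and density mu the number a(L) of
   words of length L avoiding U satisfies #D a(L) <= a(L+1) + |U| a(L+1-N), and the
   reverse inequality up to overlaps of U with itself, which are negligible when z is not
   periodic. So the growth rate of a is #D (1 - mu (1 + o(1))), and logarithms of counts
   of approximate squares give the drop of dimension.

   If some row has two digits, the projection of the survivor set loses nothing: choose a
   digit d in that row which occurs in the expansion of z, and lift every sequence of rows
   by a section of D -> pi(D) that avoids d. *)
Require Import Defs.
From HB Require Import structures.
From mathcomp Require Import all_boot all_order all_algebra.
From mathcomp Require Import all_classical all_reals all_analysis.
From mathcomp Require Import measurable_realfun zify ring lra.
Import Order.TTheory GRing.Theory Num.Theory.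
Import numFieldNormedType.Exports.
Local Open Scope classical_set_scope.
Local Open Scope ring_scope.
Set Implicit Arguments.
Unset Strict Implicit.
Unset Printing Implicit Defensive.

(* [frac] alone would denote the fraction construction of all_algebra. *)
Local Notation frac := Defs.frac.

(** * Counting words that avoid a set of factors *)

(** The ball has radius about n^-k0, but its boundary is resolved only by words of a length N that
    is a large multiple of k0. There are very many of them, possibly overlapping at many shifts, so
    their number alone does not control the overlaps. What does is the number of prefixes: at most
    16 words of length i <= k0, four cells per coordinate, begin an element of U, since a cell of
    level i has sides at least n^-i >= e; beyond k0 each letter multiplies this by at most q = #D.
    Overlaps with shift i thus have weight at most 16 q^-i or 16 q^-k0 relative to |U|. Large shifts
    contribute little, and a bounded range of shifts does not occur for a small ball. The same bound
    gives N mu -> 0, as N is linear in k0.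

    If a row has several digits, survivors are coded by a free word over D followed by letters of a
    section missing d. A hole word across the junction that carries d at position t must have its
    first t + 1 letters in the free part. By the prefix bound this is rare when t is large: hence
    the need for late visits of the orbit of z to the cell of d. *)

Section Words.
Local Open Scope nat_scope.
Variable T : eqType.
Implicit Types (A : seq T) (w u v : seq T) (U P : pred (seq T)).

Fixpoint words A L : seq (seq T) :=
  if L is L'.+1 then [seq d :: w | d <- A, w <- words A L'] else [:: [::]].

Lemma wordsS A L : words A L.+1 = [seq d :: w | d <- A, w <- words A L].
Proof. by []. Qed.

Lemma size_words A L : size (words A L) = size A ^ L.
Proof. by elim: L => //= L IH; rewrite size_allpairs IH expnS. Qed.

Lemma mem_words A L w : (w \in words A L) = (size w == L) && all (mem A) w.
Proof.
elim: L w => [|L IH] [|d w] //=.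
  by apply/allpairsP => -[[]] /= ? ? [].
rewrite eqSS; apply/allpairsP/andP => [[[d' w'] /= [d'A w'L [-> ->]]]|].
  by move: w'L; rewrite IH => /andP[-> ->]; rewrite d'A.
move=> [sw /andP[dA wA]]; exists (d, w) => /=.
by rewrite IH sw wA.
Qed.

Lemma words_uniq A L : uniq A -> uniq (words A L).
Proof.
move=> uA; elim: L => //= L IH.
by apply: allpairs_uniq => //= -[d w] [d' w'] _ _ /= [-> ->].
Qed.

Lemma sum_words_cat A L M (F : seq T -> nat) :
  \sum_(w <- words A (L + M)) F w =
  \sum_(u <- words A L) \sum_(v <- words A M) F (u ++ v).
Proof.
elim: L F => [|L IH] F; first by rewrite add0n big_seq1.
by rewrite addSn /= !big_allpairs_dep; apply: eq_bigr => d _; rewrite IH.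
Qed.

Arguments words : simpl never.

Lemma sum_words_take_drop A L M (F : seq T -> seq T -> nat) :
  \sum_(w <- words A (L + M)) F (take L w) (drop L w) =
  \sum_(u <- words A L) \sum_(v <- words A M) F u v.
Proof.
rewrite sum_words_cat; apply: eq_big_seq => u; rewrite mem_words => /andP[/eqP su _].
by apply: eq_bigr => v _; rewrite take_size_cat // drop_size_cat.
Qed.

Lemma sum_words_split A L M (f g : seq T -> nat) :
  \sum_(w <- words A (L + M)) f (take L w) * g (drop L w) =
  (\sum_(u <- words A L) f u) * (\sum_(v <- words A M) g v).
Proof.
rewrite (sum_words_take_drop A L M (fun u v => f u * g v)) big_distrl /=.
by apply: eq_bigr => u _; rewrite big_distrr.
Qed.

Lemma sum_const_words A L c : \sum_(w <- words A L) c = size A ^ L * c.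
Proof. by rewrite big_const_seq count_predT size_words iter_addn_0 mulnC. Qed.

Lemma count_sum (P : pred (seq T)) s : count P s = \sum_(w <- s) P w.
Proof. by elim: s => [|w s IH]; rewrite ?big_nil //= big_cons IH. Qed.

Definition avoid U w := `[< forall a b c, w = a ++ b ++ c -> ~~ U b >].

Lemma avoidP U w : reflect (forall a b c, w = a ++ b ++ c -> ~~ U b) (avoid U w).
Proof. exact: asboolP. Qed.

Lemma avoid_catl U u v : avoid U (u ++ v) -> avoid U u.
Proof.
move=> /avoidP h; apply/avoidP => a b c e.
by apply: (h a b (c ++ v)); rewrite e -!catA.
Qed.

Lemma avoid_catr U u v : avoid U (u ++ v) -> avoid U v.
Proof.
move=> /avoidP h; apply/avoidP => a b c e.
by apply: (h (u ++ a) b c); rewrite e -!catA.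
Qed.

Lemma avoid_take U k w : avoid U w -> avoid U (take k w).
Proof. by rewrite -{1}(cat_take_drop k w); exact: avoid_catl. Qed.

Lemma avoid_takeW U j k w : j <= k -> avoid U (take k w) -> avoid U (take j w).
Proof. by move=> jk /(avoid_take j); rewrite take_takel. Qed.

Definition avcount U A L := count (avoid U) (words A L).
Definition prefcount U A L :=
  count (fun x => `[< exists y, all (mem A) y /\ U (x ++ y) >]) (words A L).
(** The autocorrelation of [U] at shift i: words that begin and end with an element of [U], the two
    occurrences being i letters apart. *)
Definition retcount U A N i :=
  count (fun x => U (drop i x) && U (take N x)) (words A (N + i)).

Section Counting.
Variables (U : pred (seq T)) (A : seq T) (N : nat).
Hypothesis N0 : 0 < N.
Hypothesis UN : forall w, U w -> size w = N.

Lemma not_avoidP w : ~~ avoid U w ->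
  exists2 i, i + N <= size w & U (take N (drop i w)).
Proof.
move=> nav; apply: contrapT => h; case/negP: nav; apply/avoidP => a b c e.
apply/negP => Ub; apply: h; exists (size a).
  by rewrite e !size_cat (UN Ub) addnA leq_addr.
by rewrite e drop_size_cat // -(UN Ub) take_size_cat.
Qed.

Lemma avoid_window w i : avoid U w -> ~~ U (take N (drop i w)).
Proof.
move/avoidP => h; apply: (h (take i w) _ (drop N (drop i w))).
by rewrite !cat_take_drop.
Qed.

Lemma avoid_short w : size w < N -> avoid U w.
Proof.
move=> sw; apply: contraT => /not_avoidP[i +]; lia.
Qed.

Lemma avcount_small L : L < N -> avcount U A L = size A ^ L.
Proof.
move=> LN; rewrite /avcount -size_words; apply/eqP.
rewrite -all_count; apply/allP => w; rewrite mem_words => /andP[/eqP sw _].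
by apply: avoid_short; rewrite sw.
Qed.

(* A word of length L avoiding U whose extension by one letter does not avoid U is
   an avoiding word of length L + 1 - N followed by an element of U. *)
Lemma avcountS_ge L : size A * avcount U A L <=
  avcount U A L.+1 + (if N <= L.+1 then count U (words A N) * avcount U A (L.+1 - N) else 0).
Proof.
have -> : size A * avcount U A L =
    \sum_(w <- words A (L + 1)) avoid U (take L w) * 1.
  rewrite (sum_words_split _ _ _ (fun u => avoid U u) (fun=> 1)).
  by rewrite sum_const_words expn1 muln1 mulnC -count_sum.
rewrite addn1; case: ifPn => [NL|NL].
  rewrite /avcount !count_sum.
  have -> : (\sum_(w <- words A N) U w) * (\sum_(w <- words A (L.+1 - N)) avoid U w)
     = \sum_(w <- words A (L.+1 - N + N))
         avoid U (take (L.+1 - N) w) * U (drop (L.+1 - N) w).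
    by rewrite (sum_words_split _ _ _ (fun u => avoid U u) (fun u => U u)) mulnC.
  rewrite subnK // -big_split /= !big_seq; apply: leq_sum => w.
  rewrite mem_words => /andP[/eqP sw _].
  have [av|/not_avoidP[i iN Ui]] := boolP (avoid U w); first by case: avoid.
  have [av|] := boolP (avoid U (take L w)) => //.
  have [iL|iL] := leqP (i + N) L.
    have := avoid_window i av; suff -> : take N (drop i (take L w)) = take N (drop i w).
      by rewrite Ui.
    rewrite -[in RHS](cat_take_drop L w) drop_cat size_take sw ltnSn ifT; last lia.
    by rewrite takel_cat // size_drop size_take sw ltnSn; lia.
  have -> : L.+1 - N = i by lia.
  rewrite (avoid_takeW _ av) //; last lia.
  have -> : drop i w = take N (drop i w).
    by rewrite take_oversize // size_drop sw; lia.
  by rewrite Ui.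
rewrite addn0 /avcount count_sum !big_seq; apply: leq_sum => w.
rewrite mem_words => /andP[/eqP sw _]; rewrite (avoid_short (w := w)) //; last by rewrite sw; lia.
by case: avoid.
Qed.

(* Conversely, an avoiding word of length L + 1 - N followed by an element of U is
   such a failed extension unless an earlier occurrence of U starts i letters
   before the last one, with 0 < i < N. *)
Lemma avcountS_le L : 2 * N <= L ->
  avcount U A L.+1 + count U (words A N) * avcount U A (L.+1 - N) <=
  size A * avcount U A L +
  \sum_(1 <= i < N) avcount U A (L.+1 - N - i) * retcount U A N i.
Proof.
move=> NL; set K := L.+1 - N.
have -> : size A * avcount U A L =
    \sum_(w <- words A L.+1) avoid U (take L w) * 1.
  rewrite -addn1 (sum_words_split _ _ _ (fun u => avoid U u) (fun=> 1)).
  by rewrite sum_const_words expn1 muln1 mulnC -count_sum.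
have -> : \sum_(1 <= i < N) avcount U A (K - i) * retcount U A N i =
   \sum_(w <- words A L.+1) \sum_(1 <= i < N) avoid U (take (K - i) w) *
      (U (drop i (drop (K - i) w)) && U (take N (drop (K - i) w))).
  rewrite exchange_big /=; apply: eq_big_nat => i /andP[i1 iN].
  have -> : L.+1 = K - i + (N + i) by rewrite /K; lia.
  rewrite (sum_words_split _ _ _ (fun u => avoid U u)
     (fun x => U (drop i x) && U (take N x))).
  by rewrite /avcount /retcount !count_sum.
have -> : count U (words A N) * avcount U A K =
   \sum_(w <- words A L.+1) avoid U (take K w) * U (drop K w).
  have -> : L.+1 = K + N by rewrite /K; lia.
  rewrite (sum_words_split _ _ _ (fun u => avoid U u) (fun u => U u)) mulnC.
  by rewrite /avcount !count_sum.
rewrite /avcount count_sum -!big_split /= !big_seq; apply: leq_sum => w.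
rewrite mem_words => /andP[/eqP sw _].
have szK : size (drop K w) = N by rewrite size_drop sw /K; lia.
have [av|nav] := boolP (avoid U w).
  rewrite !avoid_take //.
  by have := avoid_window K av; rewrite take_oversize ?szK // => /negbTE ->.
have [avK|] := boolP (avoid U (take K w)) => //.
have [UK|] := boolP (U (drop K w)) => //.
have [//|/not_avoidP[i iN Ui]] := boolP (avoid U (take L w)).
have stL : size (take L w) = L by rewrite size_take sw ltnSn.
rewrite stL in iN.
have Ui' : U (take N (drop i w)).
  move: Ui; rewrite -[in X in _ -> X](cat_take_drop L w) drop_cat stL ifT; last lia.
  by rewrite takel_cat // size_drop stL; lia.
have iK : i < K by rewrite /K; lia.
have KiN : K - i < N.
  rewrite ltnNge; apply/negP => h; have := avoid_window i avK.
  have stK : size (take K w) = K by rewrite size_take sw ifT //; rewrite /K; lia.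
  move: Ui'; rewrite -{1}(cat_take_drop K w) drop_cat stK iK.
  by rewrite takel_cat ?size_drop ?stK // => ->.
(* The earlier occurrence at position i is paid for by the single summand with shift K - i. *)
rewrite (big_cat_nat_idem _ (n := K - i)) //=; try lia.
rewrite [X in _ + (_ + X)]big_ltn //.
rewrite subKn ?(ltnW iK) // drop_drop.
rewrite subnK ?(ltnW iK) // UK Ui' (avoid_takeW _ avK) //; lia.
Qed.

(* Every element of U carries the letter d at position t1; since d is not in A0,
   an occurrence of U in u ++ v must start in u and have its first t1 + 1 letters there. *)
Lemma mixed_count (A0 : seq T) t1 d x0 k r :
  {subset A0 <= A} ->
  N <= k -> N <= r -> d \notin A0 -> t1 < N -> (forall w, all (mem A) w -> U w -> nth x0 w t1 = d) ->
  size A0 ^ r * avcount U A k <=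
  \sum_(u <- words A k) \sum_(v <- words A0 r) avoid U (u ++ v) +
  size A0 ^ r * \sum_(t1.+1 <= t < N) avcount U A (k - t) * prefcount U A t.
Proof.
move=> sA kN rN dA0 t1N Ud.
pose Pf x := `[< exists y, all (mem A) y /\ U (x ++ y) >].
have -> : size A0 ^ r * avcount U A k =
   \sum_(u <- words A k) \sum_(v <- words A0 r) avoid U u.
  rewrite /avcount count_sum big_distrr /=; apply: eq_bigr => u _.
  by rewrite sum_const_words.
have -> : size A0 ^ r * \sum_(t1.+1 <= t < N) avcount U A (k - t) * prefcount U A t =
   \sum_(u <- words A k) \sum_(v <- words A0 r)
     \sum_(t1.+1 <= t < N) avoid U (take (k - t) u) * Pf (drop (k - t) u).
  under [RHS]eq_bigr do rewrite sum_const_words.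
  rewrite -big_distrr /=; congr (_ * _).
  rewrite exchange_big /=; apply: eq_big_nat => t /andP[t1t tN].
  have {2}-> : k = k - t + t by lia.
  rewrite (sum_words_split _ _ _ (fun u => avoid U u) Pf).
  by rewrite /avcount /prefcount !count_sum.
rewrite -big_split /=; rewrite big_seq [leqRHS]big_seq; apply: leq_sum => u.
rewrite mem_words => /andP[/eqP su uA].
rewrite -big_split /=; rewrite big_seq [leqRHS]big_seq; apply: leq_sum => v.
rewrite mem_words => /andP[/eqP sv /allP vA].
have [avu|//] := boolP (avoid U u).
have [//|/not_avoidP[i iN Ui]] := boolP (avoid U (u ++ v)).
rewrite size_cat su sv in iN.
have nthi : nth x0 (u ++ v) (i + t1) = d.
  rewrite -(Ud _ _ Ui) ?nth_take ?nth_drop //.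
  apply/allP => y /mem_take/mem_drop; rewrite mem_cat => /orP[|/vA /sA //].
  exact: (allP uA).
have it1 : i + t1 < k.
  rewrite ltnNge; apply/negP => h; case/negP: dA0; apply: vA.
  by rewrite -nthi nth_cat su ltnNge h /= mem_nth // sv; lia.
have iNk : k < i + N.
  rewrite ltnNge; apply/negP => h; have := avoid_window i avu.
  by move: Ui; rewrite drop_cat su ifT ?takel_cat ?size_drop ?su => [->||] //; lia.
have kit : t1.+1 <= k - i by lia.
have kiN : k - i < N by lia.
rewrite (big_cat_nat_idem _ (n := k - i)) //=; try lia.
rewrite [X in _ + (_ + X)]big_ltn // subKn; last lia.
rewrite avoid_take // /Pf.
suff -> : `[< exists y, all (mem A) y /\ U (drop i u ++ y) >] = true by lia.
apply/asboolT; exists (take (N - (k - i)) v); split.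
  by apply/allP => x /mem_take /vA /sA.
move: Ui; rewrite drop_cat su ifT; last lia.
by rewrite take_cat size_drop su ltnNge ifN // negbK; lia.
Qed.

(** Of two occurrences with shift i only the first i letters, a prefix of an element of [U], and the
    last N letters, an element of [U], are retained. *)
Lemma retcount_le i : i <= N -> retcount U A N i <= prefcount U A i * count U (words A N).
Proof.
move=> iN; rewrite /retcount /prefcount !count_sum addnC.
rewrite -(sum_words_split _ _ _ (fun x => `[< exists y, all (mem A) y /\ U (x ++ y) >] : nat)
  (fun x => U x : nat)) !big_seq.
apply: leq_sum => w; rewrite mem_words => /andP[/eqP sw /allP wA].
have [U1|//] := boolP (U (drop i w)); have [U2|//] := boolP (U (take N w)).
rewrite asboolT //; exists (drop i (take N w)); split.
  by apply/allP => x /mem_drop /mem_take /wA.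
by rewrite -(take_takel _ iN) cat_take_drop.
Qed.

Lemma prefcountD i j : prefcount U A (i + j) <= prefcount U A i * size A ^ j.
Proof.
rewrite /prefcount !count_sum -[size A ^ j]muln1 -sum_const_words.
rewrite -(sum_words_split _ _ _ (fun x => `[< exists y, all (mem A) y /\ U (x ++ y) >] : nat)
  (fun x => 1)) !big_seq.
apply: leq_sum => w; rewrite mem_words => /andP[/eqP sw /allP wA].
rewrite muln1; have [[y [yA Uy]]|//] := asboolP (exists y, all (mem A) y /\ U (w ++ y)).
rewrite asboolT //; exists (drop i w ++ y); split.
  by rewrite all_cat yA andbT; apply/allP => x /mem_drop /wA.
by rewrite catA cat_take_drop.
Qed.

Lemma count_le_prefcount : count U (words A N) <= prefcount U A N.
Proof.
apply: sub_count => w Uw; apply/asboolP; exists [::]; split=> //.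
by rewrite cats0.
Qed.

End Counting.
End Words.

(** * Exponential growth rate of the avoiding words *)

Section Growth.
Variables (R : realType) (T : eqType).
Variables (U : pred (seq T)) (A : seq T) (N : nat).
Hypothesis N0 : (0 < N)%N.
Hypothesis UN : forall w, U w -> size w = N.
Hypothesis A1 : (1 < size A)%N.

Local Notation q := ((size A)%:R : R).
Local Notation a L := ((avcount U A L)%:R : R).
(** The Bernoulli measure with equal weights of the union of the cylinders in [U]. *)
Definition density : R := (count U (words A N))%:R / q ^+ N.
Local Notation mu := density.

Let q2 : 2 <= q. Proof. by rewrite ler_nat. Qed.
Let q0 : 0 < q. Proof. exact: lt_le_trans q2. Qed.

Lemma bernoulli_ge (x : R) k : 0 <= x <= 1 -> 1 - k%:R * x <= (1 - x) ^+ k.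
Proof.
move=> /andP[x0 x1]; elim: k => [|k IH]; first by rewrite mul0r subr0 expr0.
rewrite exprS -natr1; have h0 : 0 <= 1 - x by lra.
have := ler_wpM2l h0 IH; have : 0 <= k%:R * x * x by rewrite !mulr_ge0.
nra.
Qed.

(* For small N mu, loss mu = mu (1 + o(1)) solves mu <= loss mu (1 - loss mu)^N, the
   condition under which the recursion avcountS_ge propagates the growth rate below. *)
Definition loss (mu : R) : R := mu * (1 + 4 * N%:R * mu).

Hypothesis Nmu : N%:R * mu <= 16^-1.

Definition rate : R := q * (1 - loss mu).
Local Notation delta := (loss mu).
Local Notation rho := rate.

Let mu0 : 0 <= mu. Proof. by rewrite divr_ge0 ?exprn_ge0 // ltW. Qed.

Let N1 : 1 <= N%:R :> R. Proof. by rewrite ler1n. Qed.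

Let x0 : 0 <= N%:R * mu. Proof. by rewrite mulr_ge0. Qed.

Let mu16 : mu <= 16^-1. Proof. by apply: le_trans Nmu; rewrite ler_peMl. Qed.

Let Ndelta : N%:R * delta <= N%:R * mu * (5 / 4).
Proof.
rewrite /loss; move: Nmu x0; set x := N%:R * mu => hx h0.
have -> : N%:R * (mu * (1 + 4 * N%:R * mu)) = x * (1 + 4 * x) by rewrite /x; ring.
nra.
Qed.

Let delta0 : 0 <= delta.
Proof. by rewrite /loss mulr_ge0 // addr_ge0 // -mulrA mulr_ge0. Qed.

Let delta1 : delta <= 1 / 4.
Proof.
have : delta <= N%:R * delta by rewrite ler_peMl.
move: Nmu Ndelta; lra.
Qed.

(** The range 2 N is dictated by the recursion with overlaps, which looks back N - 1 + i letters
    with i < N. *)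
Let pow2N k : (k <= 2 * N)%N -> 1 / 2 <= (1 - delta) ^+ k.
Proof.
move=> kN; apply: (@le_trans _ _ ((1 - delta) ^+ (2 * N))); last first.
  by apply: ler_wiXn2l => //; move: delta0 delta1; lra.
apply: le_trans (bernoulli_ge _ _); last by move: delta0 delta1; lra.
rewrite natrM -mulrA; move: Nmu Ndelta; lra.
Qed.

Lemma rho_gt0 : 0 < rho.
Proof. by rewrite /rate mulr_gt0 //; move: delta1; lra. Qed.

(** Divided by q^N this reads mu <= delta (1 - delta)^(N-1). With x = N mu it follows from (1 + 4 x)
    (1 - x (1 + 4 x)) >= 1, valid for 0 <= x <= 1/16. *)
Let Ubound : (count U (words A N))%:R <= delta * q * rho ^+ N.-1.
Proof.
have -> : (count U (words A N))%:R = mu * q ^+ N.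
  by rewrite /density divfK // expf_neq0 // gt_eqF.
rewrite /rate exprMn.
have -> : delta * q * (q ^+ N.-1 * (1 - delta) ^+ N.-1)
   = (delta * (1 - delta) ^+ N.-1) * q ^+ N by rewrite -[in RHS](prednK N0) exprS; ring.
apply: ler_wpM2r; first by rewrite exprn_ge0 // ltW.
have : 1 - N%:R * delta <= (1 - delta) ^+ N.-1.
  apply: (le_trans (bernoulli_ge N _)); first by move: delta0 delta1; lra.
  by apply: ler_wiXn2l; rewrite ?leq_pred //; move: delta0 delta1; lra.
move=> h; apply: le_trans (ler_wpM2l delta0 h).
rewrite /loss; move: Nmu x0; set x := N%:R * mu => hx h0.
have -> : mu * (1 + 4 * N%:R * mu) * (1 - N%:R * (mu * (1 + 4 * N%:R * mu))) =
   mu * ((1 + 4 * x) * (1 - x * (1 + 4 * x))) by rewrite /x; ring.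
rewrite ler_peMr //; nra.
Qed.

(** The induction hypothesis, used N - 1 times, bounds a (L + 1 - N) by rho^-(N-1) a L; by [Ubound]
    the term lost in [avcountS_ge] is then at most delta q a L. *)
Lemma avcount_growth L : rho * a L <= a L.+1.
Proof.
elim/ltn_ind: L => L IH.
have IHX j : (j <= L)%N -> rho ^+ j * a (L - j) <= a L.
  elim: j => [|j IHj] jL; first by rewrite expr0 mul1r subn0.
  rewrite exprSr -mulrA; apply: le_trans (IHj (ltnW jL)).
  apply: ler_wpM2l; first by rewrite exprn_ge0 // ltW // rho_gt0.
  have -> : (L - j = (L - j.+1).+1)%N by clear -jL; lia.
  by apply: IH; clear -jL; lia.
have := avcountS_ge A N0 UN L; rewrite -(ler_nat R) natrM natrD => h.
rewrite /rate; case: ifPn h => [NL|NL] h; last first.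
  rewrite mulrBr mulr1 mulrBl; have : 0 <= q * delta * a L by apply: mulr_ge0 => //; exact: mulr_ge0.
  by move: h; rewrite addr0; move: (a L) (a L.+1) => *; lra.
have h2 : (count U (words A N) * avcount U A (L.+1 - N))%:R <= delta * q * a L.
  have h3 := IHX N.-1 ltac:(clear -NL; lia).
  have e : (L - N.-1 = L.+1 - N)%N by clear -N0; lia.
  rewrite {}e in h3.
  have h4 : 0 <= delta * q by apply: mulr_ge0.
  apply: le_trans (ler_wpM2l h4 h3); rewrite natrM mulrA.
  exact: ler_wpM2r.
move: h h2; move: (_%:R) (a L) (a L.+1) => X Y Z h h2.
move: q delta h h2 => q' d' h h2; lra.
Qed.

Lemma avcount_growthX j L : rho ^+ j * a L <= a (L + j).
Proof.
elim: j => [|j IH]; first by rewrite expr0 mul1r addn0.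
rewrite exprS -mulrA addnS; apply: le_trans (avcount_growth _).
by rewrite ler_pM2l // rho_gt0.
Qed.

Lemma avcount_ge L : rho ^+ L <= a L.
Proof.
have := avcount_growthX L 0; rewrite add0n (avcount_small A N0 UN) //.
by rewrite expn0 mulr1.
Qed.

(** Avoiding [U] over at most 2 N further letters costs at most a factor 2. *)
Lemma avcount_back j L : (j <= L)%N -> (j <= 2 * N)%N ->
  a (L - j) <= 2 * a L / q ^+ j.
Proof.
move=> jL jN; rewrite ler_pdivlMr ?exprn_gt0 //.
have := avcount_growthX j (L - j); rewrite subnK // /rate exprMn => h.
have h1 := pow2N jN; have h2 : 0 <= a (L - j) * q ^+ j by rewrite mulr_ge0 // exprn_ge0 // ltW.
have := ler_wpM2l h2 h1; lra.
Qed.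

Lemma avcount_lower_back j L : (j <= L)%N -> a L <= a (L - j) * q ^+ j.
Proof.
elim: j => [|j IH] jL; first by rewrite subn0 expr0 mulr1.
apply: (le_trans (IH (ltnW jL))); rewrite exprS mulrA.
apply: ler_wpM2r; first by rewrite exprn_ge0 // ltW.
have -> : (L - j = (L - j.+1).+1)%N by clear -jL; lia.
rewrite -natrM ler_nat /avcount !count_sum -[(_ - _).+1]addn1.
have -> : ((\sum_(w <- words A (L - j.+1)) avoid U w) * size A =
    \sum_(w <- words A (L - j.+1 + 1)) avoid U (take (L - j.+1) w) * 1)%N.
  by rewrite (sum_words_split _ _ _ (fun u => avoid U u : nat) (fun=> 1%N))
    sum_const_words expn1 muln1.
apply: leq_sum => w _; have [av|//] := boolP (avoid U w).
by rewrite avoid_take.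
Qed.

(** The main term uses a (L + 1 - N) >= a L / q^(N-1), the overlap terms use [avcount_back]; its
    factor 2 is the one in 1 - 2 s. *)
Lemma avcount_upper (s : R) L : (2 * N <= L)%N ->
  \sum_(1 <= i < N) (retcount U A N i)%:R / q ^+ i <= s * (count U (words A N))%:R ->
  a L.+1 <= q * (1 - mu * (1 - 2 * s)) * a L.
Proof.
move=> NL hs.
have := avcountS_le A N0 UN NL.
rewrite -(ler_nat R) !natrD !natrM => h.
have h1 : (\sum_(1 <= i < N) avcount U A (L.+1 - N - i) * retcount U A N i)%:R <=
    2 * a L / q ^+ N.-1 * (s * (count U (words A N))%:R).
  rewrite natr_sum; apply: (@le_trans _ _
     (2 * a L / q ^+ N.-1 * \sum_(1 <= i < N) (retcount U A N i)%:R / q ^+ i)); last first.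
    by rewrite ler_wpM2l // !mulr_ge0 // invr_ge0 exprn_ge0 // ltW.
  rewrite mulr_sumr; rewrite big_nat [leRHS]big_nat.
  apply: ler_sum => i /andP[i1 iN]; rewrite natrM.
  have -> : (L.+1 - N - i = L - (N.-1 + i))%N by clear -N0; lia.
  have := @avcount_back (N.-1 + i)%N L; rewrite exprD => hb.
  rewrite [X in _ <= X](_ : _ = 2 * a L / (q ^+ N.-1 * q ^+ i) * (retcount U A N i)%:R); last first.
    by rewrite invfM; ring.
  by rewrite ler_wpM2r // hb //; clear -NL iN N0; lia.
have h2 : a L * q * mu <= (count U (words A N))%:R * a (L.+1 - N).
  have -> : (count U (words A N))%:R = mu * q ^+ N.
    by rewrite /density divfK // expf_neq0 // gt_eqF.
  have := @avcount_lower_back N.-1 L; have -> : (L - N.-1 = L.+1 - N)%N by clear -N0; lia.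
  have -> : q ^+ N = q * q ^+ N.-1 by rewrite -exprS prednK.
  move=> hb; have {}hb := hb ltac:(clear -NL; lia).
  have h0 : 0 <= mu * q by rewrite mulr_ge0 // ltW.
  have := ler_wpM2l h0 hb; lra.
have h3 : 2 * a L / q ^+ N.-1 * (s * (count U (words A N))%:R) = 2 * a L * s * q * mu.
  rewrite /density -[in q ^+ N](prednK N0) exprS invfM.
  by field; rewrite expf_neq0 // gt_eqF.
move: h h1 h2 h3.
rewrite /=; lra.
Qed.

(** The recursion holds from length 2 N on; at that length all words are counted. *)
Lemma avcount_upperX (s : R) L : 0 <= s <= 1 / 2 ->
  \sum_(1 <= i < N) (retcount U A N i)%:R / q ^+ i <= s * (count U (words A N))%:R ->
  a (2 * N + L) <= q ^+ (2 * N) * (q * (1 - mu * (1 - 2 * s))) ^+ L.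
Proof.
move=> s1 hs; elim: L => [|L IH].
  rewrite addn0 expr0 mulr1 -natrX ler_nat -size_words; exact: count_size.
rewrite addnS; apply: (le_trans (avcount_upper _ hs)); first by rewrite leq_addr.
rewrite exprS mulrCA; apply: ler_wpM2l => //.
apply: mulr_ge0; first exact: ltW.
have h1 : mu * (1 - 2 * s) <= mu by apply: ler_piMr => //; lra.
rewrite subr_ge0; apply: (le_trans h1); apply: (le_trans mu16); lra.
Qed.

(** A prefix sum of at most 1/4, doubled by [avcount_back], means that occurrences across the
    junction destroy at most half of the pairs. *)
Lemma mixed_growth (A0 : seq T) t1 d y0 k r : {subset A0 <= A} ->
  (N <= k)%N -> (N <= r)%N -> d \notin A0 -> (t1 < N)%N ->
  (forall w, all (mem A) w -> U w -> nth y0 w t1 = d) ->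
  \sum_(t1.+1 <= t < N) (prefcount U A t)%:R / q ^+ t <= 1 / 4 ->
  (size A0)%:R ^+ r * rho ^+ k / 2 <=
  (\sum_(u <- words A k) \sum_(v <- words A0 r) avoid U (u ++ v))%N%:R.
Proof.
move=> sA kN rN dA0 t1N Ud hs.
have := mixed_count N0 UN sA kN rN dA0 t1N Ud.
rewrite -(ler_nat R) natrD !natrM natrX; set p : R := _%:R ^+ r => h.
have p0 : 0 <= p by rewrite exprn_ge0.
have h1 : (\sum_(t1.+1 <= t < N) avcount U A (k - t) * prefcount U A t)%:R <= a k / 2.
  rewrite natr_sum; apply: (@le_trans _ _
     (2 * a k * \sum_(t1.+1 <= t < N) (prefcount U A t)%:R / q ^+ t)).
    rewrite mulr_sumr; rewrite big_nat [leRHS]big_nat.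
    apply: ler_sum => t /andP[t1t tN]; rewrite natrM.
    have := @avcount_back t k; move=> hb.
    rewrite [X in _ <= X](_ : _ = 2 * a k / q ^+ t * (prefcount U A t)%:R); last by ring.
    by rewrite ler_wpM2r // hb //; clear -tN kN; lia.
  have := ler_wpM2l (ler0n R (avcount U A k)) hs; lra.
have h2 := avcount_ge k.
have := ler_wpM2l p0 h1; have := ler_wpM2l p0 h2; move: h; lra.
Qed.

End Growth.

(** Up to k0 the terms are at most 16 q^-i, a geometric series. Beyond k0 the numerator grows at
    most as fast as q^i, so each of the fewer than N remaining terms is at most 16 q^-k0. Finally q
    >= 2. *)
Lemma prefcount_sum (R : realType) (T : eqType) (U : pred (seq T)) (A : seq T) (J k0 N : nat) :
  (1 < size A)%N ->
  (forall i, (i <= k0)%N -> (prefcount U A i <= 16)%N) ->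
  \sum_(J.+1 <= i < N) (prefcount U A i)%:R / (size A)%:R ^+ i <=
  16 * ((1 / 2) ^+ J + N%:R * (1 / 2) ^+ k0) :> R.
Proof.
move=> A1 hp; set q : R := (size A)%:R.
have q2 : 2 <= q by rewrite ler_nat.
have q0 : 0 < q by lra.
have qV i : (q ^+ i)^-1 <= (1 / 2) ^+ i.
  rewrite -exprVn div1r; apply: lerXn2r; rewrite ?nnegrE ?invr_ge0 //.
  by rewrite lef_pV2 ?posrE.
have hi i : (prefcount U A i)%:R / q ^+ i <= 16 * ((1 / 2) ^+ i + (1 / 2) ^+ k0).
  have [ik|ik] := leqP i k0.
    apply: (@le_trans _ _ (16 * (1 / 2) ^+ i)).
      apply: ler_pM => //; first by rewrite invr_ge0 exprn_ge0 // ltW.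
      by rewrite ler_nat hp.
    by rewrite ler_pM2l // lerDl exprn_ge0 //; lra.
  apply: (@le_trans _ _ (16 * (1 / 2) ^+ k0)); last first.
    by rewrite ler_pM2l // lerDr exprn_ge0 //; lra.
  have : (prefcount U A i <= 16 * size A ^ (i - k0))%N.
    have {1}-> : i = (k0 + (i - k0))%N by clear -ik; lia.
    by apply: (leq_trans (prefcountD _ _ _ _)); rewrite leq_mul2r hp ?orbT.
  rewrite -(ler_nat R) natrM natrX -/q => h.
  have {2}-> : i = (i - k0 + k0)%N by clear -ik; lia.
  rewrite exprD invfM mulrA; apply: ler_pM => //.
  - by rewrite mulr_ge0 // invr_ge0 exprn_ge0 // ltW.
  - by rewrite invr_ge0 exprn_ge0 // ltW.
  - by rewrite ler_pdivrMr ?exprn_gt0.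
apply: (@le_trans _ _ (\sum_(J.+1 <= i < N) 16 * ((1 / 2) ^+ i + (1 / 2) ^+ k0))).
  by apply: ler_sum.
rewrite -mulr_sumr ler_pM2l // big_split /=; apply: lerD.
  have h K : \sum_(J.+1 <= i < J.+1 + K) (1 / 2) ^+ i = (1 / 2) ^+ J - (1 / 2) ^+ (J + K) :> R.
    elim: K => [|K IH]; first by rewrite addn0 big_geq // addn0 subrr.
    rewrite addnS big_nat_recr ?leq_addr //= IH !addnS addSn exprS; lra.
  have [JN|NJ] := leqP J.+1 N.
    rewrite -(subnKC JN) h lerBlDr lerDl exprn_ge0 //; lra.
  by rewrite big_geq ?(ltnW NJ) // exprn_ge0 //; lra.
rewrite sumr_const_nat -[X in X <= _]mulr_natl; apply: ler_wpM2r.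
  by apply: exprn_ge0; lra.
by rewrite ler_nat leq_subr.
Qed.

(** * Distances on the torus and digit expansions *)

Section CircleNorm.
Variable R : realType.
Implicit Types (x y t : R).

Lemma frac_itv t : 0 <= frac t < 1.
Proof.
have /andP[h1 h2] := floor_itv t; rewrite intrD mulr1z in h2.
by rewrite /Defs.frac subr_ge0 h1 ltrBlDl.
Qed.

(** The distance to the nearest integer; [circle_dist x y] unfolds to [cnorm (x - y)]. *)
Definition cnorm t : R := Num.min (frac t) (1 - frac t).

(** With [cnorm_le] this presents [cnorm] as a minimum over the integers, from which its seminorm
    properties follow without fractional parts. *)
Lemma cnormE t : exists a : int, cnorm t = `|t - a%:~R|.
Proof.
have /andP[h0 h1] := frac_itv t; rewrite /cnorm; case: leP => h.
  by exists (Num.floor t); rewrite -/(frac t) ger0_norm.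
exists (Num.floor t + 1).
have -> : t - (Num.floor t + 1)%:~R = - (1 - frac t).
  by rewrite /Defs.frac intrD mulr1z; ring.
by rewrite normrN ger0_norm // subr_ge0 ltW.
Qed.

Lemma cnorm_le t (a : int) : cnorm t <= `|t - a%:~R|.
Proof.
have /andP[h0 h1] := frac_itv t.
have -> : t - a%:~R = frac t + (Num.floor t - a)%:~R.
  by rewrite /Defs.frac intrD mulrNz; ring.
rewrite /cnorm ge_min; move: (Num.floor t - a) => k.
have [k0|k0] := leP 0 k.
  have hk : 0 <= k%:~R :> R by rewrite ler0z.
  apply/orP; left; apply: le_trans (ler_norm _); lra.
have k1 : k%:~R <= -1 :> R.
  by rewrite -[- 1](mulrN1z 1) ler_int -ltzD1 addNr.
by apply/orP; right; rewrite ler0_norm; lra.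
Qed.

Lemma cnorm_ge0 t : 0 <= cnorm t.
Proof. by have [a ->] := cnormE t. Qed.

Lemma cnorm_norm t : cnorm t <= `|t|.
Proof. by have := cnorm_le t 0; rewrite subr0. Qed.

Lemma cnormD s t : cnorm (s + t) <= cnorm s + cnorm t.
Proof.
have [a ->] := cnormE s; have [b ->] := cnormE t.
apply: (le_trans (cnorm_le _ (a + b))); apply: le_trans (ler_normD _ _).
by rewrite intrD opprD addrACA.
Qed.

Lemma cnormN t : cnorm (- t) = cnorm t.
Proof.
suff h s : cnorm (- s) <= cnorm s by apply/eqP; rewrite eq_le h -{1}[t]opprK h.
have [a ->] := cnormE s; apply: (le_trans (cnorm_le _ (- a))).
by rewrite mulrNz -opprD normrN.
Qed.

Lemma cnormDint t (a : int) : cnorm (t + a%:~R) = cnorm t.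
Proof.
suff h s (b : int) : cnorm (s + b%:~R) <= cnorm s.
  apply/eqP; rewrite eq_le h /=; have := h (t + a%:~R) (- a).
  by rewrite mulrNz addrK.
have [c ->] := cnormE s; apply: (le_trans (cnorm_le _ (c + b))).
by rewrite intrD opprD addrACA subrr addr0.
Qed.

Lemma cnormB s t : cnorm (s - t) = cnorm (t - s).
Proof. by rewrite -cnormN opprB. Qed.

Lemma cnormMn (k : nat) t : cnorm (k%:R * t) <= k%:R * cnorm t.
Proof.
have [a ->] := cnormE t; apply: (le_trans (cnorm_le _ (k%:Z * a))).
by rewrite intrM -mulrBr normrM ger0_norm // ?ler0n.
Qed.

Lemma cnorm_eq0 t : cnorm t = 0 -> exists a : int, t = a%:~R.
Proof.
have [a ->] := cnormE t => /eqP; rewrite normr_eq0 subr_eq0 => /eqP ->.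
by exists a.
Qed.

Lemma cnorm_int (a : int) : cnorm a%:~R = 0.
Proof.
apply/eqP; rewrite eq_le cnorm_ge0 andbT.
by have := cnorm_le a%:~R a; rewrite subrr normr0.
Qed.

Lemma fracDint t (a : int) : frac (t + a%:~R) = frac t.
Proof.
rewrite /Defs.frac; have -> : Num.floor (t + a%:~R) = Num.floor t + a.
  by rewrite floorDrz ?intrKfloor // intr_int.
by rewrite intrD; ring.
Qed.

Lemma frac_id t : 0 <= t < 1 -> frac t = t.
Proof.
move=> h; rewrite /Defs.frac (_ : Num.floor t = 0) ?subr0 //.
by apply/eqP; rewrite floor_eq add0r mulr0z mulr1z.
Qed.

Lemma circle_eq x y : circle x -> circle y -> cnorm (x - y) = 0 -> x = y.
Proof.
rewrite /circle /= => hx hy /cnorm_eq0[a h].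
by rewrite -(frac_id hx) -(frac_id hy) -(fracDint y a) -h addrC subrK.
Qed.

(* A base-b cell [X/b, (X+1)/b] within 1/b of x is one of the four cells
   numbered floor(bx) - 2, ..., floor(bx) + 1 modulo b. *)
Lemma near_cells (b : nat) x : (0 < b)%N -> exists2 S : seq nat, (size S <= 4)%N &
  forall (X : nat) (q : R), (X < b)%N -> 0 <= q <= 1 ->
    cnorm (x - (X%:R + q) / b%:R) <= b%:R^-1 -> X \in S.
Proof.
move=> b0; pose f := Num.floor (b%:R * x).
exists [seq `|(((f + s) %% b%:Z)%Z)|%N | s <- [:: -2; -1; 0; 1] : seq int] => //.
move=> X q Xb q01; have [a ->] := cnormE (x - (X%:R + q) / b%:R) => h.
have bR : 0 < b%:R :> R by rewrite ltr0n.
pose V : int := a * b%:Z + X%:Z.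
have XV : X = `|(V %% b%:Z)%Z|%N by rewrite /V modzMDl modz_small //; lia.
have VR : V%:~R = a%:~R * b%:R + X%:R :> R by rewrite /V intrD intrM.
have {}h : `|b%:R * x - V%:~R - q| <= 1.
  have := ler_wpM2l (ltW bR) h; rewrite divff ?gt_eqF //.
  rewrite -{1}[b%:R]ger0_norm ?(ltW bR) // -normrM VR.
  suff -> : b%:R * x - (a%:~R * b%:R + X%:R) - q = b%:R * (x - (X%:R + q) / b%:R - a%:~R) by [].
  by field; exact: lt0r_neq0.
have := floor_itv (b%:R * x); rewrite -/f intrD mulr1z => /andP[f1 f2].
move: h; rewrite ler_norml => /andP[h1 h2].
have V1 : V <= f + 1.
  by rewrite -ltzD1 -(ltr_int R) !intrD !mulr1z; lra.
have V2 : f - 2 <= V.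
  rewrite -(ler_int R) intrD mulrNz; have -> : 2%:~R = 2 :> R by []; lra.
rewrite XV; apply/mapP; exists (V - f); last by rewrite addrC subrK.
rewrite !inE; lia.
Qed.

End CircleNorm.

Section Torus.
Variable R : realType.
Implicit Types (z w c : R * R).

Lemma torus_distE z w : torus_dist z w =
  Num.sqrt (cnorm (z.1 - w.1) ^+ 2 + cnorm (z.2 - w.2) ^+ 2).
Proof. by []. Qed.

Lemma torus_dist_ltE z w e : 0 < e -> (torus_dist z w < e) =
  (cnorm (z.1 - w.1) ^+ 2 + cnorm (z.2 - w.2) ^+ 2 < e ^+ 2).
Proof.
move=> e0; rewrite torus_distE -[in LHS](ger0_norm (ltW e0)) -sqrtr_sqr ltr_sqrt //.
by rewrite exprn_gt0.
Qed.

Lemma torus_dist_lt z w e : torus_dist z w < e ->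
  cnorm (z.1 - w.1) < e /\ cnorm (z.2 - w.2) < e.
Proof.
move=> h; have e0 : 0 < e by apply: le_lt_trans h; exact: sqrtr_ge0.
move: h; rewrite torus_dist_ltE //.
have := cnorm_ge0 (z.1 - w.1); have := cnorm_ge0 (z.2 - w.2).
move: (cnorm _) (cnorm _) => a b b0 a0 h.
split; rewrite -(ltr_pXn2r (n := 2)) ?nnegrE ?(ltW e0) //.
  by apply: le_lt_trans h; rewrite lerDl sqr_ge0.
by apply: le_lt_trans h; rewrite lerDr sqr_ge0.
Qed.

Lemma torus_dist_leD z w : torus_dist z w <= cnorm (z.1 - w.1) + cnorm (z.2 - w.2).
Proof.
have := cnorm_ge0 (z.1 - w.1); have := cnorm_ge0 (z.2 - w.2).
rewrite torus_distE; move: (cnorm _) (cnorm _) => a b b0 a0.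
rewrite -[leRHS]ger0_norm ?addr_ge0 // -sqrtr_sqr ler_sqrt ?sqr_ge0 //.
by rewrite sqrrD; have : 0 <= a * b by [rewrite mulr_ge0]; lra.
Qed.

Lemma torus_dist_int z w (a b : int) :
  torus_dist z (w.1 + a%:~R, w.2 + b%:~R) = torus_dist z w.
Proof.
rewrite !torus_distE /= !opprD !addrA -!mulrNz.
by rewrite !cnormDint.
Qed.

Lemma torus_dist_toTorus z w : torus_dist z (toTorus w) = torus_dist z w.
Proof.
rewrite -(torus_dist_int z (toTorus w) (Num.floor w.1) (Num.floor w.2)).
by rewrite /toTorus /Defs.frac /= !subrK -surjective_pairing.
Qed.

Lemma toTorus_torus w : torus (toTorus w).
Proof. by split; exact: frac_itv. Qed.

Lemma toTorus_id w : torus w -> toTorus w = w.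
Proof. by case: w => x y [/= hx hy]; rewrite /toTorus /= !frac_id. Qed.

Lemma torus_dist_eq z w : torus z -> torus w -> torus_dist z w = 0 -> z = w.
Proof.
case: z w => [x y] [x' y'] [/= hx hy] [/= hx' hy'] h.
suff [h1 h2] : cnorm (x - x') = 0 /\ cnorm (y - y') = 0.
  by rewrite (circle_eq hx hx' h1) (circle_eq hy hy' h2).
split; apply/eqP; rewrite eq_le cnorm_ge0 andbT; apply/ler_addgt0Pr => e e0; rewrite add0r.
  by rewrite ltW //; apply: (@torus_dist_lt (x, y) (x', y') e _).1; rewrite h.
by rewrite ltW //; apply: (@torus_dist_lt (x, y) (x', y') e _).2; rewrite h.
Qed.

Lemma torus_ball_toTorus z e w : torus_ball z e (toTorus w) <-> torus_dist z w < e.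
Proof.
by rewrite /torus_ball /= torus_dist_toTorus; split => [[]|h] //; split=> //; exact: toTorus_torus.
Qed.

End Torus.

Section Digits.
Local Open Scope nat_scope.

(** The most significant digit comes first, so that a prefix of the word numbers the coarser
    cell. *)
Fixpoint num (b : nat) (s : seq nat) : nat :=
  if s is c :: s' then c * b ^ size s' + num b s' else 0.

Lemma num_cat b s t : num b (s ++ t) = num b s * b ^ size t + num b t.
Proof.
elim: s => [|c s IH] //=; rewrite IH size_cat expnD; ring.
Qed.

Lemma num_lt b s : all (fun c => c < b) s -> num b s < b ^ size s.
Proof.
elim: s => [|c s IH] //= /andP[cb /IH h]; rewrite expnS.
by apply: (@leq_trans (c.+1 * b ^ size s)); rewrite ?leq_mul2r ?cb ?orbT // mulSn addnC ltn_add2r.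
Qed.

Lemma num_inj b s t : size s = size t -> all (fun c => c < b) s -> all (fun c => c < b) t ->
  num b s = num b t -> s = t.
Proof.
elim: s t => [|c s IH] [|d t] //= [st] /andP[cb sb] /andP[db tb] e.
have hs := num_lt sb; have ht := num_lt tb; rewrite st in hs e.
have bt : 0 < b ^ size t by exact: leq_ltn_trans ht.
have ec : c = d.
  by have := congr1 (fun x => x %/ b ^ size t) e; rewrite !divnMDl // !divn_small // !addn0.
rewrite ec in e *; congr cons; apply: IH => //.
by move/addnI: e.
Qed.

End Digits.

(** * Cylinders of words of digits *)

Section BMWords.
Variables (R : realType) (n m : nat).
Hypotheses (n0 : (0 < n)%N) (m0 : (0 < m)%N).
Implicit Types (w u v : seq ('I_n * 'I_m)) (z : R * R).

(** The first letter acts last. The image of the unit square is the cylinder of w, of width n^-L and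
    height m^-L with L = size w. *)
Definition bmw w z : R * R := foldr (@bm_map R n m) z w.

Definition xd w : seq nat := [seq nat_of_ord d.1 | d <- w].
Definition yd w : seq nat := [seq nat_of_ord d.2 | d <- w].
Definition xnum w := num n (xd w).
Definition ynum w := num m (yd w).

Lemma bmw_cat u v z : bmw (u ++ v) z = bmw u (bmw v z).
Proof. exact: foldr_cat. Qed.

Lemma size_xd w : size (xd w) = size w. Proof. exact: size_map. Qed.
Lemma size_yd w : size (yd w) = size w. Proof. exact: size_map. Qed.

Lemma all_xd w : all (fun c => (c < n)%N) (xd w).
Proof. by apply/allP => c /mapP[d _ ->]. Qed.
Lemma all_yd w : all (fun c => (c < m)%N) (yd w).
Proof. by apply/allP => c /mapP[d _ ->]. Qed.

Lemma xnum_lt w : (xnum w < n ^ size w)%N.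
Proof. by rewrite -size_xd num_lt // all_xd. Qed.
Lemma ynum_lt w : (ynum w < m ^ size w)%N.
Proof. by rewrite -size_yd num_lt // all_yd. Qed.

Lemma xynum_inj u v : size u = size v -> xnum u = xnum v -> ynum u = ynum v -> u = v.
Proof.
move=> s hx hy.
have {}hx : xd u = xd v by apply: num_inj hx; rewrite ?all_xd // !size_xd.
have {}hy : yd u = yd v by apply: num_inj hy; rewrite ?all_yd // !size_yd.
elim: u v s hx hy => [|[i j] u IH] [|[i' j'] v] //= [s] [/ord_inj -> hx] [/ord_inj -> hy].
by rewrite (IH v).
Qed.

Lemma ynum_cat u v : ynum (u ++ v) = (ynum u * m ^ size v + ynum v)%N.
Proof. by rewrite /ynum /yd map_cat num_cat size_map. Qed.

Lemma bmwE w z : bmw w z = (((xnum w)%:R + z.1) / n%:R ^+ size w,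
                            ((ynum w)%:R + z.2) / m%:R ^+ size w).
Proof.
have nR : n%:R != 0 :> R by rewrite pnatr_eq0 -lt0n.
have mR : m%:R != 0 :> R by rewrite pnatr_eq0 -lt0n.
elim: w => [|[i j] w IH] /=.
  by rewrite !add0r !expr0 !divr1 -surjective_pairing.
rewrite -/(bmw _ _) IH /bm_map /xnum /ynum /= size_xd size_yd !natrD !natrM !natrX !exprS.
by congr pair; field; rewrite ?expf_neq0 ?nR ?mR //.
Qed.

Definition unit_square : set (R * R) := [set z | 0 <= z.1 <= 1 /\ 0 <= z.2 <= 1].

(** The integers are left existential, since all distances are invariant under integer
    translations. *)
Lemma iter_torus_map k z : exists a b : int,
  iter k (@torus_map R n m) z = (n%:R ^+ k * z.1 + a%:~R, m%:R ^+ k * z.2 + b%:~R).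
Proof.
elim: k => [|k [a [b IH]]].
  by exists 0, 0; rewrite !expr0 !mul1r !addr0 -surjective_pairing.
rewrite iterS IH /torus_map /=; set x := n%:R * _; set y := m%:R * _.
exists (n%:Z * a - Num.floor x), (m%:Z * b - Num.floor y).
rewrite /Defs.frac !intrD !intrM !mulrNz -/x -/y !exprS.
by congr pair; rewrite ?[in LHS]/x ?[in LHS]/y -!pmulrn; ring.
Qed.

Lemma iter_torus k z : torus z -> torus (iter k (@torus_map R n m) z).
Proof. by case: k => [|k] // _; rewrite iterS; split; exact: frac_itv. Qed.

Lemma toTorus_bmw_iter u z : 
  exists a b : int, iter (size u) (@torus_map R n m) (toTorus (bmw u z)) =
    (z.1 + a%:~R, z.2 + b%:~R).
Proof.
have nR : n%:R ^+ size u != 0 :> R by rewrite expf_neq0 // pnatr_eq0 -lt0n.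
have mR : m%:R ^+ size u != 0 :> R by rewrite expf_neq0 // pnatr_eq0 -lt0n.
have [a [b ->]] := iter_torus_map (size u) (toTorus (bmw u z)).
rewrite /toTorus /= /Defs.frac; set f := Num.floor _; set g := Num.floor _.
exists ((xnum u)%:Z - (n ^ size u)%:Z * f + a), ((ynum u)%:Z - (m ^ size u)%:Z * g + b).
rewrite bmwE /= !intrD !mulrNz !intrM -!pmulrn !natrX.
by congr pair; field.
Qed.

Lemma torus_dist_iter c u z :
  torus_dist c (iter (size u) (@torus_map R n m) (toTorus (bmw u z))) = torus_dist c z.
Proof. by have [a [b ->]] := toTorus_bmw_iter u z; rewrite torus_dist_int. Qed.

Lemma bmw_unit u z : unit_square z -> unit_square (bmw u z).
Proof.
move=> [/andP[h1 h2] /andP[h3 h4]]; rewrite bmwE; split => /=.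
  have hn : 0 < n%:R ^+ size u :> R by rewrite exprn_gt0 // ltr0n.
  apply/andP; split; first by rewrite divr_ge0 ?addr_ge0 // ltW.
  rewrite ler_pdivrMr // mul1r -natrX.
  by apply: (@le_trans _ _ ((xnum u)%:R + 1)); rewrite ?lerD2l // natr1 ler_nat xnum_lt.
have hm : 0 < m%:R ^+ size u :> R by rewrite exprn_gt0 // ltr0n.
apply/andP; split; first by rewrite divr_ge0 ?addr_ge0 // ltW.
rewrite ler_pdivrMr // mul1r -natrX.
by apply: (@le_trans _ _ ((ynum u)%:R + 1)); rewrite ?lerD2l // natr1 ler_nat ynum_lt.
Qed.

Lemma unit_diff (p q : R) : 0 <= p <= 1 -> 0 <= q <= 1 -> `|p - q| <= 1.
Proof. by move=> hp hq; rewrite ler_norml; lra. Qed.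

Lemma bmw_diff u z z' : unit_square z -> unit_square z' ->
  `|(bmw u z).1 - (bmw u z').1| <= (n%:R ^+ size u)^-1 /\
  `|(bmw u z).2 - (bmw u z').2| <= (m%:R ^+ size u)^-1.
Proof.
move=> [h1 h2] [h3 h4]; rewrite !bmwE /=.
have e (x a b c : R) : (x + a) / c - (x + b) / c = (a - b) / c by ring.
rewrite !e; split; rewrite normrM [`|_^-1|]ger0_norm ?invr_ge0 ?exprn_ge0 //.
  by apply: ler_piMl; rewrite ?invr_ge0 ?exprn_ge0 // unit_diff.
by apply: ler_piMl; rewrite ?invr_ge0 ?exprn_ge0 // unit_diff.
Qed.

End BMWords.

Lemma exprn_small (R : realType) (c : R) (e : R) : 0 <= c < 1 -> 0 < e ->
  exists k0, forall k, (k0 <= k)%N -> c ^+ k < e.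
Proof.
move=> /andP[c0 c1] e0; have : `|c| < 1 by rewrite ger0_norm.
move=> /cvg_expr /cvgrPdist_lt /(_ e e0)[k0 _ h]; exists k0 => k hk.
by have := h k hk; rewrite sub0r normrN ger0_norm // exprn_ge0.
Qed.

Lemma expVn_small (R : realType) (b : nat) (M e : R) : (1 < b)%N -> 0 < e ->
  exists k, M / b%:R ^+ k < e.
Proof.
move=> b1 e0; have bR : 1 < b%:R :> R by rewrite ltr1n.
have [k0 h] := @exprn_small R (b%:R^-1) (e / (`|M| + 1)) ltac:(by
  rewrite invr_ge0 ltW ?(lt_trans ltr01) //= invf_lt1 // (lt_trans ltr01)) ltac:(by
  rewrite divr_gt0 // ltr_wpDl).
exists k0; have := h k0 (leqnn _); rewrite exprVn ltr_pdivlMr ?ltr_wpDl // mulrC => h'.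
apply: le_lt_trans h'; apply: ler_wpM2r; first by rewrite invr_ge0 exprn_ge0.
by apply: le_trans (ler_norm M) _; rewrite lerDl.
Qed.

Lemma le_expVn (R : realType) (b : nat) (M x y : R) : (1 < b)%N ->
  (forall k, x <= y + M / b%:R ^+ k) -> x <= y.
Proof.
move=> b1 h; apply/ler_addgt0Pr => e e0.
have [k hk] := expVn_small M b1 e0.
by apply: (le_trans (h k)); rewrite lerD2l ltW.
Qed.

(** * Symbolic coding of the attractor and of survivor sets *)

Section Attractor.
Variables (R : realType) (n m : nat).
Hypotheses (m2 : (1 < m)%N) (mn : (m < n)%N).
Variables (D : {set 'I_n * 'I_m}) (K : set (R * R)).
Hypothesis hK : is_attractor D K.
Let X := @toTorus R @` K.
Implicit Types (w u v : seq ('I_n * 'I_m)) (z : R * R).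

Let n2 : (1 < n)%N. Proof. exact: ltn_trans mn. Qed.
Let n0 : (0 < n)%N. Proof. exact: ltnW. Qed.
Let m0 : (0 < m)%N. Proof. exact: ltnW. Qed.

Lemma attractor_step d z : d \in D -> K z -> K (bm_map d z).
Proof. by move=> dD Kz; case: hK => _ _ ->; exists d => //; exists z. Qed.

Lemma attractor_bmw w z : all (mem D) w -> K z -> K (bmw w z).
Proof. by elim: w => //= d w IH /andP[dD wD] Kz; apply: attractor_step => //; exact: IH. Qed.

Lemma words_D w L : w \in words (enum D) L -> size w = L /\ all (mem D) w.
Proof.
rewrite mem_words => /andP[/eqP -> wD]; split=> //.
by apply: sub_all wD => d; rewrite /= mem_enum.
Qed.

Lemma mem_wordsD w : all (mem D) w -> w \in words (enum D) (size w).
Proof.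
by move=> wD; rewrite mem_words eqxx /=; apply: sub_all wD => d; rewrite /= mem_enum.
Qed.

Lemma attractor_decomp L z : K z -> exists2 w, w \in words (enum D) L &
  exists2 k, K k & z = bmw w k.
Proof.
elim: L z => [|L IH] z Kz; first by exists [::]; rewrite ?mem_words //; exists z.
have : K z by []; case: hK => _ _ {1}-> [d dD [z' Kz' <-]].
have [w wL [k Kk ->]] := IH _ Kz'.
exists (d :: w); last by exists k.
have [sw wD] := words_D wL; rewrite -sw -[(size w).+1]/(size (d :: w)).
by apply: mem_wordsD; rewrite /= wD andbT.
Qed.

(** K is compact, hence bounded by some B. A point written as [bmw w k] with size w = L is then
    within B n^-L and B m^-L of the unit square, and L is arbitrary. *)
Lemma attractor_unit z : K z -> unit_square z.
Proof.
have [_ cK _] := hK; have [M [_ hM]] := compact_bounded cK.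
have {}hM k : K k -> `|k.1| <= `|M| + 1 /\ `|k.2| <= `|M| + 1.
  move=> Kk; have : `|k| <= `|M| + 1 by apply: hM => //; rewrite (le_lt_trans (ler_norm M)) ?ltrDl.
  by rewrite {1}/Num.norm /= ge_max => /andP[].
set B := `|M| + 1 in hM.
have bnd (b L x : nat) (k : R) : (0 < b)%N -> (x < b ^ L)%N -> `|k| <= B ->
    (x%:R + k) / b%:R ^+ L <= 1 + B / b%:R ^+ L /\ 0 <= (x%:R + k) / b%:R ^+ L + B / b%:R ^+ L.
  move=> b0 xb; rewrite ler_norml => /andP[k1 k2].
  have bL : 0 < b%:R ^+ L :> R by rewrite exprn_gt0 // ltr0n.
  rewrite -mulrDl; split; last first.
    by apply: divr_ge0; [have : 0 <= x%:R :> R by []; lra|exact: ltW].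
  rewrite ler_pdivrMr // mulrDl divfK ?gt_eqF // mul1r; apply: lerD => //.
  by rewrite -natrX ler_nat ltnW.
move=> Kz; split; apply/andP; split.
- apply: (@le_expVn R n B) => // L; have [w /words_D[<- _] [k Kk ->]] := attractor_decomp L Kz.
  rewrite bmwE //=; exact: (bnd n _ _ _ n0 (xnum_lt _) (hM _ Kk).1).2.
- apply: (@le_expVn R n B) => // L; have [w /words_D[<- _] [k Kk ->]] := attractor_decomp L Kz.
  rewrite bmwE //=; exact: (bnd n _ _ _ n0 (xnum_lt _) (hM _ Kk).1).1.
- apply: (@le_expVn R m B) => // L; have [w /words_D[<- _] [k Kk ->]] := attractor_decomp L Kz.
  rewrite bmwE //=; exact: (bnd m _ _ _ m0 (ynum_lt _) (hM _ Kk).2).2.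
- apply: (@le_expVn R m B) => // L; have [w /words_D[<- _] [k Kk ->]] := attractor_decomp L Kz.
  rewrite bmwE //=; exact: (bnd m _ _ _ m0 (ynum_lt _) (hM _ Kk).2).1.
Qed.

Lemma bmw_continuous w : continuous (@bmw R n m w).
Proof.
move=> z; have -> : @bmw R n m w = fun z => (((xnum w)%:R + z.1) / n%:R ^+ size w,
                            ((ynum w)%:R + z.2) / m%:R ^+ size w).
  by apply/funext => z'; rewrite bmwE.
have h1 : (fun z : R * R => ((xnum w)%:R + z.1) / n%:R ^+ size w) @ z -->
    ((xnum w)%:R + z.1) / n%:R ^+ size w.
  by apply: cvgM; [apply: cvgD; [exact: cvg_cst|exact: cvg_fst]|exact: cvg_cst].
have h2 : (fun z : R * R => ((ynum w)%:R + z.2) / m%:R ^+ size w) @ z -->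
    ((ynum w)%:R + z.2) / m%:R ^+ size w.
  by apply: cvgM; [apply: cvgD; [exact: cvg_cst|exact: cvg_snd]|exact: cvg_cst].
exact: (cvg_pair h1 h2).
Qed.

(** Take a cluster point of the images of k0 under the prefixes of s. For each L the image of K
    under the prefix of length L is closed and contains all of them from index L on. *)
Lemma coding_point (s : nat -> 'I_n * 'I_m) : (forall i, s i \in D) ->
  exists2 x, K x & forall L, exists2 k, K k & x = bmw (mkseq s L) k.
Proof.
move=> sD; have [[k0 Kk0] cK _] := hK.
have msD L : all (mem D) (mkseq s L) by apply/allP => d /mapP[i _ ->]; exact: sD.
pose g L := @bmw R n m (mkseq s L) @` K.
have gM i M : (i <= M)%N -> g i (bmw (mkseq s M) k0).
  move=> iM; exists (bmw (mkseq (fun j => s (i + j)%N) (M - i)) k0).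
    by apply: attractor_bmw => //; apply/allP => d /mapP[j _ ->]; exact: sD.
  rewrite -bmw_cat; congr bmw.
  apply: (@eq_from_nth _ (s 0%N)); first by rewrite size_cat !size_mkseq subnKC.
  move=> j; rewrite size_cat !size_mkseq subnKC // => jM.
  rewrite nth_cat size_mkseq [RHS]nth_mkseq //; case: ltnP => ji; first by rewrite nth_mkseq.
  by rewrite nth_mkseq ?subnKC //; lia.
pose F := (fun M => bmw (mkseq s M) k0) @ \oo.
have FK : F K by exists 0%N => // M _; exact: attractor_bmw.
have [x [Kx Fx]] := cK F _ FK.
exists x => // L; have cg : closed (g L).
  apply: compact_closed; first exact: norm_hausdorff.
  by apply: continuous_compact => //; apply: continuous_subspaceT; exact: bmw_continuous.
have [k Kk <-] : g L x; last by exists k.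
apply: cg => B Bx; have FgL : F (g L) by exists L => // M /= LM; exact: gM.
exact: Fx.
Qed.

(** Cylinders are images of the closed square, not of K. Inner and outer words are compared with the
    ball through [torus_dist], so that cylinders need not be reduced modulo 1. *)
Definition inner_hole z e N : pred (seq ('I_n * 'I_m)) := fun w =>
  (size w == N) && `[< forall q, unit_square q -> torus_dist z (bmw w q) < e >].

Definition outer_hole z e N : pred (seq ('I_n * 'I_m)) := fun w =>
  (size w == N) && `[< exists2 q, unit_square q & torus_dist z (bmw w q) < e >].

Lemma unit_square0 : unit_square (0 : R * R).
Proof. by split; rewrite /= lexx ler01. Qed.

Lemma inner_outer z e N w : inner_hole z e N w -> outer_hole z e N w.
Proof.
move=> /andP[sw /asboolP h]; rewrite /outer_hole sw; apply/asboolP.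
by exists 0; [exact: unit_square0|apply: h; exact: unit_square0].
Qed.

(** An inner word at position size a of the code would put the iterate of y of order size a into the
    ball. Together with [survivor_of_code] this encloses the survivors between sequences avoiding
    outer words and sequences avoiding inner words. *)
Lemma survivor_code z e N L y : survivor n m X (torus_ball z e) y ->
  exists2 w, w \in words (enum D) L & avoid (inner_hole z e N) w /\
    exists2 k, unit_square k & y = toTorus (bmw w k).
Proof.
move=> [[x Kx <-] hy]; have [w wL [k Kk xk]] := attractor_decomp L Kx.
exists w => //; split; last by exists k; [exact: attractor_unit|rewrite xk].
apply/avoidP => a b c wabc; apply/negP => /andP[_ /asboolP h].
apply: (hy (size a)); split; first by apply: iter_torus; exact: toTorus_torus.
rewrite xk wabc bmw_cat torus_dist_iter // bmw_cat; apply: h.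
by apply: bmw_unit => //; exact: attractor_unit.
Qed.

Lemma survivor_of_code z e N (s : nat -> 'I_n * 'I_m) : (forall i, s i \in D) ->
  (forall L, avoid (outer_hole z e N) (mkseq s L)) ->
  exists2 y, survivor n m X (torus_ball z e) y &
    forall L, exists2 k, unit_square k & y = toTorus (bmw (mkseq s L) k).
Proof.
move=> sD av; have [x Kx hx] := coding_point sD.
exists (toTorus x); last first.
  by move=> L; have [k Kk ->] := hx L; exists k => //; exact: attractor_unit.
split; first by exists x.
move=> i [_]; have [k Kk ->] := hx (i + N)%N.
have e1 : mkseq s (i + N) = mkseq s i ++ mkseq (fun j => s (i + j)%N) N.
  by rewrite /mkseq iotaD map_cat add0n -[in X in _ ++ X](addn0 i) iotaDl -map_comp.
rewrite e1 bmw_cat -{1}(size_mkseq s i) torus_dist_iter // => h.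
have /avoidP := av (i + N)%N.
move=> /(_ (mkseq s i) (mkseq (fun j => s (i + j)%N) N) [::]); rewrite cats0 => /(_ e1).
rewrite /outer_hole size_mkseq eqxx /= => /asboolPn; apply.
by exists k => //; exact: attractor_unit.
Qed.

End Attractor.

(** * Covering numbers and box dimensions *)

Section Covering.
Variables (R : realType) (n m : nat).
Hypotheses (n0 : (0 < n)%N) (m0 : (0 < m)%N).
Implicit Types (w u v : seq ('I_n * 'I_m)) (z c : R * R) (Y : set (R * R)).

(** The infimum of an empty set of reals is 0, so a lower bound for covering numbers presupposes a
    finite cover. The upper estimates therefore also return one. *)
Let covers Y (e : R) : set R := [set k%:R | k in [set k : nat | exists c : 'I_k -> R * R,
    Y `<=` \bigcup_(i in [set: 'I_k]) torus_ball (c i) e]].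

Lemma covering_number_le Y e (s : seq (R * R)) :
  (forall y, Y y -> exists2 c, c \in s & torus_ball c e y) ->
  covering_number Y e <= (size s)%:R /\ covers Y e (size s)%:R.
Proof.
move=> h; have hc : covers Y e (size s)%:R.
  exists (size s) => //; exists (fun i => nth 0 s i) => y Yy.
  have [c cs cy] := h y Yy; have ci : (index c s < size s)%N by rewrite index_mem.
  by exists (Ordinal ci) => //=; rewrite nth_index.
split=> //; apply: ge_inf => //.
by exists 0 => _ [k _ <-].
Qed.

(** By [near_cells] in each coordinate a ball of radius e meets at most 4 * 4 approximate squares of
    width n^-k and height m^-l; by the injectivity hypothesis each of these belongs to at most one
    word of F. *)
Lemma covering_number_ge Y e (F : seq (seq ('I_n * 'I_m))) k l :
  covers Y e !=set0 -> uniq F -> (k <= l)%N ->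
  e <= (n%:R ^+ k)^-1 -> e <= (m%:R ^+ l)^-1 ->
  (forall w, w \in F -> size w = l /\ exists2 q, unit_square q & Y (toTorus (bmw w q))) ->
  {in F &, injective (fun w => (xnum (take k w), ynum w))} ->
  (size F)%:R <= 16 * covering_number Y e.
Proof.
move=> cov0 uF kl en em hF injF.
rewrite mulrC -ler_pdivrMr //; apply: lb_le_inf => // _ [K [c hc] <-].
rewrite ler_pdivrMr // -natrM ler_nat.
pose Fi i := [seq w <- F | `[< exists2 q, unit_square q & torus_ball (c i) e (toTorus (bmw w q)) >]].
have Fi16 i : (size (Fi i) <= 16)%N.
  have nk : (0 < n ^ k)%N by rewrite expn_gt0 n0.
  have ml : (0 < m ^ l)%N by rewrite expn_gt0 m0.
  have [S1 s1 h1] := @near_cells R (n ^ k) (c i).1 nk.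
  have [S2 s2 h2] := @near_cells R (m ^ l) (c i).2 ml.
  rewrite -(size_map (fun w => (xnum (take k w), ynum w))).
  apply: (@leq_trans (size [seq (a, b) | a <- S1, b <- S2])); last first.
    by rewrite size_allpairs (leq_mul s1 s2).
  apply: uniq_leq_size.
    rewrite map_inj_in_uniq ?filter_uniq // => w w'.
    by rewrite !mem_filter => /andP[_ wF] /andP[_ wF']; exact: injF.
  move=> _ /mapP[w + ->]; rewrite mem_filter => /andP[/asboolP[q Q /torus_ball_toTorus hd] wF].
  have [sw _] := hF w wF; apply/allpairsP; exists (xnum (take k w), ynum w) => /=.
  have [d1 d2] := torus_dist_lt hd; split=> //.
    have sk : size (take k w) = k by rewrite size_take sw; case: ltnP => //; lia.
    have [qi _] := bmw_unit n0 m0 (drop k w) Q.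
    apply: h1 qi _; first by have := xnum_lt (take k w); rewrite sk.
    rewrite -[w](cat_take_drop k) bmw_cat bmwE // sk in d1.
    by rewrite natrX (le_trans _ en) // ltW.
  have [_ qi] := Q; apply: h2 qi _; first by have := ynum_lt w; rewrite sw.
  rewrite bmwE // sw in d2.
  by rewrite natrX (le_trans _ em) // ltW.
apply: (@leq_trans (size (flatten [seq Fi i | i <- enum 'I_K]))).
  apply: uniq_leq_size => // w wF; apply/flattenP.
  have [_ [q Q Yq]] := hF w wF; have [i _ hi] := hc _ Yq.
  exists (Fi i); first by apply: map_f; rewrite mem_enum.
  by rewrite mem_filter wF andbT; apply/asboolP; exists q.
rewrite size_flatten /shape -map_comp sumnE big_map big_enum /=.
apply: (@leq_trans (\sum_(i < K) 16)); first exact: leq_sum.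
by rewrite sum_nat_const card_ord mulnC.
Qed.

(** An approximate square depends on the letters after the k-th only through their rows, so these
    letters can be replaced by representatives in [D0]. The two numerators 2 leave half of e to each
    coordinate. *)
Lemma covering_number_upper Y e (A D0 : seq ('I_n * 'I_m)) (P : pred (seq ('I_n * 'I_m))) k l :
  (k <= l)%N -> 2 / n%:R ^+ k < e -> 2 / m%:R ^+ l < e ->
  (forall d, d \in A -> exists2 d0, d0 \in D0 & d0.2 = d.2) ->
  (forall y, Y y -> exists2 w, w \in words A l & P (take k w) /\
     exists2 q, unit_square q & y = toTorus (bmw w q)) ->
  covering_number Y e <= (count P (words A k))%:R * (size D0)%:R ^+ (l - k) /\
  covers Y e !=set0.
Proof.
move=> kl en em hD0 hY.
pose s := [seq bmw (u ++ v) (0 : R * R) | u <- seq.filter P (words A k), v <- words D0 (l - k)].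
have [|h1 h2] := @covering_number_le Y e s; last first.
  split; last by exists (size s)%:R.
  by move: h1; rewrite size_allpairs size_filter size_words natrM natrX.
move=> y /hY[w]; rewrite mem_words => /andP[/eqP sw /allP wA] [Pw [q Q ->]].
have [f hf] : exists f : 'I_n * 'I_m -> 'I_n * 'I_m,
    forall d, d \in A -> f d \in D0 /\ (f d).2 = d.2.
  have /choice[f hf] : forall d, exists d0, d \in A -> d0 \in D0 /\ d0.2 = d.2.
    move=> d; have [dA|dA] := boolP (d \in A); last by exists d.
    by have [d0 ? ?] := hD0 d dA; exists d0.
  by exists f.
have sk : size (take k w) = k by rewrite size_take sw; case: ltnP => //; lia.
have sdr : size (drop k w) = (l - k)%N by rewrite size_drop sw.
have ydE : yd (map f (drop k w)) = yd (drop k w).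
  rewrite /yd -map_comp; apply/eq_in_map => d /mem_drop/wA/= dA.
  by have [_ ->] := hf d dA.
exists (bmw (take k w ++ map f (drop k w)) 0).
  apply: allpairs_f.
    by rewrite mem_filter Pw mem_words sk eqxx /=; apply/allP => d /mem_take/wA.
  rewrite mem_words size_map sdr eqxx /=; apply/allP => d /mapP[d' /mem_drop/wA dA ->].
  by have [] := hf d' dA.
apply/torus_ball_toTorus; apply: le_lt_trans (torus_dist_leD _ _) _.
rewrite [e](splitr e); apply: ltr_leD; last first.
  apply: (le_trans (cnorm_norm _)); apply: (@le_trans _ _ (m%:R ^+ l)^-1); last by lra.
  have yE : ynum w = ynum (take k w ++ map f (drop k w)).
    by rewrite -{1}[w](cat_take_drop k) /ynum /yd !map_cat -!/(yd _) ydE.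
  rewrite !bmwE // -yE size_cat size_map sk sdr subnKC // sw.
  have e1 (x a b c : R) : (x + a) / c - (x + b) / c = (a - b) / c by ring.
  rewrite e1 normrM [`|_^-1|]ger0_norm ?invr_ge0 ?exprn_ge0 //.
  by apply: ler_piMl; rewrite ?invr_ge0 ?exprn_ge0 // unit_diff ?lexx ?ler01 //; case: Q.
apply: le_lt_trans (cnorm_norm _) _; apply: (@le_lt_trans _ _ (n%:R ^+ k)^-1); last by lra.
have -> : bmw w q = bmw (take k w) (bmw (drop k w) q) by rewrite -bmw_cat cat_take_drop.
rewrite bmw_cat.
have := bmw_diff n0 m0 (take k w) (bmw_unit n0 m0 (map f (drop k w)) (unit_square0 R))
  (bmw_unit n0 m0 (drop k w) Q).
by rewrite sk => -[].
Qed.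

End Covering.

(** * Box dimension from counts of approximate squares *)

Section BoxDimensions.
Variable R : realType.

Lemma near_right0 (P : R -> Prop) e0 : 0 < e0 ->
  (forall e, 0 < e -> e < e0 -> P e) -> \forall e \near 0^'+, P e.
Proof.
move=> e0p h; near=> e; apply: h; first by near: e; exact: nbhs_right_gt.
by near: e; exact: nbhs_right_lt.
Unshelve. all: by end_near. Qed.

Lemma nat_log (a E : R) : 0 < a -> 0 <= E ->
  exists k : nat, k%:R * a <= E /\ E < (k%:R + 1) * a.
Proof.
move=> a0 E0; exists (Num.truncn (E / a)).
have /andP[h1 h2] := truncn_itv (divr_ge0 E0 (ltW a0)).
by rewrite -ler_pdivlMr // -ltr_pdivrMr // natr1.
Qed.

Variables (n m : nat).
Hypotheses (m2 : (1 < m)%N) (mn : (m < n)%N).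

Let lnm : 0 < ln (m%:R : R). Proof. by rewrite ln_gt0 // ltr1n. Qed.
Let lnn : 0 < ln (n%:R : R). Proof. by rewrite ln_gt0 // ltr1n (ltn_trans m2). Qed.
Let lnmn : ln (m%:R : R) < ln (n%:R : R).
Proof. by rewrite ltr_ln ?posrE ?ltr0n ?ltr_nat; lia. Qed.

(** The exponent of 1/e in rho^k p^(l - k) when n^k and m^l are both about 1/e. For rho = #D and p =
    #pi(D) it is the classical formula for the box dimension of X. *)
Definition dim_value (rho p : R) : R :=
  ln rho / ln n%:R + ((ln m%:R)^-1 - (ln n%:R)^-1) * ln p.

Lemma dim_value_error (C rho p c E : R) (k l : nat) : (k <= l)%N ->
  0 < C -> 0 < rho -> 0 < p ->
  `|k%:R - E / ln n%:R| <= c -> `|l%:R - E / ln m%:R| <= c ->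
  `|ln (C * rho ^+ k * p ^+ (l - k)) - E * dim_value rho p| <=
  `|ln C| + c * `|ln rho| + 2 * c * `|ln p|.
Proof.
move=> kl C0 rho0 p0 hk hl.
rewrite !lnM ?posrE ?mulr_gt0 ?exprn_gt0 // !lnXn // -[_ *+ k]mulr_natl -[_ *+ (l - k)]mulr_natl natrB //.
have -> : ln C + k%:R * ln rho + (l%:R - k%:R) * ln p - E * dim_value rho p =
  ln C + (k%:R - E / ln n%:R) * ln rho + ((l%:R - E / ln m%:R) - (k%:R - E / ln n%:R)) * ln p.
  by rewrite /dim_value; ring.
apply: (le_trans (ler_normD _ _)); apply: lerD.
  by apply: (le_trans (ler_normD _ _)); rewrite lerD2l normrM ler_wpM2r.
rewrite normrM ler_wpM2r //; apply: (le_trans (ler_normB _ _)); lra.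
Qed.

Lemma expr_le_inv (b k : nat) (e : R) : (1 < b)%N -> 0 < e ->
  (e <= (b%:R ^+ k)^-1) = (k%:R * ln b%:R <= - ln e).
Proof.
move=> b1 e0; have b0 : 0 < b%:R :> R by rewrite ltr0n ltnW.
have bk : 0 < b%:R ^+ k :> R by rewrite exprn_gt0.
rewrite -ler_ln ?posrE ?invr_gt0 // lnV ?posrE // lnXn // -[ln _ *+ k]mulr_natl lerNr.
by [].
Qed.

Lemma expr_lt_inv (b k : nat) (e : R) : (1 < b)%N -> 0 < e ->
  (2 / b%:R ^+ k < e) = (- ln (e / 2) < k%:R * ln b%:R).
Proof.
move=> b1 e0; have := expr_le_inv k b1 (divr_gt0 e0 (ltr0Sn R 1)).
rewrite ler_pdivrMr // mulrC => h.
by rewrite ltNge h -ltNge.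
Qed.

Lemma lnN_large (A : R) : \forall e \near (0 : R)^'+, A < - ln e.
Proof.
apply: (@near_right0 _ (expR (- A))); first exact: expR_gt0.
move=> e e0 eA; rewrite ltrNr -[ltRHS]expRK ltr_ln ?posrE //; exact: expR_gt0.
Qed.

(** The difference l - k grows like [gap] times - ln e, so there is room for a tail of any fixed
    length. *)
Let gap : R := (ln m%:R)^-1 - (ln n%:R)^-1.
Let gap0 : 0 < gap.
Proof. by rewrite subr_gt0 ltf_pV2 ?posrE. Qed.

Lemma ratio_lower (f : R -> R) (C rho p : R) (k1 r1 : nat) (d : R) :
  0 < C -> 0 < rho -> 0 < p -> 0 < d ->
  (forall e k l, 0 < e -> (k1 <= k)%N -> (k + r1 <= l)%N ->
    e <= (n%:R ^+ k)^-1 -> e <= (m%:R ^+ l)^-1 -> C * rho ^+ k * p ^+ (l - k) <= f e) ->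
  \forall e \near (0 : R)^'+, dim_value rho p - d <= ln (f e) / - ln e.
Proof.
move=> C0 rho0 p0 d0 h.
pose B := `|ln C| + `|ln rho| + 2 * `|ln p|.
near=> e.
have e0 : 0 < e by near: e; exact: nbhs_right_gt.
have E0 : 0 < - ln e by near: e; exact: lnN_large.
have EB : B / d < - ln e by near: e; exact: lnN_large.
have Ek : (k1%:R + 1) * ln n%:R < - ln e by near: e; exact: lnN_large.
have El : (r1%:R + 2) / gap < - ln e by near: e; exact: lnN_large.
set E := - ln e in E0 EB Ek El *.
have [k [k1' k2]] := nat_log lnn (ltW E0).
have [l [l1 l2]] := nat_log lnm (ltW E0).
have hk : E / ln n%:R - 1 <= k%:R <= E / ln n%:R.
  by rewrite lerBlDr ler_pdivrMr // ler_pdivlMr // (ltW k2).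
have hl : E / ln m%:R - 1 <= l%:R <= E / ln m%:R.
  by rewrite lerBlDr ler_pdivrMr // ler_pdivlMr // (ltW l2).
have kk1 : (k1 <= k)%N.
  rewrite -(ler_nat R); move: Ek; rewrite -ltr_pdivlMr //; lra.
have kl : (k + r1 <= l)%N.
  rewrite -(ler_nat R) natrD; move: El; rewrite ltr_pdivrMr // /gap mulrBr; lra.
have hf := h e k l e0 kk1 kl.
rewrite !expr_le_inv // ?(ltn_trans m2) // in hf; have {}hf := hf k1' l1.
have pos : 0 < C * rho ^+ k * p ^+ (l - k) by rewrite !mulr_gt0 ?exprn_gt0.
have lnf : ln (C * rho ^+ k * p ^+ (l - k)) <= ln (f e).
  by rewrite ler_ln ?posrE // (lt_le_trans pos).
rewrite ler_pdivlMr //.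
have := @dim_value_error C rho p 1 E k l (leq_trans (leq_addr _ _) kl) C0 rho0 p0.
rewrite !ler_norml => /(_ ltac:(lra) ltac:(lra)) /andP[+ _].
rewrite mul1r mulr1 -/B; move: EB; rewrite ltr_pdivrMr //.
by move: lnf; move: (ln (_ * _)) => x; lra.
Unshelve. all: by end_near. Qed.

(** As [ln] is 0 on nonpositive numbers, an upper bound for f bounds ln f only where f is
    positive. *)
Lemma ratio_upper (f : R -> R) (C rho p : R) (k1 r1 : nat) (d : R) :
  0 < C -> 0 < rho -> 0 < p -> 0 < d ->
  (\forall e \near (0 : R)^'+, 0 < f e) ->
  (forall e k l, 0 < e -> (k1 <= k)%N -> (k + r1 <= l)%N ->
    2 / n%:R ^+ k < e -> 2 / m%:R ^+ l < e -> f e <= C * rho ^+ k * p ^+ (l - k)) ->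
  \forall e \near (0 : R)^'+, ln (f e) / - ln e <= dim_value rho p + d.
Proof.
move=> C0 rho0 p0 d0 f0 h.
(* The levels are the least ones with 2 / n^k < e and 2 / m^l < e: rounding costs 1, and the factor
   2 costs at most ln 2 / ln m. *)
pose c : R := 1 + ln 2 / ln m%:R.
pose B := `|ln C| + c * `|ln rho| + 2 * c * `|ln p|.
have ln2 : 0 < ln 2 :> R by rewrite ln_gt0 // ltr1n.
near=> e.
have e0 : 0 < e by near: e; exact: nbhs_right_gt.
have fe0 : 0 < f e by near: e.
have E0 : 0 < - ln e by near: e; exact: lnN_large.
have EB : B / d < - ln e by near: e; exact: lnN_large.
have Ek : k1%:R * ln n%:R < - ln e by near: e; exact: lnN_large.
have El : (r1%:R + 1) / gap < - ln e by near: e; exact: lnN_large.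
set E := - ln e in E0 EB Ek El *.
have E2 : - ln (e / 2) = E + ln 2 by rewrite ln_div ?posrE // opprB /E addrC.
have E20 : 0 <= E + ln 2 by lra.
have [k [k1' k2]] := nat_log lnn E20.
have [l [l1 l2]] := nat_log lnm E20.
have hn : ln 2 / ln n%:R <= ln 2 / ln m%:R :> R.
  by rewrite ler_pM2l // lef_pV2 ?posrE // ltW.
have hk : (E + ln 2) / ln n%:R - 1 < k%:R <= (E + ln 2) / ln n%:R.
  by rewrite ltrBlDr ltr_pdivrMr // ler_pdivlMr // k2.
have hl : (E + ln 2) / ln m%:R - 1 < l%:R <= (E + ln 2) / ln m%:R.
  by rewrite ltrBlDr ltr_pdivrMr // ler_pdivlMr // l2.
rewrite !mulrDl in hk hl.
have n20 : 0 <= ln 2 / ln n%:R :> R by rewrite divr_ge0 // ltW.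
have kk1 : (k1 <= k.+1)%N.
  rewrite -(ler_nat R) -natr1; move: Ek; rewrite -ltr_pdivlMr //; lra.
have kl : (k.+1 + r1 <= l.+1)%N.
  rewrite -(ler_nat R) natrD -!natr1; move: El; rewrite ltr_pdivrMr // /gap mulrBr; lra.
have hf := h e k.+1 l.+1 e0 kk1 kl.
rewrite !expr_lt_inv // ?(ltn_trans m2) // E2 -[k.+1%:R]natr1 -[l.+1%:R]natr1 in hf.
have {}hf := hf k2 l2.
have pos : 0 < C * rho ^+ k.+1 * p ^+ (l.+1 - k.+1) by rewrite !mulr_gt0 ?exprn_gt0.
have lnf : ln (f e) <= ln (C * rho ^+ k.+1 * p ^+ (l.+1 - k.+1)) by rewrite ler_ln ?posrE.
rewrite ler_pdivrMr //.
have hk' : `|k.+1%:R - E / ln n%:R| <= c.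
  by rewrite -[k.+1%:R]natr1 ler_norml /c; lra.
have hl' : `|l.+1%:R - E / ln m%:R| <= c.
  by rewrite -[l.+1%:R]natr1 ler_norml /c; lra.
have := @dim_value_error C rho p c E k.+1 l.+1 (leq_trans (leq_addr _ _) kl) C0 rho0 p0 hk' hl'.
rewrite -/B ler_norml => /andP[_].
move: EB; rewrite ltr_pdivrMr //.
by move: lnf; move: (ln (_ * _)) => x; lra.
Unshelve. all: by end_near. Qed.

Lemma limf_esup_le (f : R -> R) (G : R) :
  (forall d, 0 < d -> \forall e \near (0 : R)^'+, f e <= G + d) ->
  (limf_esup (fun e => (f e)%:E) (0 : R)^'+ <= G%:E)%E.
Proof.
move=> h; apply/lee_addgt0Pr => d d0; apply: ereal_inf_le.
exists (ereal_sup [set (f e)%:E | e in [set e | f e <= G + d]]).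
  by exists [set e | f e <= G + d] => //; exact: h.
by apply: ub_ereal_sup => _ [e /= he <-]; rewrite -EFinD lee_fin.
Qed.

Lemma limf_einf_ge (f : R -> R) (G : R) :
  (forall d, 0 < d -> \forall e \near (0 : R)^'+, G - d <= f e) ->
  (G%:E <= limf_einf (fun e => (f e)%:E) (0 : R)^'+)%E.
Proof.
move=> h; rewrite /limf_einf leeNr.
have := @limf_esup_le (fun e => - f e) (- G); apply=> d d0.
by move: (h d d0); apply: filterS => e; lra.
Qed.

Lemma limf_einf_le_esup (f : R -> R) :
  (limf_einf (fun e => (f e)%:E) (0 : R)^'+ <= limf_esup (fun e => (f e)%:E) (0 : R)^'+)%E.
Proof.
rewrite limf_einfE; apply: ub_ereal_sup => _ [V hV <-].
apply: le_ereal_inf_tmp => _ [W hW <-].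
have [e [Ve We]] : exists e, V e /\ W e.
  by apply: (@filter_ex _ ((0 : R)^'+)); exact: filterI.
apply: (@le_trans _ _ (f e)%:E).
  by apply: ereal_inf_lbound; exists e.
by apply: ereal_sup_ubound; exists e.
Qed.

Lemma box_dim_eq (Y : set (R * R)) (G : R) :
  (forall d, 0 < d -> \forall e \near (0 : R)^'+, G - d <= ln (covering_number Y e) / - ln e) ->
  (forall d, 0 < d -> \forall e \near (0 : R)^'+, ln (covering_number Y e) / - ln e <= G + d) ->
  box_dim Y = G%:E.
Proof.
move=> hl hu; rewrite /box_dim; apply: cvg_lim => //.
apply: cvg_EFin; first by near=> e.
apply/cvgrPdist_le => d d0; near=> e.
have h1 : G - d <= ln (covering_number Y e) / - ln e by near: e; exact: hl.
have h2 : ln (covering_number Y e) / - ln e <= G + d by near: e; exact: hu.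
by rewrite /= ler_norml; lra.
Unshelve. all: by end_near. Qed.

End BoxDimensions.

(** * The measures mu_max and nu *)

Section Measure.
Variables (R : realType) (n m : nat).
Hypotheses (m2 : (1 < m)%N) (mn : (m < n)%N).
Implicit Types (z w : R * R).

Let n2 : (1 < n)%N. Proof. exact: ltn_trans mn. Qed.
Let n0 : (0 < n)%N. Proof. exact: ltnW. Qed.
Let m0 : (0 < m)%N. Proof. exact: ltnW. Qed.

Lemma measurable_frac : measurable_fun [set: R] (@Defs.frac R).
Proof.
move=> _ A mA; rewrite setTI.
have -> : @Defs.frac R @^-1` A = \bigcup_(k in [set: int])
    (`[k%:~R, k%:~R + 1[ `&` (fun x => x - k%:~R) @^-1` A).
  apply/seteqP; split => x /=.
    move=> Ax; exists (Num.floor x) => //; split=> //=.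
    have /andP[h1 h2] := floor_itv x; rewrite intrD mulr1z in h2.
    by rewrite in_itv /= h1 h2.
  move=> [k _ [/=]]; rewrite in_itv /= => /andP[h1 h2] Ax.
  have <- // : x - k%:~R = Defs.frac x.
  rewrite -(frac_id (t := x - k%:~R)) -?mulrNz ?fracDint //.
  by rewrite mulrNz subr_ge0 h1 ltrBlDl.
apply: countable_bigcupT_measurable => // k; apply: measurableI => //.
rewrite -[X in measurable X]setTI; apply: measurable_funB => //.
Qed.

Lemma measurable_cnorm : measurable_fun [set: R] (@cnorm R).
Proof.
by apply: measurable_minr; [exact: measurable_frac|
  apply: measurable_funB => //; exact: measurable_frac].
Qed.

Lemma measurable_torus_map : measurable_fun [set: R * R] (@torus_map R n m).
Proof.
apply: measurable_fun_pair; apply: (measurableT_comp measurable_frac);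
  apply: measurable_funM => //.
Qed.

Lemma measurable_bm_map d : measurable_fun [set: R * R] (@bm_map R n m d).
Proof.
apply: measurable_fun_pair; apply: measurable_funM => //;
  apply: measurable_funD => //.
Qed.

Lemma measurable_torus_dist z e : measurable [set w | torus_dist z w < e].
Proof.
have [e0|e0] := ltP 0 e; last first.
  rewrite (_ : [set w | _] = set0) //; apply/seteqP; split => w //= h.
  by have := lt_le_trans h e0; rewrite ltNge sqrtr_ge0.
pose f w : R := cnorm (z.1 - w.1) ^+ 2 + cnorm (z.2 - w.2) ^+ 2.
have mf : measurable_fun [set: R * R] f.
  by apply: measurable_funD; apply: measurable_funX; apply: (measurableT_comp measurable_cnorm);
   apply: measurable_funB => //.
rewrite (_ : [set w | _] = [set: R * R] `&` f @^-1` `]-oo, e ^+ 2[); first exact: mf.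
by rewrite setTI; apply/seteqP; split => w /=; rewrite in_itv /= torus_dist_ltE.
Qed.

Definition box (r : R) : set (R * R) :=
  [set z | (- r <= z.1 <= 1 + r) /\ (- r <= z.2 <= 1 + r)].

Lemma measurable_box r : measurable (box r).
Proof.
rewrite (_ : box r = ([set: R * R] `&` fst @^-1` `[- r, 1 + r]) `&`
   ([set: R * R] `&` snd @^-1` `[- r, 1 + r])).
  by apply: measurableI; [apply: measurable_fst|apply: measurable_snd].
by rewrite !setTI; apply/seteqP; split => z /=; rewrite !in_itv.
Qed.

Lemma box0 : box 0 = @unit_square R.
Proof. by rewrite /box /unit_square oppr0 addr0. Qed.

Section SelfAffine.
Variables (D : {set 'I_n * 'I_m}) (mu : probability (R * R)%type R).
Hypotheses (D0 : (0 < #|D|)%N) (hmu : is_self_affine_measure D mu).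

Let p A : R := fine (mu A).

Let pE A : measurable A -> mu A = (p A)%:E.
Proof. by move=> mA; rewrite /p fineK // fin_num_measure. Qed.

Let p_le A B : measurable A -> measurable B -> A `<=` B -> p A <= p B.
Proof.
move=> mA mB AB; rewrite -lee_fin -!pE //; apply: le_measure => //; by rewrite inE.
Qed.

Lemma measurable_bmw (w : seq ('I_n * 'I_m)) (A : set (R * R)) : measurable A -> measurable (@bmw R n m w @^-1` A).
Proof.
elim: w A => [|d w IH] A mA //=.
have -> : @bmw R n m (d :: w) @^-1` A = @bmw R n m w @^-1` (@bm_map R n m d @^-1` A) by [].
by apply: IH; rewrite -[X in measurable X]setTI; exact: measurable_bm_map.
Qed.

Lemma self_affine_step A : measurable A ->
  p A = #|D|%:R^-1 * \sum_(d in D) p (@bm_map R n m d @^-1` A).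
Proof.
move=> mA; rewrite /p (hmu mA); under eq_bigr => d _.
  rewrite /pushforward pE; last by rewrite -[X in measurable X]setTI; exact: measurable_bm_map.
  over.
by rewrite sumEFin -EFinM.
Qed.

Lemma self_affine_iter N A : measurable A ->
  p A = \sum_(w <- words (enum D) N) p (@bmw R n m w @^-1` A) / #|D|%:R ^+ N.
Proof.
elim: N A => [|N IH] A mA; first by rewrite big_seq1 expr0 divr1.
rewrite self_affine_step // wordsS.
rewrite big_allpairs_dep big_enum /= mulr_sumr; apply: eq_bigr => d _.
rewrite IH; last by rewrite -[X in measurable X]setTI; exact: measurable_bm_map.
by rewrite mulr_sumr; apply: eq_bigr => w _; rewrite exprS invfM mulrCA.
Qed.

(** Every [bm_map d] sends box r into box (r / 2), because n and m are at least 2. *)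
Lemma box_half r : 0 <= r -> p (box r) <= p (box (r / 2)).
Proof.
move=> r0; rewrite [leRHS]self_affine_step; last exact: measurable_box.
have DR : 0 < #|D|%:R :> R by rewrite ltr0n.
rewrite mulrC ler_pdivlMr // mulr_natr -sumr_const; apply: ler_sum => d _.
apply: p_le; [exact: measurable_box| |].
  by rewrite -[X in measurable X]setTI; apply: measurable_bm_map => //; exact: measurable_box.
have step (b : nat) (i : 'I_b) (x : R) : (1 < b)%N -> - r <= x <= 1 + r ->
    - (r / 2) <= (x + i%:R) / b%:R <= 1 + r / 2.
  move=> b1 /andP[x1 x2]; have bR : 2 <= b%:R :> R by rewrite ler_nat.
  have b0 : 0 < b%:R :> R by lra.
  have i0 : 0 <= i%:R :> R by [].
  have ib : i%:R <= b%:R - 1 :> R by rewrite lerBrDr natr1 ler_nat ltn_ord.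
  by rewrite ler_pdivlMr // ler_pdivrMr //; nra.
by move=> z [hz1 hz2]; split => /=; apply: step.
Qed.

Lemma box_pow r k : 0 <= r -> p (box r) <= p (box (r / 2 ^+ k)).
Proof.
move=> r0; elim: k => [|k IH]; first by rewrite expr0 divr1.
apply: (le_trans IH); rewrite exprSr invfM mulrA; apply: box_half.
by rewrite divr_ge0 // exprn_ge0.
Qed.

(** The self-affine equation alone locates the mass: a box has at most the mass of its contractions,
    hence of their intersection, the unit square, while the boxes exhaust the plane. *)
Lemma unit_square_full : p (@unit_square R) = 1.
Proof.
have p1 A : measurable A -> p A <= 1.
  by move=> mA; rewrite -lee_fin -pE // probability_le1.
apply/eqP; rewrite eq_le p1 /=; last by rewrite -box0; exact: measurable_box.
have h1 : (mu \o (fun k : nat => box k%:R)) x @[x --> \oo] --> mu [set: R * R].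
  have <- : \bigcup_k box k%:R = [set: R * R].
    apply/seteqP; split => // z _; exists (Num.truncn (`|z.1| + `|z.2|)).+1 => //=.
    have := truncnS_gt (`|z.1| + `|z.2|).
    have := ler_norm z.1; have := ler_norm (- z.1); rewrite normrN.
    have := ler_norm z.2; have := ler_norm (- z.2); rewrite normrN.
    have := normr_ge0 z.1; have := normr_ge0 z.2.
    by move=> *; split; lra.
  apply: nondecreasing_cvg_mu => [k|| i j ij]; first exact: measurable_box.
    by apply: bigcupT_measurable => k; exact: measurable_box.
  apply/subsetPset => z; have : i%:R <= j%:R :> R by rewrite ler_nat.
  by rewrite /box /= => h [h1 h2]; split; lra.
have h2 (j : nat) : (mu \o (fun k : nat => box (j%:R / 2 ^+ k))) x @[x --> \oo] -->
   mu (@unit_square R).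
  have <- : \bigcap_k box (j%:R / 2 ^+ k) = @unit_square R.
    apply/seteqP; split => z /=; last first.
      move=> [hz1 hz2] k _; have : 0 <= j%:R / 2 ^+ k :> R by rewrite divr_ge0 // exprn_ge0.
      by move=> h; split; lra.
    move=> h; have hk k := h k I.
    split; apply/andP; split; apply: (@le_expVn R 2 j%:R) => // k; have [/andP[? ?] /andP[? ?]] := hk k; lra.
  apply: nonincreasing_cvg_mu => [|k|| i k ik].
  - by rewrite -ge0_fin_numE // fin_num_measure //; exact: measurable_box.
  - exact: measurable_box.
  - by apply: bigcapT_measurable => k; exact: measurable_box.
  - apply/subsetPset => z.
    have : j%:R / 2 ^+ k <= j%:R / 2 ^+ i :> R.
      by rewrite ler_wpM2l // lef_pV2 ?posrE ?exprn_gt0 // ler_weXn2l // ler1n.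
    by rewrite /box /= => h [hz1 hz2]; split; lra.
have h3 (j : nat) : (mu (box j%:R) <= mu (@unit_square R))%E.
  have <- := cvg_lim _ (h2 j); last by [].
  apply: lime_ge; first by apply/cvg_ex; eexists; exact: h2.
  near=> k; rewrite /= !pE ?lee_fin; try exact: measurable_box.
  exact: box_pow.
rewrite -lee_fin -pE; last by rewrite -box0; exact: measurable_box.
rewrite -(@probability_setT _ _ _ mu).
have <- := cvg_lim _ h1; last by [].
apply: lime_le; first by apply/cvg_ex; eexists; exact: h1.
by near=> k; exact: h3.
Unshelve. all: by end_near. Qed.

(** In the N-fold self-affine equation an inner word contributes the mass 1 of the unit square, and
    a word that is not outer contributes 0. *)
Lemma mumax_bounds z e N :
  let M := fine (pushforward mu (@toTorus R) (torus_ball z e)) in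
  (count (inner_hole z e N) (words (enum D) N))%:R / #|D|%:R ^+ N <= M /\
  M <= (count (outer_hole z e N) (words (enum D) N))%:R / #|D|%:R ^+ N.
Proof.
move=> M; set A := [set w | torus_dist z w < e].
have mA : measurable A by exact: measurable_torus_dist.
have ME : M = p A.
  rewrite /M /pushforward; congr (fine (mu _)).
  by apply/seteqP; split => w /torus_ball_toTorus.
have DN : 0 <= (#|D|%:R ^+ N)^-1 :> R by rewrite invr_ge0 exprn_ge0.
rewrite ME (self_affine_iter N mA) -mulr_suml.
have mU : measurable (@unit_square R) by rewrite -box0; exact: measurable_box.
split; apply: ler_wpM2r => //; rewrite count_sum natr_sum big_seq [leRHS]big_seq; apply: ler_sum => w wN.
  have [/andP[_ /asboolP h]|_] := boolP (inner_hole _ _ _ _); last by rewrite fine_ge0.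
  by rewrite -unit_square_full; apply: p_le => //; exact: measurable_bmw.
have sw : size w == N by move: wN; rewrite mem_words => /andP[].
have [_|] := boolP (outer_hole _ _ _ _).
  by rewrite -lee_fin -pE ?probability_le1 //; exact: measurable_bmw.
rewrite /outer_hole sw /= => /asboolPn h.
have mC : measurable (~` @unit_square R) by exact: measurableC.
apply: (@le_trans _ _ (p (~` @unit_square R))).
  apply: p_le => //; first exact: measurable_bmw.
  by move=> q Aq Q; apply: h; exists q.
by rewrite -lee_fin -pE // probability_setC // pE // unit_square_full subee.
Qed.

End SelfAffine.

(** * Zero-one law and recurrence for the ergodic measure *)

Section Ergodic.
Variable nu : probability (R * R)%type R.
Let f := @torus_map R n m.
Hypotheses (hinv : invariant_measure nu f) (herg : ergodic_measure nu f).

Let mf k A : measurable A -> measurable (iter k f @^-1` A).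
Proof.
elim: k A => [|k IH] A mA //=.
have -> : iter k.+1 f @^-1` A = iter k f @^-1` (f @^-1` A) by [].
by apply: IH; rewrite -[X in measurable X]setTI; exact: measurable_torus_map.
Qed.

Let inv_iter k A : measurable A -> nu (iter k f @^-1` A) = nu A.
Proof.
elim: k A => [|k IH] A mA //=.
have -> : iter k.+1 f @^-1` A = iter k f @^-1` (f @^-1` A) by [].
rewrite IH; first exact: hinv.
by rewrite -[X in measurable X]setTI; exact: measurable_torus_map.
Qed.

(** Ergodicity speaks of strictly invariant sets. The increasing union of the preimages of A is one,
    and it has the measure of A by invariance and continuity from below. *)
Lemma ergodic_forward_invariant A : measurable A -> A `<=` f @^-1` A ->
  nu A = 0%E \/ nu A = 1%E.
Proof.
move=> mA fA; pose B := \bigcup_k (iter k f @^-1` A).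
have mB : measurable B by apply: bigcupT_measurable => k; exact: mf.
have AS k z : A (iter k f z) -> A (iter k.+1 f z) by move=> /fA.
have fB : f @^-1` B = B.
  apply/seteqP; split => z [k _ /= hk].
    by exists k.+1 => //=; rewrite -iterSr in hk.
  by exists k => //=; rewrite -iterSr; exact: AS.
have <- : nu B = nu A; last exact: herg.
have h : (nu \o (fun k => iter k f @^-1` A)) x @[x --> \oo] --> nu B.
  apply: nondecreasing_cvg_mu => [k||]; [exact: mf|exact: mB|].
  by apply/nondecreasing_seqP => k; apply/subsetPset => z /AS.
rewrite -(cvg_lim _ h) //; apply: lim_near_cst => //.
by near=> k; rewrite /= inv_iter.
Unshelve. all: by end_near. Qed.

(** The points visiting A infinitely often form a strictly invariant set, a decreasing limit of sets
    each containing a preimage of A; so its measure is at least nu A, hence 1. *)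
Lemma ergodic_recurrence A : measurable A -> (0 < nu A)%E ->
  {ae nu, forall z, forall k, exists2 j, (k <= j)%N & A (iter j f z)}.
Proof.
move=> mA A0; pose B k := \bigcup_(j in [set j | (k <= j)%N]) (iter j f @^-1` A).
have mB k : measurable (B k) by apply: bigcup_measurable => j _; exact: mf.
pose L := \bigcap_k B k.
have mL : measurable L by apply: bigcapT_measurable.
have fL : f @^-1` L = L.
  apply/seteqP; split => z hz k _.
    have [j /= kj hj] := hz k I; exists j.+1 => /=; first exact: leqW.
    by rewrite -iterSr in hj.
  have [[|j] /= kj hj] := hz k.+1 I; first by [].
  by exists j => //=; rewrite -iterSr.
have h : (nu \o B) x @[x --> \oo] --> nu L.
  apply: nonincreasing_cvg_mu => //; first by rewrite -ge0_fin_numE // fin_num_measure.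
  by move=> i j ij; apply/subsetPset => z [k /= jk hk]; exists k => //=; exact: leq_trans jk.
have L0 : (0 < nu L)%E.
  apply: (lt_le_trans A0); rewrite -(cvg_lim _ h) //.
  apply: lime_ge; first by apply/cvg_ex; eexists; exact: h.
  near=> k; rewrite /= -(inv_iter k mA); apply: le_measure; rewrite ?inE //; first exact: mf.
  by move=> z hz; exists k => //=.
have L1 : nu L = 1%E by case: (herg mL fL) => // h0; rewrite h0 ltxx in L0.
exists (~` L); split; [exact: measurableC| |].
  by rewrite probability_setC // L1 subee.
move=> z /= hz Lz; apply: hz => k.
by have [j kj hj] := Lz k I; exists j.
Unshelve. all: by end_near. Qed.

End Ergodic.
End Measure.

(** * Cylinders near the boundary of a ball *)

Section StripCount.
Variables (R : realType) (T : eqType) (A : seq T) (b : nat) (f : T -> nat).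
Hypotheses (b0 : (0 < b)%N) (fb : forall d, (f d < b)%N).
Hypothesis nonconst : exists d d', [/\ d \in A, d' \in A & f d != f d'].

Lemma count_fiber (a : nat) : (count (fun d => f d == a) A <= (size A).-1)%N.
Proof.
have [d [dA da]] : exists d, d \in A /\ f d != a.
  have [d [d' [dA d'A dd']]] := nonconst.
  have [e|ne] := eqVneq (f d) a; last by exists d.
  by exists d'; rewrite -e eq_sym.
have := count_predC (fun d => f d == a) A.
have : (0 < count (predC (fun d => f d == a)) A)%N.
  by rewrite -has_count; apply/hasP; exists d.
lia.
Qed.

Lemma count_map_fiber L (s : seq nat) :
  (count (fun w => map f w == s) (words A L) <= (size A).-1 ^ L)%N.
Proof.
elim: L s => [|L IH] s; first by rewrite expn0; case: s.
rewrite wordsS count_sum big_allpairs_dep /=; case: s => [|a s].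
  by rewrite big1 // => d _; rewrite big1.
rewrite expnS; apply: (@leq_trans (\sum_(d <- A) (f d == a) * (size A).-1 ^ L)%N).
  apply: leq_sum => d _; have [e|ne] := eqVneq (f d) a.
    rewrite mul1n -count_sum; apply: leq_trans (IH s); apply: sub_count => w /=.
    by rewrite e eqseq_cons eqxx.
  rewrite mul0n leqn0 sum_nat_seq_eq0; apply/allP => w _ /=.
  by rewrite eqseq_cons (negbTE ne).
rewrite -big_distrl leq_mul2r /=; apply/orP; right.
have -> : (\sum_(d <- A) (f d == a) = count (fun d => f d == a) A)%N.
  by elim: A => [|x s' IHs]; rewrite ?big_nil //= big_cons IHs.
exact: count_fiber.
Qed.

Lemma count_num_fiber L (S : seq nat) :
  (count (fun w => num b (map f w) \in S) (words A L) <= size S * (size A).-1 ^ L)%N.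
Proof.
elim: S => [|V S IH]; first by rewrite (eq_count (a2 := pred0)) ?count_pred0.
rewrite mulSn; apply: (@leq_trans (count (fun w => num b (map f w) == V) (words A L) +
   count (fun w => num b (map f w) \in S) (words A L))%N).
  rewrite -count_predUI; apply: leq_trans (leq_addr _ _); apply: sub_count => w /=.
  by rewrite inE.
apply: leq_add => //.
have [/hasP[w0 w0L /eqP h0]|] := boolP (has (fun w => num b (map f w) == V) (words A L)); last first.
  by rewrite has_count -leqNgt leqn0 => /eqP ->.
apply: leq_trans (count_map_fiber L (map f w0)).
rewrite !count_sum big_seq [leqRHS]big_seq; apply: leq_sum => w wL.
have [/eqP h|//] := boolP (num b (map f w) == V).
suff -> : map f w == map f w0 by [].
apply/eqP; apply: (@num_inj b).
- by move: wL w0L; rewrite !size_map !mem_words => /andP[/eqP -> _] /andP[/eqP -> _].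
- by apply/allP => c /mapP[d _ ->].
- by apply/allP => c /mapP[d _ ->].
- by rewrite h h0.
Qed.

(** A strip of half-width b^-r leaves 4 choices for the first r digits, and a given digit leaves at
    most size A - 1 letters, as f is not constant on A. *)
Lemma count_strip (c : R) (r N : nat) : (r <= N)%N ->
  (count (fun w => `[< exists2 t : R, (0 <= t <= 1)%R &
      (cnorm (c - ((num b (map f w))%:R + t) / b%:R ^+ N) <= (b%:R ^+ r)^-1)%R >]) (words A N)
   <= 4 * ((size A).-1 ^ r * size A ^ (N - r)))%N.
Proof.
move=> rN; have br : (0 < b ^ r)%N by rewrite expn_gt0 b0.
have [S S4 hS] := @near_cells R (b ^ r) c br.
apply: (@leq_trans (\sum_(w <- words A (r + (N - r)))
   ((num b (map f (take r w)) \in S) * 1))%N).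
  rewrite subnKC // count_sum big_seq [leqRHS]big_seq; apply: leq_sum => w.
  rewrite mem_words => /andP[/eqP sw _]; rewrite muln1.
  case: asboolP => // -[t /andP[t0 t1] ht].
  suff -> : num b (map f (take r w)) \in S by [].
  have sr : size (take r w) = r by rewrite size_takel // sw.
  have sdr : size (drop r w) = (N - r)%N by rewrite size_drop sw.
  have allf v : all (fun c => c < b)%N (map f v) by apply/allP => x /mapP[d _ ->].
  have lt1 := num_lt (allf (take r w)); have lt2 := num_lt (allf (drop r w)).
  rewrite size_map sr in lt1; rewrite size_map sdr in lt2.
  have bR : 0 < b%:R :> R by rewrite ltr0n.
  have bN : 0 < b%:R ^+ (N - r) :> R by rewrite exprn_gt0.
  apply: (hS _ (((num b (map f (drop r w)))%:R + t) / b%:R ^+ (N - r)) lt1).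
    rewrite divr_ge0 ?addr_ge0 ?(ltW bN) //= ler_pdivrMr // mul1r -natrX.
    by apply: (@le_trans _ _ ((num b (map f (drop r w)))%:R + 1)); rewrite ?lerD2l // natr1 ler_nat.
  rewrite natrX; apply: le_trans ht; rewrite le_eqVlt; apply/orP; left; apply/eqP.
  rewrite -[in RHS](cat_take_drop r w) map_cat num_cat size_map sdr natrD natrM natrX.
  have bNE : b%:R ^+ N = b%:R ^+ r * b%:R ^+ (N - r) :> R by rewrite -exprD subnKC.
  rewrite bNE; congr cnorm; congr (_ - _).
  by field; rewrite !expf_neq0 ?gt_eqF.
rewrite (sum_words_split _ _ _ (fun u => (num b (map f u) \in S) : nat) (fun=> 1%N)).
rewrite sum_const_words muln1 mulnA leq_mul2r -count_sum; apply/orP; right.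
by apply: (leq_trans (count_num_fiber r S)); rewrite leq_mul2r S4 orbT.
Qed.

End StripCount.

Section HoleGeometry.
Variables (R : realType) (n m : nat).
Hypotheses (m2 : (1 < m)%N) (mn : (m < n)%N).
Variables (D : {set 'I_n * 'I_m}) (K : set (R * R)).
Hypothesis hK : is_attractor D K.
Let X := @toTorus R @` K.
Implicit Types (w u v : seq ('I_n * 'I_m)) (z : R * R) (e : R).

Let n2 : (1 < n)%N. Proof. exact: ltn_trans mn. Qed.
Let n0 : (0 < n)%N. Proof. exact: ltnW. Qed.
Let m0 : (0 < m)%N. Proof. exact: ltnW. Qed.
Let nR : 0 < n%:R :> R. Proof. by rewrite ltr0n. Qed.
Let mR : 0 < m%:R :> R. Proof. by rewrite ltr0n. Qed.

Definition two_rows := exists d d', [/\ d \in enum D, d' \in enum D & d.2 != d'.2 :> nat].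
Definition two_columns := exists d d', [/\ d \in enum D, d' \in enum D & d.1 != d'.1 :> nat].

Lemma torus_distC z z' : torus_dist z z' = torus_dist z' z.
Proof. by rewrite !torus_distE cnormB [cnorm (z.2 - _)]cnormB. Qed.

Lemma torus_dist_toTorusl z z' : torus_dist (toTorus z) z' = torus_dist z z'.
Proof. by rewrite torus_distC torus_dist_toTorus torus_distC. Qed.

Lemma expVn_mn k : (n%:R ^+ k)^-1 <= (m%:R ^+ k)^-1 :> R.
Proof.
rewrite lef_pV2 ?posrE ?exprn_gt0 //; apply: lerXn2r; rewrite ?nnegrE //.
by rewrite ler_nat ltnW.
Qed.

Lemma code_of_point z L : X z -> exists2 c, c \in words (enum D) L &
  exists2 k, unit_square k & z = toTorus (bmw c k).
Proof.
move=> [x Kx <-]; have [w wL [k Kk ->]] := attractor_decomp hK L Kx.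
by exists w => //; exists k => //; apply: (attractor_unit m2 mn hK).
Qed.

(** The cylinder of a prefix comes within e of z, and e is at most the width n^-i and the height
    m^-i of the cell: four cells remain in each coordinate. *)
Lemma prefcount_outer z e N i : e <= (n%:R ^+ i)^-1 ->
  (prefcount (outer_hole z e N) (enum D) i <= 16)%N.
Proof.
move=> ei; have ni : (0 < n ^ i)%N by rewrite expn_gt0 n0.
have mi : (0 < m ^ i)%N by rewrite expn_gt0 m0.
have [S1 s1 h1] := @near_cells R (n ^ i) z.1 ni.
have [S2 s2 h2] := @near_cells R (m ^ i) z.2 mi.
rewrite /prefcount -size_filter -(size_map (fun w => (xnum w, ynum w))).
apply: (@leq_trans (size [seq (a, b) | a <- S1, b <- S2])); last first.
  by rewrite size_allpairs (leq_mul s1 s2).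
apply: uniq_leq_size.
  rewrite map_inj_in_uniq ?filter_uniq ?words_uniq ?enum_uniq // => w w'.
  rewrite !mem_filter !mem_words => /andP[_ /andP[/eqP sw _]] /andP[_ /andP[/eqP sw' _]] [hx hy].
  by apply: xynum_inj => //; rewrite sw sw'.
move=> _ /mapP[u + ->]; rewrite mem_filter mem_words.
move=> /andP[/asboolP[y [_ /andP[_ /asboolP[q Q hd]]]] /andP[/eqP su _]].
apply/allpairsP; exists (xnum u, ynum u); have [d1 d2] := torus_dist_lt hd.
have [q1 q2] := bmw_unit n0 m0 y Q; rewrite bmw_cat bmwE //= su in d1 d2.
split=> //=.
  apply: h1 q1 _; first by have := xnum_lt u; rewrite su.
  by rewrite natrX (le_trans _ ei) // ltW.
apply: h2 q2 _; first by have := ynum_lt u; rewrite su.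
by rewrite natrX (le_trans _ (expVn_mn i)) // (le_trans _ ei) // ltW.
Qed.

Lemma prefcount_inner z e N i : e <= (n%:R ^+ i)^-1 ->
  (prefcount (inner_hole z e N) (enum D) i <= 16)%N.
Proof.
move=> ei; apply: leq_trans (prefcount_outer z N ei); apply: sub_count => u /=.
by move=> /asboolP[y [yD /inner_outer Uy]]; apply/asboolP; exists y.
Qed.

Lemma cnorm_lip (s t : R) : `|cnorm s - cnorm t| <= `|s - t|.
Proof.
have h a b : cnorm a - cnorm b <= `|a - b| :> R.
  rewrite lerBlDr; apply: le_trans (lerD (cnorm_norm _) (lexx _)).
  by apply: le_trans (cnormD _ _); rewrite subrK.
by rewrite ler_norml h andbT lerNl opprB distrC h.
Qed.

Lemma cnorm_le1 (t : R) : cnorm t <= 1.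
Proof. by have /andP[h0 h1] := frac_itv t; rewrite /cnorm ge_min (ltW h1). Qed.

(** The two signs are the reason why boundary cylinders lie in pairs of strips. *)
Lemma cnorm_near (t h rho : R) : `|cnorm t - h| <= rho ->
  cnorm (t - h) <= rho \/ cnorm (t + h) <= rho.
Proof.
have [a ->] := cnormE t => hh; have [ta|ta] := lerP 0 (t - a%:~R).
  left; apply: le_trans hh; rewrite [`|t - _|]ger0_norm //.
  by apply: (le_trans (cnorm_le _ a)); rewrite addrAC.
right; apply: le_trans hh; rewrite [`|t - _|]ltr0_norm //.
apply: (le_trans (cnorm_le _ a)); rewrite -normrN.
by have -> : - (t + h - a%:~R) = - (t - a%:~R) - h by ring.
Qed.

(** The cylinder has a point inside the ball and one outside, and their coordinates differ by at
    most d = m^-N. As (a + d)^2 <= a^2 + 3 d for a, d in [0, 1], the sum of two squares changes by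
    at most 6 d. *)
Lemma annulus_radii z e N w : size w = N -> e <= 1 ->
  outer_hole z e N w -> ~~ inner_hole z e N w ->
  exists2 q, unit_square q &
    let a := cnorm (z.1 - (bmw w q).1) in let b := cnorm (z.2 - (bmw w q).2) in
    a ^+ 2 + b ^+ 2 < e ^+ 2 /\ e ^+ 2 <= a ^+ 2 + b ^+ 2 + 6 / m%:R ^+ N.
Proof.
move=> sw e1 /andP[_ /asboolP[q Q hq]]; rewrite /inner_hole sw eqxx /= => /asboolPn.
move=> /existsNP[q' /not_implyP[Q' /negP]]; rewrite -leNgt => hq'.
have e0 : 0 < e by apply: le_lt_trans hq; exact: sqrtr_ge0.
exists q => //; move: hq hq'; rewrite torus_dist_ltE // => hq.
rewrite leNgt torus_dist_ltE // -leNgt.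
have [h1 h2] := bmw_diff n0 m0 w Q Q'; rewrite sw in h1 h2.
have l1 := le_trans (cnorm_lip (z.1 - (bmw w q').1) (z.1 - (bmw w q).1)) (_ : _ <= (m%:R ^+ N)^-1).
have l2 := le_trans (cnorm_lip (z.2 - (bmw w q').2) (z.2 - (bmw w q).2)) (_ : _ <= (m%:R ^+ N)^-1).
have e2 (a b c : R) : (a - b) - (a - c) = c - b by ring.
rewrite !e2 in l1 l2.
have {}l1 := l1 (le_trans h1 (expVn_mn N)); have {}l2 := l2 h2.
have d1 : (m%:R ^+ N)^-1 <= 1 :> R.
  by rewrite invf_le1 ?exprn_gt0 // -natrX ler1n expn_gt0 m0.
have d0 : 0 <= (m%:R ^+ N)^-1 :> R by rewrite invr_ge0 exprn_ge0.
move: hq l1 l2.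
have := cnorm_ge0 (z.1 - (bmw w q).1); have := cnorm_ge0 (z.2 - (bmw w q).2).
have := cnorm_ge0 (z.1 - (bmw w q').1); have := cnorm_ge0 (z.2 - (bmw w q').2).
move: (cnorm (z.1 - (bmw w q').1)) (cnorm (z.2 - (bmw w q').2)) => a' b'.
move: (cnorm (z.1 - (bmw w q).1)) (cnorm (z.2 - (bmw w q).2)) => a b.
move: (_^-1) d0 d1 => d d0 d1 b'0 a'0 b00 a0 hq; rewrite !ler_norml => /andP[_ l1] /andP[_ l2] hq'.
split=> //.
have a1 : a <= 1 by nra.
have b1 : b <= 1 by nra.
have ha : a' ^+ 2 <= a ^+ 2 + 3 * d by nra.
have hb : b' ^+ 2 <= b ^+ 2 + 3 * d by nra.
lra.
Qed.

(** The difference of the squares is divided by b + h, which exceeds theta. The truncation at 0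
    covers columns beyond the circle, where g is negative. *)
Lemma sqr_near (b g lam theta : R) : 0 <= b -> 0 < theta -> theta < b ->
  `|b ^+ 2 - g| <= lam -> `|b - Num.sqrt (Num.max 0 g)| <= lam / theta.
Proof.
move=> b0 t0 tb hg; set h := Num.sqrt _.
have h0 : 0 <= h by exact: sqrtr_ge0.
have hh : h ^+ 2 = Num.max 0 g by rewrite sqr_sqrtr // le_max lexx.
have hb : `|b ^+ 2 - h ^+ 2| <= lam.
  apply: le_trans hg; rewrite hh /Num.max; case: ltP => g0 //.
  rewrite subr0 !ger0_norm ?sqr_ge0 //; [by lra|].
  by rewrite subr_ge0 (le_trans g0) // sqr_ge0.
rewrite ler_pdivlMr //; apply: le_trans hb.
rewrite subr_sqr normrM ler_wpM2l // ger0_norm; lra.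
Qed.

Let q := #|D|.
Let szD : size (enum D) = q. Proof. by rewrite -cardE. Qed.

Definition boundary_hole z e N : pred (seq ('I_n * 'I_m)) :=
  fun w => outer_hole z e N w && ~~ inner_hole z e N w.

(* On the part of the circle where the vertical radius exceeds m^-r, the first j digits
   confine the second coordinate to two intervals of length about (m / n)^j relative to
   the cell, because the cell is much thinner than high; the rest is a horizontal strip. *)
Lemma boundary_two_rows z e (N j r : nat) : two_rows -> e <= 1 -> (j + r <= N)%N ->
  (6 / m%:R ^+ N + 2 / n%:R ^+ j) * m%:R ^+ (r + j) <= (m%:R ^+ r)^-1 :> R ->
  (count (boundary_hole z e N) (words (enum D) N) <= 12 * (q.-1 ^ r * q ^ (N - r)))%N.
Proof.
move=> rows e1 jrN hnum.
pose fy (d : 'I_n * 'I_m) : nat := d.2.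
pose S c M := fun w => `[< exists2 t : R, 0 <= t <= 1 &
      cnorm (c - ((num m (map fy w))%:R + t) / m%:R ^+ M) <= (m%:R ^+ r)^-1 >].
(* [h u] is the vertical half-chord of the circle over the left edge of the column of u; [c1 u] and
   [c2 u] are the two heights after zooming in by m^j. *)
pose h u : R := Num.sqrt (Num.max 0 (e ^+ 2 - cnorm (z.1 - (xnum u)%:R / n%:R ^+ j) ^+ 2)).
pose c1 u : R := m%:R ^+ j * (z.2 - h u).
pose c2 u : R := m%:R ^+ j * (z.2 + h u).
have hS c M : (r <= M)%N -> (count (S c M) (words (enum D) M) <= 4 * (q.-1 ^ r * q ^ (M - r)))%N.
  move=> rM; rewrite -szD; apply: (@count_strip R _ (enum D) m fy m0) => // d; exact: ltn_ord.
(* The first strip catches vertical distances up to m^-r. Otherwise the tail of w lies in one of the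
   two strips attached to its first j letters. The bounds 4 and 4 + 4 make 12. *)
apply: (@leq_trans (\sum_(w <- words (enum D) N) S z.2 N w +
   \sum_(u <- words (enum D) j) \sum_(v <- words (enum D) (N - j)) (S (c1 u) (N - j)%N v + S (c2 u) (N - j)%N v))%N).
  rewrite -(sum_words_take_drop _ _ _ (fun u v => S (c1 u) (N - j)%N v + S (c2 u) (N - j)%N v)%N).
  rewrite subnKC ?(leq_trans (leq_addr _ _) jrN) // count_sum -big_split /=.
  rewrite big_seq [leqRHS]big_seq; apply: leq_sum => w wN.
  have sw : size w = N by move: wN; rewrite mem_words => /andP[/eqP].
  have [/andP[wo wi]|//] := boolP (boundary_hole z e N w).
  have [p P [hab1 hab2]] := annulus_radii sw e1 wo wi.
  have [_ P2] := P.
  have [hb|hb] := leP (cnorm (z.2 - (bmw w p).2)) (m%:R ^+ r)^-1.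
    suff -> : S z.2 N w by [].
    by apply/asboolP; exists p.2 => //; move: hb; rewrite bmwE //= sw.
  have jN : (j <= N)%N := leq_trans (leq_addr _ _) jrN.
  set u := take j w; set v := drop j w.
  have su : size u = j by rewrite size_takel // sw.
  have sv : size v = (N - j)%N by rewrite size_drop sw.
  have wuv : w = u ++ v by rewrite cat_take_drop.
  set a := cnorm (z.1 - (bmw w p).1) in hab1 hab2.
  set b := cnorm (z.2 - (bmw w p).2) in hb hab1 hab2.
  pose au := cnorm (z.1 - (xnum u)%:R / n%:R ^+ j).
  have aau : `|a - au| <= (n%:R ^+ j)^-1.
    apply: (le_trans (cnorm_lip _ _)).
    have e2 (x y t : R) : (x - y) - (x - t) = t - y by ring.
    rewrite e2 wuv bmw_cat.
    have := (bmw_diff n0 m0 u (@unit_square0 R) (bmw_unit n0 m0 v P)).1.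
    by rewrite {1}bmwE //= addr0 su.
  have a0 : 0 <= a by exact: cnorm_ge0.
  have b0 : 0 <= b by exact: cnorm_ge0.
  have au0 : 0 <= au by exact: cnorm_ge0.
  have a1 : a <= 1 by exact: cnorm_le1.
  have au1 : au <= 1 by exact: cnorm_le1.
  pose lam : R := 6 / m%:R ^+ N + 2 / n%:R ^+ j.
  have hbg : `|b ^+ 2 - (e ^+ 2 - au ^+ 2)| <= lam.
    rewrite /lam; move: hab1 hab2 aau; rewrite !ler_norml.
    have : 0 <= (n%:R ^+ j)^-1 :> R by rewrite invr_ge0 exprn_ge0.
    have : 0 <= (m%:R ^+ N)^-1 :> R by rewrite invr_ge0 exprn_ge0.
    move: (m%:R ^+ N)^-1 (n%:R ^+ j)^-1 => d1 d2 d10 d20 h1 h2 /andP[h3 h4].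
    have h5 : au ^+ 2 <= a ^+ 2 + 2 * d2 by nra.
    have h6 : a ^+ 2 <= au ^+ 2 + 2 * d2 by nra.
    by apply/andP; split; lra.
  have mr : 0 < (m%:R ^+ r)^-1 :> R by rewrite invr_gt0 exprn_gt0.
  have := sqr_near b0 mr hb hbg; rewrite -/(h u) invrK => hbh.
  have mj : 0 < m%:R ^+ j :> R by rewrite exprn_gt0.
  have key s : cnorm (z.2 - (bmw w p).2 + s) <= lam * m%:R ^+ r ->
      S (m%:R ^+ j * (z.2 + s)) (N - j)%N v.
    move=> hs; apply/asboolP; exists p.2 => //.
    apply: le_trans hnum; apply: (@le_trans _ _ (m%:R ^+ j * (lam * m%:R ^+ r))); last first.
      by rewrite exprD /lam le_eqVlt; apply/orP; left; apply/eqP; ring.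
    apply: le_trans (ler_wpM2l (ltW mj) hs); rewrite -natrX.
    apply: le_trans (cnormMn _ _); rewrite natrX -(cnormDint _ (- (ynum u)%:Z)) mulrNz.
    rewrite bmwE //= sw wuv ynum_cat sv natrD natrM natrX -pmulrn le_eqVlt.
    apply/orP; left; apply/eqP; congr cnorm.
    have mN : m%:R ^+ N = m%:R ^+ j * m%:R ^+ (N - j) :> R by rewrite -exprD subnKC.
    have -> : ynum v = num m (map fy v) by [].
    by rewrite mN; field; rewrite !expf_neq0 ?gt_eqF.
  case: (cnorm_near hbh) => [hm|hp].
    have -> : S (c1 u) (N - j)%N v by apply: key.
    by rewrite addnA [X in (_ <= X)%N]addnAC leq_addl.
  have -> : S (c2 u) (N - j)%N v by apply: key.
  by rewrite addnA leq_addl.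
rewrite -count_sum.
have h3 : (\sum_(u <- words (enum D) j) \sum_(v <- words (enum D) (N - j))
    (S (c1 u) (N - j)%N v + S (c2 u) (N - j)%N v) <= 8 * (q.-1 ^ r * q ^ (N - r)))%N.
  apply: (@leq_trans (\sum_(u <- words (enum D) j) 8 * (q.-1 ^ r * q ^ (N - j - r)))%N).
    apply: leq_sum => u _; rewrite big_split /= -!count_sum.
    have rNj : (r <= N - j)%N by clear -jrN; lia.
    by apply: leq_trans (leq_add (hS (c1 u) _ rNj) (hS (c2 u) _ rNj)) _; rewrite -mulnDl.
  rewrite sum_const_words szD mulnCA leq_mul2l /= mulnCA leq_mul2l -expnD.
  by apply/orP; right; rewrite (_ : (j + (N - j - r) = N - r)%N) //; clear -jrN; lia.
have rN : (r <= N)%N by clear -jrN; lia.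
by apply: leq_trans (leq_add (hS z.2 N rN) h3) _; rewrite -mulnDl.
Qed.

(** With a single row, z and the cylinder differ vertically by at most m^-N, so only the abscissae
    near z.1 - e and z.1 + e matter: e (e - a) <= e^2 - a^2 <= 7 m^-N, where 6 comes from
    [annulus_radii] and 1 from b^2. *)
Lemma boundary_one_row z e (N r : nat) : ~ two_rows -> two_columns -> X z ->
  0 < e -> e <= 1 -> (r <= N)%N -> 7 / m%:R ^+ N / e <= (n%:R ^+ r)^-1 :> R ->
  (count (boundary_hole z e N) (words (enum D) N) <= 8 * (q.-1 ^ r * q ^ (N - r)))%N.
Proof.
move=> rows cols Xz e0 e1 rN hnum.
pose fx (d : 'I_n * 'I_m) : nat := d.1.
pose S c M := fun w => `[< exists2 t : R, 0 <= t <= 1 &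
      cnorm (c - ((num n (map fx w))%:R + t) / n%:R ^+ M) <= (n%:R ^+ r)^-1 >].
have hS c M : (r <= M)%N -> (count (S c M) (words (enum D) M) <= 4 * (q.-1 ^ r * q ^ (M - r)))%N.
  move=> rM; rewrite -szD; apply: (@count_strip R _ (enum D) n fx n0) => // d; exact: ltn_ord.
have [c cN [k Q zk]] := code_of_point N Xz.
apply: (@leq_trans (count (S (z.1 - e)%R N) (words (enum D) N) + count (S (z.1 + e)%R N) (words (enum D) N))%N); last first.
  have := hS (z.1 - e) N rN; have := hS (z.1 + e) N rN; lia.
rewrite !count_sum -big_split /= big_seq [leqRHS]big_seq; apply: leq_sum => w wN.
have sw : size w = N by move: wN; rewrite mem_words => /andP[/eqP].
have [/andP[wo wi]|//] := boolP (boundary_hole z e N w).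
have [p P [hab1 hab2]] := annulus_radii sw e1 wo wi.
have ycw : ynum c = ynum w.
  rewrite /ynum; congr num.
  move: cN wN; rewrite !mem_words => /andP[/eqP sc /allP cD] /andP[_ /allP wD].
  have all1 d d' : d \in enum D -> d' \in enum D -> d.2 = d'.2 :> nat.
    move=> dD d'D; apply/eqP; apply: contrapT => /negP h; apply: rows.
    by exists d, d'.
  move: sw; rewrite -sc => {zk sc}.
  elim: c cD w wD {wo wi hab1 hab2} => [|d c IH] cD [|d' w] wD //= [sw].
  congr cons; first by apply: all1; [apply: cD|apply: wD]; rewrite mem_head.
  apply: IH => // x hx; [apply: cD|apply: wD]; by rewrite in_cons hx orbT.
set a := cnorm (z.1 - (bmw w p).1) in hab1 hab2.
set b := cnorm (z.2 - (bmw w p).2) in hab1 hab2.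
have sc : size c = N by move: cN; rewrite mem_words => /andP[/eqP].
have hb : b <= (m%:R ^+ N)^-1.
  rewrite /b zk.
  have -> : cnorm ((toTorus (bmw c k)).2 - (bmw w p).2) = cnorm ((bmw c k).2 - (bmw w p).2).
    by rewrite /toTorus /= /Defs.frac addrAC -mulrNz cnormDint.
  apply: (le_trans (cnorm_norm _)); rewrite !bmwE //= ycw sc sw.
  have e2 (x s t d : R) : (x + s) / d - (x + t) / d = (s - t) / d by ring.
  rewrite e2 normrM [`|_^-1|]ger0_norm ?invr_ge0 ?exprn_ge0 //.
  by apply: ler_piMl; rewrite ?invr_ge0 ?exprn_ge0 // unit_diff //; [case: Q|case: P].
have d1 : (m%:R ^+ N)^-1 <= 1 :> R.
  by rewrite invf_le1 ?exprn_gt0 // -natrX ler1n expn_gt0 m0.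
have a0 : 0 <= a by exact: cnorm_ge0.
have b0 : 0 <= b by exact: cnorm_ge0.
have hae : `|a - e| <= (n%:R ^+ r)^-1.
  apply: le_trans hnum; rewrite ler_pdivlMr //.
  have h1 : b ^+ 2 <= (m%:R ^+ N)^-1.
    apply: le_trans (hb); rewrite expr2; apply: ler_piMl => //; exact: le_trans hb d1.
  have h2 : a < e.
    rewrite -(ltr_pXn2r (n := 2)) ?nnegrE ?(ltW e0) //.
    by apply: le_lt_trans hab1; rewrite lerDl sqr_ge0.
  rewrite ltr0_norm ?subr_lt0 //; move: hab2; nra.
have key s : cnorm (z.1 - (bmw w p).1 + s) <= (n%:R ^+ r)^-1 -> S (z.1 + s) N w.
  move=> hs; apply/asboolP; exists p.1; first by case: P.
  by move: hs; rewrite bmwE //= sw addrAC.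
case: (cnorm_near hae) => [hm|hp].
  have -> : S (z.1 - e) N w by apply: key.
  exact: leq_addr.
have -> : S (z.1 + e) N w by apply: key.
exact: leq_addl.
Qed.

(** A cylinder of level l0 containing z has diameter less than e, so all words extending it are
    inner. *)
Lemma inner_count_ge z e (N l0 : nat) : X z -> (l0 <= N)%N -> 2 / m%:R ^+ l0 < e ->
  (q ^ (N - l0) <= count (inner_hole z e N) (words (enum D) N))%N.
Proof.
move=> Xz lN he; have [c cL [k Q zk]] := code_of_point l0 Xz.
have sc : size c = l0 by move: cL; rewrite mem_words => /andP[/eqP].
rewrite -szD -size_words -(size_map (cat c)) -size_filter.
apply: uniq_leq_size.
  rewrite map_inj_uniq ?words_uniq ?enum_uniq // => v v' /eqP.
  by rewrite eqseq_cat // eqxx => /eqP.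
move=> _ /mapP[v vL ->]; rewrite mem_filter; apply/andP; split; last first.
  move: cL vL; rewrite !mem_words => /andP[_ cD] /andP[/eqP sv vD].
  by rewrite size_cat sc sv subnKC // eqxx all_cat cD vD.
have sv : size v = (N - l0)%N by move: vL; rewrite mem_words => /andP[/eqP].
rewrite /inner_hole size_cat sc sv subnKC // eqxx /=; apply/asboolP => p P.
rewrite zk torus_dist_toTorusl bmw_cat; apply: le_lt_trans he.
apply: (le_trans (torus_dist_leD _ _)).
have [h1 h2] := bmw_diff n0 m0 c Q (bmw_unit n0 m0 v P); rewrite sc in h1 h2.
have := le_trans (cnorm_norm _) h1; have := le_trans (cnorm_norm _) h2.
have := expVn_mn l0; lra.
Qed.

End HoleGeometry.

(** * Typical points *)

Section Coordinates.
Variables (R : realType) (n m : nat).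
Hypotheses (m2 : (1 < m)%N) (mn : (m < n)%N).
Variables (D : {set 'I_n * 'I_m}) (K : set (R * R)).
Hypothesis hK : is_attractor D K.
Let X := @toTorus R @` K.
Implicit Types (w u v : seq ('I_n * 'I_m)) (z : R * R) (e : R) (co : bool).

Let n2 : (1 < n)%N. Proof. exact: ltn_trans mn. Qed.
Let n0 : (0 < n)%N. Proof. exact: ltnW. Qed.
Let m0 : (0 < m)%N. Proof. exact: ltnW. Qed.

(* The two coordinates are treated uniformly: [true] selects the x-axis. *)
Definition crd co z : R := if co then z.1 else z.2.
Definition bs co : nat := if co then n else m.
Definition dg co (d : 'I_n * 'I_m) : nat := if co then nat_of_ord d.1 else nat_of_ord d.2.
Definition spread co := exists d d', [/\ d \in enum D, d' \in enum D & dg co d != dg co d'].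

Let b2 co : (1 < bs co)%N. Proof. by case: co. Qed.
Let bR co : 0 < (bs co)%:R :> R. Proof. by rewrite ltr0n ltnW. Qed.
Let dgb co d : (dg co d < bs co)%N. Proof. by case: co => /=; exact: ltn_ord. Qed.

Lemma crd_bmw co w z : crd co (bmw w z) =
  ((num (bs co) (map (dg co) w))%:R + crd co z) / (bs co)%:R ^+ size w.
Proof. by case: co; rewrite /crd bmwE. Qed.

Lemma crd_bm_map co d z : crd co (@bm_map R n m d z) = (crd co z + (dg co d)%:R) / (bs co)%:R.
Proof. by case: co. Qed.

Lemma crd_unit co z : unit_square z -> 0 <= crd co z <= 1.
Proof. by case: co => -[]. Qed.

Lemma crd_torus co z : torus z -> 0 <= crd co z < 1.
Proof. by case: co => -[]. Qed.

Lemma crd_toTorus co z : crd co (toTorus z) = frac (crd co z).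
Proof. by case: co. Qed.

Lemma crd_iter co k z : exists a : int,
  crd co (iter k (@torus_map R n m) z) = (bs co)%:R ^+ k * crd co z + a%:~R.
Proof. by have [a [b ->]] := iter_torus_map n m k z; case: co => /=; [exists a|exists b]. Qed.

Lemma cnorm_torus_dist co z z' e : torus_dist z z' < e -> cnorm (crd co z - crd co z') < e.
Proof. by move/torus_dist_lt => [h1 h2]; case: co. Qed.

(** Two points of K whose codes differ only in letter L + 1, being d and d' there, have coordinates
    differing by (dg d - dg d') / b^(L+1). Integrality of M times both makes M (dg d - dg d') a
    nonzero multiple of b^(L+1), impossible for large L. *)
Lemma exists_nonresonant co (M : nat) : spread co -> (0 < M)%N ->
  exists2 z, X z & cnorm (M%:R * crd co z) <> 0.
Proof.
move=> [d [d' [dD d'D dd']]] M0; apply: contrapT => hall.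
have {}hall z : K z -> cnorm (M%:R * crd co z) = 0.
  move=> Kz; apply: contrapT => h; apply: hall; exists (toTorus z); first by exists z.
  have -> // : cnorm (M%:R * crd co (toTorus z)) = cnorm (M%:R * crd co z).
  rewrite crd_toTorus /Defs.frac mulrBr -[M%:R]/(M%:Z%:~R) -intrM -mulrNz.
  exact: cnormDint.
have [[k Kk] _ _] := hK; rewrite !mem_enum in dD d'D.
have [L hL] := expVn_small (M%:R * (bs co)%:R : R) (b2 co) ltr01.
have KL x : x \in D -> K (bmw (rcons (nseq L d) x) k).
  move=> xD; apply: (attractor_bmw hK) => //; rewrite all_rcons; apply/andP; split; first exact: xD.
  by apply/allP => y /nseqP[-> _].
have := hall _ (KL d dD); have := hall _ (KL d' d'D); rewrite !crd_bmw !size_rcons size_nseq.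
rewrite -!cats1 !map_cat !num_cat /= !muln1 !addn0.
set B := num _ _; set P := _ ^+ L.+1.
have P0 : 0 < P by rewrite exprn_gt0.
move=> /cnorm_eq0[a ha] /cnorm_eq0[a' ha'].
have e1 : M%:R * ((dg co d)%:R - (dg co d')%:R) = (a' - a)%:~R * P.
  rewrite intrD mulrNz -ha -ha' !natrD; field; exact: lt0r_neq0.
have hP : M%:R * (bs co)%:R < P.
  move: hL; rewrite ltr_pdivrMr ?exprn_gt0 // mul1r => hL; apply: (lt_le_trans hL).
  by rewrite /P exprS ler_peMl ?exprn_ge0 ?(ltW (bR _)) // ler1n ltnW.
have MR : 0 < M%:R :> R by rewrite ltr0n.
have ne : a' - a != 0.
  apply/eqP => h; move/eqP: e1; rewrite h mul0r mulf_eq0 subr_eq0 eqr_nat.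
  by rewrite (negbTE dd') (gt_eqF MR).
have h1 : P <= `|(a' - a)%:~R * P|.
  rewrite normrM (gtr0_norm P0) ler_peMl ?(ltW P0) //.
  by rewrite -intr_norm ler1z; move: ne; clear; lia.
have h2 : `|M%:R * ((dg co d)%:R - (dg co d')%:R)| <= M%:R * (bs co)%:R :> R.
  rewrite normrM (gtr0_norm MR) ler_pM2l // ler_norml.
  have := dgb co d; have := dgb co d'; rewrite -!(ltr_nat R).
  have : 0 <= (dg co d)%:R :> R by []. have : 0 <= (dg co d')%:R :> R by [].
  by lra.
by move: h1 h2; rewrite -e1 => h1 h2; have := le_lt_trans (le_trans h1 h2) hP; rewrite ltxx.
Qed.

(** After two maps with distinct digits a coordinate is interior, since not both digits are 0 and
    not both are maximal. Interior coordinates stay interior, so the axes can be treated in turn. *)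
Lemma exists_interior : exists2 k, K k & forall co, spread co -> 0 < crd co k < 1.
Proof.
have step co d z : 0 <= crd co z <= 1 ->
    (0 < crd co z \/ (0 < dg co d)%N) -> (crd co z < 1 \/ (dg co d < (bs co).-1)%N) ->
    0 < crd co (@bm_map R n m d z) < 1.
  move=> /andP[z0 z1] h1 h2; rewrite crd_bm_map divr_gt0 ?andbT //=; last first.
    case: h1 => [h1|h1]; first by rewrite ltr_wpDr.
    by rewrite ltr_wpDl // ltr0n.
  rewrite ltr_pdivrMr // mul1r; case: h2 => h2.
    have : (dg co d)%:R + 1 <= (bs co)%:R :> R by rewrite natr1 ler_nat dgb.
    by move: h2; lra.
  have : (dg co d)%:R + 2 <= (bs co)%:R :> R by rewrite -natrD ler_nat; move: h2; clear; lia.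
  by move: z1; lra.
have step1 co d z : 0 < crd co z < 1 -> 0 < crd co (@bm_map R n m d z) < 1.
  by move=> /andP[h1 h2]; apply: step; [rewrite !ltW|left|left].
have unitK z : K z -> unit_square z by exact: (attractor_unit m2 mn hK).
have KD d z : d \in enum D -> K z -> K (bm_map d z).
  by rewrite mem_enum => dD Kz; apply: (attractor_step hK).
have two co z : spread co -> K z -> exists2 z', K z' & 0 < crd co z' < 1.
  move=> [d [d' [dD d'D dd']]] Kz.
  exists (bm_map d (bm_map d' z)); first by apply: (KD) => //; apply: KD.
  have := crd_unit co (unitK _ Kz) => /andP[z0 z1].
  have hz' := crd_unit co (unitK _ (KD _ _ d'D Kz)).
  apply: step => //.
    have [d0|d0] := posnP (dg co d); last by right.
    left; rewrite crd_bm_map divr_gt0 // ltr_wpDl // ltr0n.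
    by move: dd'; rewrite d0; clear; case: (dg co d').
  have [d1|d1] := ltnP (dg co d) (bs co).-1; first by right.
  left; rewrite crd_bm_map ltr_pdivrMr // mul1r.
  have : (dg co d').+2%:R <= (bs co)%:R :> R.
    by rewrite ler_nat; have := dgb co d; have := dgb co d'; move: dd' d1; clear; lia.
  rewrite -addn2 natrD; move: z1; lra.
have [[k Kk] _ _] := hK.
have [k1 Kk1 h1] : exists2 k1, K k1 & (spread true -> 0 < crd true k1 < 1).
  by have [/two/(_ Kk)[z' Kz' hz']|h] := pselect (spread true); [exists z'|exists k].
have [sf|nsf] := pselect (spread false); last first.
  by exists k1 => // -[] // /nsf.
have [d [d' [dD d'D dd']]] := sf.
exists (bm_map d (bm_map d' k1)); first by apply: (KD) => //; apply: KD.
case=> [st|_]; first by apply: (step1); apply: (step1); exact: h1.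
have := crd_unit false (unitK _ Kk1) => /andP[z0 z1].
have hz' := crd_unit false (unitK _ (KD _ _ d'D Kk1)).
apply: step => //.
  have [d0|d0] := posnP (dg false d); last by right.
  left; rewrite crd_bm_map divr_gt0 // ltr_wpDl // ltr0n.
  by move: dd'; rewrite d0; clear; case: (dg false d').
have [d1|d1] := ltnP (dg false d) (bs false).-1; first by right.
left; rewrite crd_bm_map ltr_pdivrMr // mul1r.
have : (dg false d').+2%:R <= (bs false)%:R :> R.
  by rewrite ler_nat; have := dgb false d; have := dgb false d'; move: dd' d1; clear; lia.
rewrite -addn2 natrD; move: z1; lra.
Qed.

(** A direction in which all digits agree is left free: there all points of X share one coordinate,
    possibly on the edge of the cell. *)
Definition open_cell d : set (R * R) := [set z | forall co, spread co ->
  (dg co d)%:R / (bs co)%:R < crd co z < ((dg co d)%:R + 1) / (bs co)%:R].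

Lemma measurable_crd co : measurable_fun [set: R * R] (crd co).
Proof. by case: co; [exact: measurable_fst|exact: measurable_snd]. Qed.

Lemma measurable_open_cell d : measurable (open_cell d).
Proof.
pose Aco co : set (R * R) := [set z | spread co ->
  (dg co d)%:R / (bs co)%:R < crd co z < ((dg co d)%:R + 1) / (bs co)%:R].
have mA co : measurable (Aco co).
  have [sp|nsp] := pselect (spread co); last first.
    by rewrite (_ : Aco co = setT) //; apply/seteqP; split=> // z _ /nsp.
  rewrite (_ : Aco co = [set: R * R] `&` crd co @^-1`
     `](dg co d)%:R / (bs co)%:R, ((dg co d)%:R + 1) / (bs co)%:R[).
    exact: measurable_crd.
  by rewrite setTI; apply/seteqP; split; [move=> z /= /(_ sp)|move=> z /= + _]; rewrite in_itv.
rewrite (_ : open_cell d = Aco true `&` Aco false); first exact: measurableI.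
by apply/seteqP; split => [z h|z [h1 h2] [|]]; [split; exact: h| |].
Qed.

Section TypicalPoints.
Variable nu : probability (R * R)%type R.
Let f := @torus_map R n m.
Hypotheses (hinv : invariant_measure nu f) (herg : ergodic_measure nu f).
Hypothesis hsupp : torus_support nu = X.

Lemma measurable_torus : measurable (@torus R).
Proof.
rewrite (_ : @torus R = ([set: R * R] `&` fst @^-1` `[0, 1[) `&`
   ([set: R * R] `&` snd @^-1` `[0, 1[)).
  by apply: measurableI; [apply: measurable_fst|apply: measurable_snd].
by rewrite !setTI; apply/seteqP; split => z /=; rewrite !in_itv.
Qed.

Lemma measurable_ball z e : measurable (torus_ball z e).
Proof. by apply: measurableI; [exact: measurable_torus|exact: measurable_torus_dist]. Qed.

(** The points with M times the coordinate integral form a forward invariant set. Measure 1 would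
    make a ball about the point of [exists_nonresonant] null, against full support. These null sets
    handle both periodic points and grid lines. *)
Lemma nonresonant_ae : {ae nu, forall z co M, spread co -> (0 < M)%N ->
  cnorm (M%:R * crd co z) <> 0}.
Proof.
pose A co (M : nat) : set (R * R) := [set z | cnorm (M%:R * crd co z) = 0].
have mA co M : measurable (A co M).
  rewrite (_ : A co M = [set: R * R] `&` (fun z => cnorm (M%:R * crd co z)) @^-1` [set 0]).
    apply: (measurableT_comp (@measurable_cnorm R)) => //.
    by apply: measurable_funM => //; exact: measurable_crd.
  by rewrite setTI; apply/seteqP; split.
have fA co M : A co M `<=` f @^-1` A co M.
  move=> z; rewrite /A /= => h.
  have -> : crd co (f z) = frac ((bs co)%:R * crd co z) by case: co {h}.
  rewrite /Defs.frac mulrBr -[X in _ - X * _]/(M%:Z%:~R) -intrM -mulrNz cnormDint mulrCA.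
  apply/eqP; rewrite eq_le cnorm_ge0 andbT; apply: (le_trans (cnormMn _ _)).
  by rewrite h mulr0.
have A0 co M : spread co -> (0 < M)%N -> nu (A co M) = 0%E.
  move=> sp M0; have [//|A1] := ergodic_forward_invariant hinv herg (mA co M) (fA co M).
  have [z Xz hz] := exists_nonresonant sp M0.
  have MR : 0 < M%:R :> R by rewrite ltr0n.
  set g := cnorm (M%:R * crd co z) in hz.
  have g0 : 0 < g by rewrite lt_neqAle cnorm_ge0 andbT; apply/eqP => h; apply: hz.
  have : torus_support nu z by rewrite hsupp.
  move=> [_ /(_ (g / M%:R) (divr_gt0 g0 MR))].
  suff : (nu (torus_ball z (g / M%:R)) <= 0)%E by move=> h h'; have := lt_le_trans h' h; rewrite ltxx.
  apply: (@le_trans _ _ (nu (~` A co M))); last first.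
    by rewrite probability_setC // A1 subee.
  apply: le_measure; rewrite ?inE; [exact: measurable_ball|exact: measurableC|].
  move=> w [_ /(cnorm_torus_dist co) hw] Aw.
  move: hw; rewrite ltNge => /negP; apply; rewrite ler_pdivrMr // mulrC.
  apply: le_trans (cnormMn _ _); rewrite mulrBr.
  have := cnormD (M%:R * crd co z - M%:R * crd co w) (M%:R * crd co w).
  by rewrite subrK Aw addr0.
have neg co : nu.-negligible (\bigcup_M (A co M.+1 `&` [set _ | spread co])).
  apply: negligible_bigcup => M; have [sp|nsp] := pselect (spread co).
    exists (A co M.+1); split; [exact: mA|exact: A0|by move=> z []].
  by exists set0; split; [|exact: measure0|move=> z [_ /nsp]].
have := negligibleU (neg true) (neg false); apply: negligibleS => z /=.
move=> /existsNP[co /existsNP[[|M] /not_implyP[sp /not_implyP[M0 /contrapT h]]]] //.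
by case: co sp h => sp h; [left|right]; exists M.
Qed.

(** The cell has positive measure: it contains a ball about the image under [bm_map d] of an
    interior point of K. *)
Lemma recurrence_ae d : d \in D ->
  {ae nu, forall z k, exists2 j, (k <= j)%N & open_cell d (iter j f z)}.
Proof.
move=> dD; apply: (ergodic_recurrence hinv herg (measurable_open_cell d)).
have [k Kk hk] := exists_interior.
pose z := toTorus (bm_map d k).
have Xz : X z by exists (bm_map d k) => //; exact: (attractor_step hK).
have zE co : spread co -> crd co z = (crd co k + (dg co d)%:R) / (bs co)%:R.
  move=> sp; have := hk co sp => /andP[k0 k1].
  rewrite /z crd_toTorus crd_bm_map frac_id // divr_ge0 ?addr_ge0 ?(ltW k0) ?(ltW (bR _)) //=.
  rewrite ltr_pdivrMr // mul1r.
  have : (dg co d)%:R + 1 <= (bs co)%:R :> R by rewrite natr1 ler_nat dgb.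
  by move: k1; lra.
have Tz : torus z by exact: toTorus_torus.
have cell co : exists2 e, 0 < e & forall y, torus y -> cnorm (crd co z - crd co y) < e ->
    spread co -> (dg co d)%:R / (bs co)%:R < crd co y < ((dg co d)%:R + 1) / (bs co)%:R.
  have [sp|nsp] := pselect (spread co); last by exists 1.
  have := hk co sp => /andP[k0 k1].
  have z1 : (dg co d)%:R / (bs co)%:R < crd co z.
    by rewrite zE // ltr_pM2r ?invr_gt0 // ltrDr.
  have z2 : crd co z < ((dg co d)%:R + 1) / (bs co)%:R.
    by rewrite zE // ltr_pM2r ?invr_gt0 // addrC ltrD2l.
  have d0 : 0 <= (dg co d)%:R / (bs co)%:R :> R by rewrite divr_ge0.
  have d1 : ((dg co d)%:R + 1) / (bs co)%:R <= 1 :> R.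
    by rewrite ler_pdivrMr // mul1r natr1 ler_nat dgb.
  exists (Num.min (crd co z - (dg co d)%:R / (bs co)%:R)
             (((dg co d)%:R + 1) / (bs co)%:R - crd co z)).
    by rewrite lt_min !subr_gt0 z1 z2.
  move=> y Ty; have /andP[w0 w1] := crd_torus co Ty.
  have [a ->] := cnormE (crd co z - crd co y) => + _; rewrite lt_min => /andP[].
  move: (_ / _) (_ / _) d0 d1 z1 z2 => p1 p2 d0 d1 z1 z2; rewrite !ltr_norml.
  move: (crd co z) (crd co y) z1 z2 w0 w1 => x y' z1 z2 w0 w1 /andP[h1 h2] /andP[h3 h4].
  have a1 : (- 1 < a) by rewrite -(ltr_int R) mulrNz; lra.
  have a2 : (a < 1) by rewrite -(ltr_int R); lra.
  have a0 : a = 0 by move: a1 a2; clear; lia.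
  by move: h1 h2 h3 h4; rewrite a0 => *; lra.
have [e1 e10 h1] := cell true; have [e2 e20 h2] := cell false.
have e0 : 0 < Num.min e1 e2 by rewrite lt_min e10 e20.
have : torus_support nu z by rewrite hsupp.
move=> [_ /(_ _ e0)] h; apply: (lt_le_trans h); apply: le_measure; rewrite ?inE.
- exact: measurable_ball.
- exact: measurable_open_cell.
move=> w [Tw hw] [|] sp; [apply: h1 => //|apply: h2 => //];
  by apply: cnorm_torus_dist; apply: (lt_le_trans hw); rewrite ge_min lexx ?orbT.
Qed.

End TypicalPoints.

(** A return after p steps would make b^p - 1 times the coordinate an integer. *)
Lemma nonresonant_nonperiodic co z p : (0 < p)%N -> spread co ->
  (forall M, (0 < M)%N -> cnorm (M%:R * crd co z) <> 0) ->
  cnorm (crd co z - crd co (iter p (@torus_map R n m) z)) <> 0.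
Proof.
move=> p0 sp h; have [a ->] := crd_iter co p z.
have bp : (1 < bs co ^ p)%N by rewrite -[1%N](exp1n p) ltn_exp2r.
have := h ((bs co ^ p).-1) ltac:(clear -bp; lia).
rewrite -cnormN -(cnormDint _ (- a)) mulrNz; set x := - _ - _; set y := _ - _.
suff -> : x = y by [].
rewrite /x /y -subn1 natrB ?(ltnW bp) // natrX; ring.
Qed.

(** An overlap with shift i gives a point within e of z whose i-th iterate is also within e of z. As
    T^i expands by at most n^i, T^i z would be too close to z. *)
Lemma no_return z (J : nat) : torus z ->
  (forall p, (0 < p)%N -> iter p (@torus_map R n m) z <> z) ->
  exists2 e0, 0 < e0 & forall e N i, e <= e0 -> (0 < i <= J)%N ->
    retcount (inner_hole z e N) (enum D) N i = 0%N.
Proof.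
move=> Tz hz.
have each i : exists2 e0, 0 < e0 & forall e N, e <= e0 -> (0 < i)%N ->
    retcount (inner_hole z e N) (enum D) N i = 0%N.
  have [->|i0] := posnP i; first by exists 1.
  pose zi := iter i (@torus_map R n m) z.
  have nR : 1 <= n%:R ^+ i :> R by rewrite -natrX ler1n expn_gt0 n0.
  have d0 : 0 < torus_dist z zi.
    rewrite lt_neqAle sqrtr_ge0 andbT; apply/eqP => h; apply: (hz i i0).
    by apply/esym/torus_dist_eq => //; exact: iter_torus.
  (* Each coordinate of z and T^i z would differ by at most (1 + n^i) e, so their distance would be
     at most 4 n^i e, less than 5 n^i e. *)
  exists (torus_dist z zi / (5 * n%:R ^+ i)); first by rewrite divr_gt0 // mulr_gt0 //; lra.
  move=> e N he _; apply/eqP; rewrite /retcount -leqn0 leqNgt -has_count.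
  apply/hasP => -[x]; rewrite mem_words => /andP[/eqP sx _] /andP[U1 U2].
  move: U1 U2 => /andP[_ /asboolP h1] /andP[_ /asboolP h2].
  have {}h1 := h1 0 (@unit_square0 R).
  have {}h2 := h2 _ (bmw_unit n0 m0 (drop N x) (@unit_square0 R)).
  rewrite -bmw_cat cat_take_drop in h2.
  have si : size (take i x) = i by rewrite size_takel // sx leq_addl.
  have hc co : cnorm (crd co z - crd co zi) <= e + n%:R ^+ i * e.
    have [a ha] := crd_iter co i z.
    have k1 := cnorm_torus_dist co h1; have k2 := cnorm_torus_dist co h2.
    have bn : (bs co)%:R ^+ i <= n%:R ^+ i :> R.
      by rewrite -!natrX ler_nat leq_exp2r //; case: (co); rewrite /bs // ltnW.
    have k3 : cnorm ((bs co)%:R ^+ i * (crd co z - crd co (bmw x 0))) <= n%:R ^+ i * e.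
      rewrite -natrX; apply: (le_trans (cnormMn _ _)); rewrite natrX.
      by apply: ler_pM => //; [exact: cnorm_ge0|exact: ltW].
    have k4 : cnorm ((bs co)%:R ^+ i * (crd co z - crd co (bmw x 0))) =
              cnorm (crd co (bmw (drop i x) 0) - crd co zi).
      rewrite /zi ha -[x in bmw x 0](cat_take_drop i) bmw_cat [crd co (bmw (take i x) _)]crd_bmw si.
      set y := crd co (bmw _ _); set Y := num _ _.
      rewrite -[RHS]cnormN -[LHS](cnormDint _ (Y%:Z + a)) intrD -pmulrn.
      by congr cnorm; field; rewrite expf_neq0 // gt_eqF.
    have -> : crd co z - crd co zi =
       (crd co z - crd co (bmw (drop i x) 0)) + (crd co (bmw (drop i x) 0) - crd co zi) by ring.
    apply: (le_trans (cnormD _ _)); rewrite -k4; apply: lerD => //; exact: ltW.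
  have := torus_dist_leD z zi; have := hc true; have := hc false; rewrite /crd => c1 c2 c3.
  have e0 : 0 < e by apply: le_lt_trans h1; exact: sqrtr_ge0.
  have hP : e <= n%:R ^+ i * e by rewrite ler_peMl // ltW.
  move: he; rewrite ler_pdivlMr; last by lra.
  lra.
elim: J => [|J [e1 e10 h1]].
  by exists 1 => // e N [|i].
have [e2 e20 h2] := each J.+1.
exists (Num.min e1 e2); first by rewrite lt_min e10 e20.
move=> e N i; rewrite le_min => /andP[he1 he2] /andP[i0 iJ].
have [->|ne] := eqVneq i J.+1; first exact: h2.
by apply: h1 => //; rewrite i0 -ltnS ltn_neqAle ne.
Qed.

(** As M x is not an integer, k is neither 0 nor 1, and every other cell stays at distance at least
    min(k, 1 - k) / M from x modulo 1. *)
Lemma cell_interior (M V : nat) (k x : R) : (0 < M)%N -> (V < M)%N -> 0 <= k <= 1 ->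
  cnorm (x - (V%:R + k) / M%:R) = 0 -> cnorm (M%:R * x) <> 0 ->
  exists2 e0, 0 < e0 & forall (W : nat) (q : R), (W < M)%N -> 0 <= q <= 1 ->
    cnorm (x - (W%:R + q) / M%:R) < e0 -> W = V.
Proof.
move=> M0 VM /andP[k0 k1] hx hMx.
have MR : 0 < M%:R :> R by rewrite ltr0n.
have [a ha] := cnorm_eq0 hx.
have xE : M%:R * x = V%:R + k + M%:R * a%:~R.
  by rewrite -ha; field; exact: lt0r_neq0.
have k0' : 0 < k.
  rewrite lt_neqAle k0 andbT; apply/eqP => h; apply: hMx.
  rewrite xE -h addr0 -[V%:R]/(V%:Z%:~R) -[M%:R]/(M%:Z%:~R) -intrM -intrD; exact: cnorm_int.
have k1' : k < 1.
  rewrite lt_neqAle k1 andbT; apply/eqP => h; apply: hMx.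
  rewrite xE h -[V%:R]/(V%:Z%:~R) -[M%:R]/(M%:Z%:~R) -[1]/(1%:~R) -intrM -!intrD; exact: cnorm_int.
exists (Num.min k (1 - k) / M%:R); first by rewrite divr_gt0 // lt_min k0' subr_gt0.
move=> W q WM /andP[q0 q1].
have [c ->] := cnormE (x - (W%:R + q) / M%:R); rewrite ltr_pdivlMr // -(gtr0_norm MR) -normrM.
rewrite (gtr0_norm MR) mulrC !mulrBr xE mulrCA divff ?gt_eqF // mulr1.
pose t : int := V%:Z - W%:Z + M%:Z * (a - c).
have -> : V%:R + k + M%:R * a%:~R - (W%:R + q) - M%:R * c%:~R = t%:~R + (k - q).
  by rewrite /t intrD intrM !intrD !mulrNz -!pmulrn; ring.
rewrite lt_min !ltr_norml => /andP[/andP[h1 h2] /andP[h3 h4]].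
have t1 : t < 1 by rewrite -(ltr_int R); lra.
have t2 : - 1 < t by rewrite -(ltr_int R) mulrNz; lra.
have t0 : V%:Z - W%:Z + M%:Z * (a - c) = 0 by rewrite -/t; move: t1 t2; clear; lia.
move: (a - c) t0 => b t0.
have b0 : b = 0 by move: t0 VM WM; clear; nia.
by move: t0; rewrite b0 mulr0 addr0; clear; lia.
Qed.

Lemma not_spread co d d' : ~ spread co -> d \in enum D -> d' \in enum D -> dg co d = dg co d'.
Proof.
by move=> nsp dD d'D; apply/eqP; apply: contrapT => /negP h; apply: nsp; exists d, d'.
Qed.

(** Where digits vary, [cell_interior] keeps the other cells away from z; where they do not, all
    words of length s have the same digits. *)
Lemma unique_code z c k s : torus z -> c \in words (enum D) s -> unit_square k ->
  z = toTorus (bmw c k) ->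
  (forall co M, spread co -> (0 < M)%N -> cnorm (M%:R * crd co z) <> 0) ->
  exists2 e0, 0 < e0 & forall u q, u \in words (enum D) s -> unit_square q ->
    torus_dist z (bmw u q) < e0 -> u = c.
Proof.
move=> Tz cs Q zE hz; move: (cs); rewrite mem_words => /andP[/eqP sc /allP cD].
have nlt co w : (num (bs co) (map (dg co) w) < bs co ^ size w)%N.
  by rewrite -(size_map (dg co)) num_lt //; apply/allP => x /mapP[d _ ->].
have each co : exists2 e0, 0 < e0 & forall u q, u \in words (enum D) s -> unit_square q ->
    cnorm (crd co z - crd co (bmw u q)) < e0 ->
    num (bs co) (map (dg co) u) = num (bs co) (map (dg co) c).
  have [sp|nsp] := pselect (spread co); last first.
    exists 1 => // u q; rewrite mem_words => /andP[/eqP su /allP uD] _ _; congr num.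
    move: su; rewrite -sc; elim: (u) (c) uD cD => [|d u' IH] [|d' c'] uD cD //= [su].
    congr cons; first by apply: (not_spread nsp); [apply: uD|apply: cD]; rewrite mem_head.
    by apply: IH => // x hx; [apply: uD|apply: cD]; rewrite in_cons hx orbT.
  have bs0 : (0 < bs co ^ s)%N by rewrite expn_gt0 ltnW.
  have := nlt co c; rewrite sc => ltc.
  have hc : cnorm (crd co z - ((num (bs co) (map (dg co) c))%:R + crd co k) / (bs co ^ s)%:R) = 0.
    rewrite natrX -{1}sc -crd_bmw zE crd_toTorus /Defs.frac addrAC subrr add0r -mulrNz.
    exact: cnorm_int.
  have [e0 e00 he] := cell_interior bs0 ltc (crd_unit co Q) hc (hz co _ sp bs0).
  exists e0 => // u q us Qq; have : size u = s by move: us; rewrite mem_words => /andP[/eqP].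
  move=> su; have := nlt co u; rewrite su => ltu.
  by rewrite crd_bmw su -natrX => /(he _ _ ltu (crd_unit co Qq)).
have [e1 e10 h1] := each true; have [e2 e20 h2] := each false.
exists (Num.min e1 e2); first by rewrite lt_min e10 e20.
move=> u q us Qq hd.
have hcrd co : cnorm (crd co z - crd co (bmw u q)) < Num.min e1 e2 := cnorm_torus_dist co hd.
have su : size u = s by move: us; rewrite mem_words => /andP[/eqP].
apply: xynum_inj; first by rewrite su sc.
  by apply: (h1 u q) => //; apply: (lt_le_trans (hcrd true)); rewrite ge_min lexx.
by apply: (h2 u q) => //; apply: (lt_le_trans (hcrd false)); rewrite ge_min lexx orbT.
Qed.

(** The iterate lies, modulo integers, in the closed cell of the letter at position t. Lying in an
    open cell it is off the grid, so the integer is 0 and the letter is d. *)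
Lemma code_digit z c k s t d d0 : torus z -> c \in words (enum D) s -> unit_square k ->
  z = toTorus (bmw c k) -> (t < s)%N -> d \in D -> open_cell d (iter t (@torus_map R n m) z) ->
  nth d0 c t = d.
Proof.
move=> Tz; rewrite mem_words => /andP[/eqP sc /allP cD] Q zE ts dD hcell.
have tc : (t < size c)%N by rewrite sc.
have cE : c = take t c ++ nth d0 c t :: drop t.+1 c by rewrite -drop_nth // cat_take_drop.
have cDt : nth d0 c t \in enum D by apply: cD; rewrite mem_nth.
have st : size (take t c) = t by rewrite size_takel // ltnW.
have same co : dg co (nth d0 c t) = dg co d.
  have [sp|nsp] := pselect (spread co); last by apply: (not_spread nsp) => //; rewrite mem_enum.
  have /andP[h1 h2] := hcell co sp.
  set x := crd co _ in h1 h2.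
  have /andP[x0 x1] : 0 <= x < 1 by apply: crd_torus; exact: iter_torus.
  pose p := crd co (bmw (drop t.+1 c) k).
  have /andP[p0 p1] : 0 <= p <= 1 by apply: crd_unit; exact: bmw_unit.
  set d' := nth d0 c t in cE cDt *.
  have [a ha] : exists a : int, x = (p + (dg co d')%:R) / (bs co)%:R + a%:~R.
    have := @toTorus_bmw_iter R n m n0 m0 (take t c) (bmw (d' :: drop t.+1 c) k).
    rewrite -bmw_cat -cE -zE st => -[a [b hab]].
    rewrite -crd_bm_map /x hab -[bm_map d' _]/(bmw (d' :: drop t.+1 c) k).
    by case: (co); [exists a|exists b].
  have db : (dg co d')%:R + 1 <= (bs co)%:R :> R by rewrite natr1 ler_nat dgb.
  have y0 : 0 <= (p + (dg co d')%:R) / (bs co)%:R by rewrite divr_ge0 ?addr_ge0 // ltW.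
  have y1 : (p + (dg co d')%:R) / (bs co)%:R <= 1.
    by rewrite ler_pdivrMr // mul1r; move: p1 db; lra.
  have x0' : 0 < x by apply: le_lt_trans h1; rewrite divr_ge0 // ltW.
  have a1 : (- 1 < a) by rewrite -(ltr_int R) mulrNz; move: y1 x0' ha; lra.
  have a2 : (a < 1) by rewrite -(ltr_int R); move: y0 x1 ha; lra.
  have a0 : a = 0 by move: a1 a2; clear; lia.
  rewrite a0 addr0 in ha.
  move: h1 h2; rewrite ha !ltr_pM2r ?invr_gt0 // => h1 h2.
  have l1 : (dg co d < (dg co d').+1)%N.
    by rewrite -(ltr_nat R) -natr1; move: p1 h1; lra.
  have l2 : (dg co d' < (dg co d).+1)%N.
    by rewrite -(ltr_nat R) -natr1; move: p0 h2; lra.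
  by move: l1 l2; clear; lia.
have := same true; have := same false; rewrite /dg.
by case: (nth d0 c t) (d) => [i j] [i' j'] /= /ord_inj -> /ord_inj ->.
Qed.

End Coordinates.

Lemma geometric_small (R : realType) (C : nat) (eta : R) : 0 < eta ->
  exists k1, forall k0, (k1 <= k0)%N ->
    16 * ((C * (k0 + 2))%:R * (1 / 2) ^+ k0) <= eta.
Proof.
move=> eta0.
(* The linear factor is absorbed by k0 + 2 <= 2 (3/2)^k0, and (3/2) (1/2) = 3/4. *)
have [k1 hk1] := @exprn_small R (3 / 4) (eta / (32 * C.+1%:R)) ltac:(lra)
  ltac:(by rewrite divr_gt0 // mulr_gt0).
exists k1 => k0 /hk1; rewrite ltr_pdivlMr ?mulr_gt0 // => h.
have h32 (x : R) k : 0 <= x -> 1 + k%:R * x <= (1 + x) ^+ k.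
  move=> x0; elim: k => [|k IH]; first by rewrite mul0r addr0 expr0.
  rewrite exprS -natr1; have := ler_wpM2l (_ : 0 <= 1 + x) IH; rewrite addr_ge0 // => /(_ isT).
  by have : 0 <= k%:R * x * x by [rewrite !mulr_ge0]; nra.
have h1 : (k0 + 2)%:R <= 2 * (3 / 2) ^+ k0 :> R.
  have -> : 3 / 2 = 1 + 1 / 2 :> R by lra.
  rewrite natrD; have := h32 (1 / 2) k0 ltac:(lra); lra.
have h2 : (3 / 4) ^+ k0 = (3 / 2) ^+ k0 * (1 / 2) ^+ k0 :> R.
  by rewrite -exprMn; congr (_ ^+ _); lra.
have p2 : 0 <= (1 / 2) ^+ k0 :> R by apply: exprn_ge0; lra.
have CR : C%:R <= C.+1%:R :> R by rewrite ler_nat.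
have C0 : 0 <= C%:R :> R by [].
rewrite natrM; apply: ltW; apply: le_lt_trans h; rewrite h2.
have h4 := ler_wpM2r p2 h1.
have h5 : 0 <= (3 / 2) ^+ k0 * (1 / 2) ^+ k0 :> R by rewrite mulr_ge0 // exprn_ge0 //; lra.
have h6 := ler_wpM2l C0 h4; have h7 := ler_wpM2l h5 CR.
by move: h6 h7; set a := _ ^+ k0; set b := _ ^+ k0; set c := _%:R; set d := _%:R; set f := _%:R; lra.
Qed.

(** * Choice of the level of the approximating cylinders *)

Section HoleParameters.
Variables (R : realType) (n m : nat).
Hypotheses (m2 : (1 < m)%N) (mn : (m < n)%N).
Variables (D : {set 'I_n * 'I_m}) (K : set (R * R)).
Hypothesis hK : is_attractor D K.
Let X := @toTorus R @` K.
Implicit Types (w u v : seq ('I_n * 'I_m)) (z : R * R) (e : R).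

Let n2 : (1 < n)%N. Proof. exact: ltn_trans mn. Qed.
Let n0 : (0 < n)%N. Proof. exact: ltnW. Qed.
Let m0 : (0 < m)%N. Proof. exact: ltnW. Qed.
Let nR : 0 < n%:R :> R. Proof. by rewrite ltr0n. Qed.
Let mR : 0 < m%:R :> R. Proof. by rewrite ltr0n. Qed.
Let q := #|D|.

Lemma spread_card co : spread D co -> (1 < size (enum D))%N.
Proof.
move=> [d [d' [dD d'D dd']]]; case: (enum D) dD d'D => [//|a [|b s]] //.
by rewrite !inE => /eqP da /eqP d'a; rewrite da d'a eqxx in dd'.
Qed.

(** Every q2 letters make cells at least m^2 times thinner relative to their height. *)
Lemma contraction_exponent : exists q2, (m ^ (q2 + 2) <= n ^ q2)%N.
Proof.
have [k hk] := @exprn_small R (m%:R / n%:R) ((m%:R ^+ 2)^-1)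
  ltac:(by rewrite divr_ge0 //= ltr_pdivrMr // mul1r ltr_nat)
  ltac:(by rewrite invr_gt0 exprn_gt0).
exists k; have := hk k (leqnn _); rewrite expr_div_n ltr_pdivrMr ?exprn_gt0 //.
rewrite mulrC ltr_pdivlMr ?exprn_gt0 // -exprD -!natrX ltr_nat.
exact: ltnW.
Qed.

(** Confining c letters to q - 1 values gains a factor 2 q: the q pays for one of the l0 letters
    fixed in the inner words, the 2 gives the decay. *)
Lemma fraction_exponent : (1 < q)%N -> exists2 c, (0 < c)%N & (q.-1 ^ c * (2 * q) <= q ^ c)%N.
Proof.
move=> q1; have qR : 0 < q%:R :> R by rewrite ltr0n ltnW.
have [k hk] := @exprn_small R (q.-1%:R / q%:R) ((2 * q%:R)^-1)
  ltac:(by rewrite divr_ge0 //= ltr_pdivrMr // mul1r ltr_nat prednK // ltnW)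
  ltac:(by rewrite invr_gt0 mulr_gt0).
exists k.+1 => //; have := hk k.+1 (leqnSn _); rewrite expr_div_n ltr_pdivrMr ?exprn_gt0 //.
rewrite mulrC ltr_pdivlMr ?mulr_gt0 // -natrM -!natrX -natrM ltr_nat.
exact: ltnW.
Qed.

Lemma hole_scale z : X z -> spread D true \/ spread D false ->
  exists2 C, (0 < C)%N & forall k0 e, (n%:R ^+ k0.+1)^-1 < e -> e <= (n%:R ^+ k0)^-1 ->
    let N := (C * (k0 + 2))%N in
    (count (boundary_hole z e N) (words (enum D) N) * 2 ^ k0 <=
      12 * count (inner_hole z e N) (words (enum D) N))%N /\
    (0 < count (inner_hole z e N) (words (enum D) N))%N.
Proof.
move=> Xz sp.
have q1 : (1 < q)%N by rewrite /q cardE; case: sp => /spread_card.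
have [q2 hq2] := contraction_exponent; have [c c0 hc] := fraction_exponent q1.
(* In units of r the summand 2 q2 is the zoom length j, n serves to bound n^r by m^(n r), and 8
   absorbs the remaining powers of m and the numerical constants. *)
exists ((2 * q2 + n + 8) * (c * n))%N; first by rewrite !muln_gt0 c0 n0 !addn_gt0 orbT.
move=> k0 e he1 he2 N.
(* Since n <= m^n, one has m^l0 >= n^(k0 + 2) >= 2 n^(k0 + 1) > 2 / e, so a cylinder of level l0
   about z fits into the ball. At the boundary r letters are confined. *)
pose l0 := (n * (k0 + 2))%N; pose r := (c * l0)%N; pose j := (q2 * (2 * r))%N.
have NE : N = ((2 * q2 + n + 8) * r)%N by rewrite /N /r /l0 !mulnA.
have l00 : (0 < l0)%N by rewrite /l0 muln_gt0 n0 addn2.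
have r0 : (0 < r)%N by rewrite /r muln_gt0 c0.
have lr : (l0 <= r)%N by rewrite /r leq_pmull.
have Nj : N = (j + (n + 8) * r)%N by rewrite NE /j mulnCA mulnA -mulnDl addnA.
have rN : (r <= N)%N by rewrite NE leq_pmull // !addn_gt0 orbT.
have jrN : (j + r <= N)%N by rewrite Nj leq_add2l leq_pmull // !addn_gt0 orbT.
have e0 : 0 < e by apply: lt_trans he1; rewrite invr_gt0 exprn_gt0.
have e1 : e <= 1.
  by apply: (le_trans he2); rewrite invf_le1 ?exprn_gt0 // -natrX ler1n expn_gt0 n0.
have hl0 : 2 / m%:R ^+ l0 < e.
  apply: le_lt_trans he1; rewrite ler_pdivrMr ?exprn_gt0 // mulrC ler_pdivlMr ?exprn_gt0 //.
  rewrite -!natrX -natrM ler_nat; apply: (@leq_trans (n ^ (k0 + 2))).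
    by rewrite addn2 [(n ^ k0.+2)%N]expnS leq_mul2r n2 orbT.
  by rewrite /l0 expnM leq_exp2r ?addn2 // ltnW // ltn_expl.
have hin := inner_count_ge m2 mn hK Xz (leq_trans lr rN) hl0.
have hb : (count (boundary_hole z e N) (words (enum D) N) <= 12 * (q.-1 ^ r * q ^ (N - r)))%N.
  have [sf|nsf] := pselect (spread D false).
    apply: (@boundary_two_rows R n m m2 mn D z e N j r sf e1 jrN).
    pose P : R := m%:R ^+ r; pose Q : R := m%:R ^+ (r + j).
    have P0 : 0 < P by rewrite exprn_gt0.
    have Q0 : 0 < Q by rewrite exprn_gt0.
    have h1 : 12 * (P * Q) <= m%:R ^+ N.
      rewrite -exprD -natrX -natrM -natrX ler_nat.
      apply: (@leq_trans (m ^ 4 * m ^ (r + (r + j)))%N).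
        by rewrite leq_mul2r (leq_trans (_ : 12 <= 2 ^ 4)%N) ?orbT // leq_exp2r.
      rewrite -expnD leq_exp2l // Nj; have : (8 <= 8 * r)%N by rewrite leq_pmulr.
      rewrite mulnDl; lia.
    have h2 : 4 * (P * Q) <= n%:R ^+ j.
      rewrite -exprD -!natrX -natrM ler_nat.
      apply: (@leq_trans (m ^ ((q2 + 2) * (2 * r)))%N); last first.
        by rewrite /j (expnM m) (expnM n) leq_exp2r // muln_gt0 r0.
      apply: (@leq_trans (m ^ 2 * m ^ (r + (r + j)))%N).
        by rewrite leq_mul2r (leq_trans (_ : 4 <= 2 ^ 2)%N) ?orbT // leq_exp2r.
      by rewrite -expnD leq_exp2l // mulnDl -/j; lia.
    rewrite mulrDl [leRHS]splitr; apply: lerD.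
      rewrite mulrAC ler_pdivrMr ?exprn_gt0 //.
      apply: le_trans (ler_wpM2l _ h1); last by rewrite divr_ge0 // invr_ge0 ltW.
      by rewrite -/P -/Q le_eqVlt; apply/orP; left; apply/eqP; field; rewrite gt_eqF.
    rewrite mulrAC ler_pdivrMr ?exprn_gt0 //.
    apply: le_trans (ler_wpM2l _ h2); last by rewrite divr_ge0 // invr_ge0 ltW.
    by rewrite -/P -/Q le_eqVlt; apply/orP; left; apply/eqP; field; rewrite gt_eqF.
  have st : spread D true by case: sp.
  apply: leq_trans (_ : _ <= 8 * (q.-1 ^ r * q ^ (N - r)))%N _; last by rewrite leq_mul2r orbT.
  apply: (@boundary_one_row R n m m2 mn D K hK z e N r) => //.
  have he : (m%:R ^+ r)^-1 <= e.
    apply: ltW; apply: le_lt_trans hl0; apply: (@le_trans _ _ (m%:R ^+ l0)^-1).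
      rewrite lef_pV2 ?posrE ?exprn_gt0 //; apply: ler_weXn2l => //.
      by rewrite ler1n.
    by rewrite ler_peMl ?invr_ge0 ?exprn_ge0 // ler1n.
  have nr0 : 0 <= (n%:R ^+ r)^-1 :> R by rewrite invr_ge0 exprn_ge0.
  rewrite ler_pdivrMr //; apply: le_trans (ler_wpM2l nr0 he).
  rewrite -invfM ler_pdivrMr ?exprn_gt0 // mulrC ler_pdivlMr ?mulr_gt0 ?exprn_gt0 //.
  rewrite -!natrX -!natrM ler_nat mulnA.
  apply: (@leq_trans (m ^ 3 * (m ^ (n * r) * m ^ r))%N).
    rewrite -mulnA; apply: leq_mul; first by rewrite (leq_trans (_ : 7 <= 2 ^ 3)%N) // leq_exp2r.
    by rewrite leq_mul2r expnM leq_exp2r // (ltnW (ltn_expl _ _)) ?orbT.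
  rewrite -!expnD leq_exp2l // NE !mulnDl; have : (8 <= 8 * r)%N by rewrite leq_pmulr.
  lia.
split; last by apply: leq_trans hin; rewrite expn_gt0 (ltnW q1).
apply: (@leq_trans (count (boundary_hole z e N) (words (enum D) N) * 2 ^ l0)%N).
  by rewrite leq_mul2l leq_exp2l // (leq_trans (leq_addr 2 k0)) ?orbT // /l0 leq_pmull.
have ql : (0 < q ^ l0)%N by rewrite expn_gt0 (ltnW q1).
rewrite -(leq_pmul2r ql); apply: (@leq_trans (12 * q ^ N)%N); last first.
  rewrite -mulnA leq_mul2l /=; have -> : (q ^ N = q ^ (N - l0) * q ^ l0)%N.
    by rewrite -expnD subnK // (leq_trans lr).
  by rewrite leq_mul2r hin orbT.
rewrite -mulnA -expnMn; apply: (leq_trans (leq_mul hb (leqnn _))).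
rewrite -!mulnA leq_mul2l /=.
have -> : (q.-1 ^ r * (q ^ (N - r) * (2 * q) ^ l0) = (q.-1 ^ c * (2 * q)) ^ l0 * q ^ (N - r))%N.
  by rewrite (expnMn (q.-1 ^ c)) /r (expnM q.-1) mulnA mulnAC.
have -> : (q ^ N = q ^ r * q ^ (N - r))%N by rewrite -expnD subnKC.
by rewrite leq_mul2r /r expnM leq_exp2r // hc orbT.
Qed.

Lemma scale_exists k1 e : 0 < e -> e <= (n%:R ^+ k1)^-1 ->
  exists2 k0, (k1 <= k0)%N & (n%:R ^+ k0.+1)^-1 < e /\ e <= (n%:R ^+ k0)^-1.
Proof.
move=> e0 he; have lnn : 0 < ln (n%:R : R) by rewrite ln_gt0 // ltr1n.
have : k1%:R * ln n%:R <= - ln e by rewrite -expr_le_inv.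
move=> hk1; have E0 : 0 <= - ln e by apply: le_trans hk1; rewrite mulr_ge0 // ltW.
have [k0 [h1 h2]] := nat_log lnn E0.
exists k0; last first.
  by rewrite ltNge !expr_le_inv // h1 -ltNge -natr1.
rewrite -ltnS -(ltr_nat R) -natr1 -(ltr_pM2r lnn); exact: le_lt_trans h2.
Qed.

Definition hole_estimates z e (eta : R) N :=
  [/\ (0 < N)%N, (0 < count (inner_hole z e N) (words (enum D) N))%N,
      N%:R * density R (outer_hole z e N) (enum D) N <= eta,
      (count (outer_hole z e N) (words (enum D) N))%:R <=
        (1 + eta) * (count (inner_hole z e N) (words (enum D) N))%:R :> R &
      \sum_(1 <= i < N) (retcount (inner_hole z e N) (enum D) N i)%:R / (size (enum D))%:R ^+ i
        <= eta * (count (inner_hole z e N) (words (enum D) N))%:R].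

(** The conditions under which [mixed_growth] applies to the outer words and any alphabet missing
    d. *)
Definition marked_hole z e N d := exists2 t1, (t1 < N)%N &
  (forall d0 w, all (mem (enum D)) w -> outer_hole z e N w -> nth d0 w t1 = d) /\
  \sum_(t1.+1 <= t < N) (prefcount (outer_hole z e N) (enum D) t)%:R /
     (size (enum D))%:R ^+ t <= 1 / 4 :> R.

(** The threshold e0 combines three demands: no overlap with shift at most J, agreement of all outer
    words with the code of z up to position t1, and k0 large. The visit time t1 >= J is fixed before
    e. *)
Lemma hole_parameters z (eta : R) d : X z -> torus z -> spread D true \/ spread D false ->
  (forall co M, spread D co -> (0 < M)%N -> cnorm (M%:R * crd co z) <> 0) ->
  (forall k, exists2 j, (k <= j)%N & open_cell D d (iter j (@torus_map R n m) z)) ->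
  d \in D -> 0 < eta <= 1 / 2 ->
  exists2 e0, 0 < e0 & forall e, 0 < e -> e < e0 ->
    exists2 N, hole_estimates z e eta N & marked_hole z e N d.
Proof.
move=> Xz Tz sp hz hrec dD /andP[eta0 eta1].
have A1 : (1 < size (enum D))%N by case: sp => /spread_card.
have [C C0 hC] := hole_scale Xz sp.
(* With these constants [prefcount_sum] bounds the tails by 16 (eta / 64) + eta / 4 = eta / 2, which
   is also at most 1/4. *)
have [k1 hk1] := @geometric_small R C (eta / 4) ltac:(by rewrite divr_gt0).
have [J hJ] := @exprn_small R (1 / 2) (eta / 64) ltac:(lra) ltac:(by rewrite divr_gt0).
have np p : (0 < p)%N -> iter p (@torus_map R n m) z <> z.
  move=> p0 hp; have [co sco] : exists co, spread D co by case: sp => ?; [exists true|exists false].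
  apply: (@nonresonant_nonperiodic R n m m2 mn D co z p p0 sco (hz co ^~ sco)).
  by rewrite hp subrr; exact: (cnorm_int R 0).
have [e1 e10 hret] := no_return m2 mn D J Tz np.
have [t1 Jt1 ht1] := hrec J.
have [c cs [k Q zE]] := code_of_point m2 mn hK t1.+1 Xz.
have [e2 e20 huniq] := unique_code m2 mn Tz cs Q zE hz.
pose kk := maxn k1 (maxn J.+1 t1.+1).
pose e3 : R := (n%:R ^+ kk)^-1.
have e30 : 0 < e3 by rewrite invr_gt0 exprn_gt0.
exists (Num.min e1 (Num.min e2 e3)); first by rewrite !lt_min e10 e20.
move=> e e0; rewrite !lt_min => /andP[ee1 /andP[ee2 ee3]].
have [k0 kk0 [he1 he2]] := scale_exists e0 (ltW ee3).
move: kk0; rewrite /kk !geq_max => /andP[k1k0 /andP[Jk0 t1k0]].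
have [hb hin] := hC k0 e he1 he2; set N := (C * (k0 + 2))%N in hb hin.
have hgeo := hk1 k0 k1k0; rewrite -/N in hgeo.
have k0N : (k0 < N)%N.
  by apply: (@leq_trans (k0 + 2)%N); rewrite ?addn2 // /N addn2 leq_pmull.
have N0 : (0 < N)%N := leq_ltn_trans (leq0n _) k0N.
have pref i : (i <= k0)%N -> (prefcount (outer_hole z e N) (enum D) i <= 16)%N.
  move=> ik; apply: prefcount_outer => //; apply: (le_trans he2).
  rewrite lef_pV2 ?posrE ?exprn_gt0 //; apply: ler_weXn2l => //.
  by rewrite ler1n.
have prefi i : (i <= k0)%N -> (prefcount (inner_hole z e N) (enum D) i <= 16)%N.
  move=> ik; apply: prefcount_inner => //; apply: (le_trans he2).
  rewrite lef_pV2 ?posrE ?exprn_gt0 //; apply: ler_weXn2l => //.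
  by rewrite ler1n.
have half0 k' : 0 <= (1 / 2) ^+ k' :> R by apply: exprn_ge0; lra.
have tail U j : (forall i, (i <= k0)%N -> (prefcount U (enum D) i <= 16)%N) -> (J <= j)%N ->
    \sum_(j.+1 <= i < N) (prefcount U (enum D) i)%:R / (size (enum D))%:R ^+ i <= eta / 2 :> R.
  move=> hp Jj; apply: (le_trans (prefcount_sum R j N A1 hp)).
  rewrite mulrDr; have := hJ j Jj; move: hgeo; lra.
have N1 : 1 <= N%:R :> R by rewrite ler1n.
have hhalf : (1 / 2) ^+ k0 <= eta / 64.
  have : 16 * (1 / 2) ^+ k0 <= 16 * (N%:R * (1 / 2) ^+ k0) :> R.
    by rewrite ler_pM2l // ler_peMl.
  by move: hgeo; lra.
have szN U : (count U (words (enum D) N) <= prefcount U (enum D) N)%N by exact: count_le_prefcount.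
exists N.
  split => //.
  - apply: le_trans (_ : _ <= N%:R * (16 * (1 / 2) ^+ k0)) _; last first.
      by rewrite mulrCA; move: hgeo eta0; lra.
    apply: ler_wpM2l => //; rewrite /density ler_pdivrMr ?exprn_gt0 ?ltr0n ?(ltnW A1) //.
    have h1 : (count (outer_hole z e N) (words (enum D) N) <= 16 * size (enum D) ^ (N - k0))%N.
      apply: (leq_trans (szN _)); rewrite -{2}(subnKC (ltnW k0N)).
      by apply: (leq_trans (prefcountD _ _ _ _)); rewrite leq_mul2r pref ?orbT.
    move: h1; rewrite -(ler_nat R) natrM natrX => h1; apply: (le_trans h1).
    rewrite -{2}(subnKC (ltnW k0N)) exprD -[leRHS]mulrA ler_pM2l // mulrA.
    rewrite ler_peMl ?exprn_ge0 // -exprMn exprn_ege1 //.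
    have : 2 <= (size (enum D))%:R :> R by rewrite ler_nat.
    by lra.
  - have hcount : (count (outer_hole z e N) (words (enum D) N) <=
       count (inner_hole z e N) (words (enum D) N) + count (boundary_hole z e N) (words (enum D) N))%N.
      rewrite !count_sum -big_split; apply: leq_sum => w _; rewrite /boundary_hole.
      by case: (outer_hole _ _ _ _); case: (inner_hole _ _ _ _).
    move: hcount hb; rewrite -!(ler_nat R) natrD !natrM natrX => h1 h2.
    apply: (le_trans h1); rewrite mulrDl mul1r lerD2l.
    have e12 : (1 / 2) ^+ k0 * 2 ^+ k0 = 1 :> R.
      by rewrite -exprMn (_ : 1 / 2 * 2 = 1 :> R) ?expr1n //; lra.
    have h3 := ler_wpM2r (half0 k0) h2.
    rewrite -mulrA [2 ^+ k0 * _]mulrC e12 mulr1 in h3; apply: (le_trans h3).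
    have y0 : 0 <= (count (inner_hole z e N) (words (enum D) N))%:R :> R by [].
    have := ler_wpM2l y0 hhalf; have := mulr_ge0 (ltW eta0) y0; lra.
  - apply: le_trans (_ : _ <= \sum_(J.+1 <= i < N)
       (prefcount (inner_hole z e N) (enum D) i)%:R / (size (enum D))%:R ^+ i *
       (count (inner_hole z e N) (words (enum D) N))%:R) _.
      have JN : (J.+1 <= N)%N := leq_trans Jk0 (ltnW k0N).
      rewrite (big_cat_nat_idem _ (n := J.+1)) //=; last by rewrite addr0.
      rewrite [X in X + _]big_nat [X in X + _]big1 ?add0r; last first.
        by move=> i iJ; rewrite hret ?mul0r //; exact: ltW.
      rewrite big_nat [leRHS]big_nat; apply: ler_sum => i /andP[_ iN].
      rewrite mulrAC ler_wpM2r ?invr_ge0 ?exprn_ge0 // -natrM ler_nat.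
      by apply: retcount_le; exact: ltnW.
    rewrite -mulr_suml ler_wpM2r //; apply: (le_trans (tail _ _ prefi (leqnn J))).
    by move: eta0; lra.
exists t1; first exact: ltn_trans t1k0 k0N.
split; last by apply: (le_trans (tail _ _ pref Jt1)); move: eta1; lra.
move=> d0 w wD /andP[/eqP sw /asboolP[p P hd]].
have t1N : (t1.+1 <= N)%N := leq_trans t1k0 (ltnW k0N).
have wc : take t1.+1 w = c.
  apply: (huniq _ (bmw (drop t1.+1 w) p)).
  - rewrite mem_words size_takel ?sw // eqxx /=; apply/allP => x /mem_take xw.
    exact: (allP wD).
  - exact: bmw_unit.
  - by rewrite -bmw_cat cat_take_drop; exact: lt_trans ee2.
rewrite -(nth_take d0 (ltnSn t1)) wc.
exact: (code_digit m2 mn d0 Tz cs Q zE (ltnSn t1) dD ht1).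
Qed.

End HoleParameters.

(** * Dimensions of survivor sets *)

Section SurvivorDimension.
Variables (R : realType) (n m : nat).
Hypotheses (m2 : (1 < m)%N) (mn : (m < n)%N).
Variables (D : {set 'I_n * 'I_m}) (K : set (R * R)).
Hypothesis hK : is_attractor D K.
Let X := @toTorus R @` K.
Variables (z : R * R) (e : R) (N : nat).
Implicit Types (w u v : seq ('I_n * 'I_m)) (F : seq (seq ('I_n * 'I_m))).

Let n2 : (1 < n)%N. Proof. exact: ltn_trans mn. Qed.
Let n0 : (0 < n)%N. Proof. exact: ltnW. Qed.
Let m0 : (0 < m)%N. Proof. exact: ltnW. Qed.
Let A := enum D.
Let Y := survivor n m X (torus_ball z e).
Local Notation Uin := (inner_hole z e N).
Local Notation Uout := (outer_hole z e N).

Hypothesis A1 : (1 < size A)%N.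
Hypothesis N0 : (0 < N)%N.
Let q0 : 0 < (size A)%:R :> R. Proof. by rewrite ltr0n ltnW. Qed.

Lemma inner_size w : Uin w -> size w = N. Proof. by move=> /andP[/eqP]. Qed.
Lemma outer_size w : Uout w -> size w = N. Proof. by move=> /andP[/eqP]. Qed.

Section Upper.
Variable s : R.
Hypothesis s01 : 0 <= s <= 1 / 2.
Hypothesis Nin : N%:R * density R Uin A N <= 16^-1.
Hypothesis ret : \sum_(1 <= i < N) (retcount Uin A N i)%:R / (size A)%:R ^+ i
        <= s * (count Uin (words A N))%:R.
Hypothesis cov0 : \forall e' \near (0 : R)^'+, 0 < covering_number Y e'.

Definition upper_rate := (size A)%:R * (1 - density R Uin A N * (1 - 2 * s)).
Local Notation rho' := upper_rate.

Let dens0 : 0 <= density R Uin A N.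
Proof. by rewrite /density divr_ge0 // exprn_ge0 // ltW. Qed.

Lemma upper_rate_gt0 : 0 < rho'.
Proof.
have /andP[s0 s1] := s01; rewrite /upper_rate mulr_gt0 // subr_gt0.
have : density R Uin A N <= N%:R * density R Uin A N by rewrite ler_peMl // ler1n.
have : density R Uin A N * (1 - 2 * s) <= density R Uin A N by rewrite ler_piMr //; lra.
by move: Nin; lra.
Qed.

Let Cst : R := (size A)%:R ^+ (2 * N) / rho' ^+ (2 * N).
Let Cst0 : 0 < Cst.
Proof. by rewrite divr_gt0 // exprn_gt0 // upper_rate_gt0. Qed.

Let avbound k : (2 * N <= k)%N -> (avcount Uin A k)%:R <= Cst * rho' ^+ k.
Proof.
move=> Nk; rewrite -(subnKC Nk).
apply: (le_trans (avcount_upperX N0 inner_size A1 Nin (k - 2 * N) s01 ret)).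
rewrite -/upper_rate exprD mulrA /Cst divfK //.
by rewrite expf_neq0 // gt_eqF // upper_rate_gt0.
Qed.

Let code l y : Y y -> exists2 w, w \in words A l & avoid Uin w /\
     exists2 q, unit_square q & y = toTorus (bmw w q).
Proof. by move=> Yy; exact: (survivor_code m2 mn hK N l Yy). Qed.

Lemma survivor_upper_rows (D0 : seq ('I_n * 'I_m)) d : (0 < size D0)%N ->
  (forall x, x \in A -> exists2 x0, x0 \in D0 & x0.2 = x.2) -> 0 < d ->
  \forall e' \near (0 : R)^'+, ln (covering_number Y e') / - ln e' <=
     dim_value n m rho' (size D0)%:R + d.
Proof.
move=> D00 hD0 d0.
apply: (@ratio_upper R n m m2 mn _ Cst rho' (size D0)%:R (2 * N) 0) => //.
- exact: upper_rate_gt0.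
- by rewrite ltr0n.
move=> e' k l e'0 Nk kl hn hm; rewrite addn0 in kl.
have [|h _] := covering_number_upper (P := avoid Uin) n0 m0 kl hn hm hD0 (Y := Y).
  move=> y /(code l)[w wl [av hy]]; exists w => //; split=> //; exact: avoid_take.
apply: (le_trans h); rewrite ler_wpM2r ?exprn_ge0 //; exact: avbound.
Qed.

(** Whole cylinders of level l are counted, so the last l - k letters feel the hole too; this is
    sharp when the row determines the letter. *)
Lemma survivor_upper_full d : 0 < d ->
  \forall e' \near (0 : R)^'+, ln (covering_number Y e') / - ln e' <=
     dim_value n m rho' rho' + d.
Proof.
move=> d0; apply: (@ratio_upper R n m m2 mn _ Cst rho' rho' (2 * N) 0) => //.
- exact: upper_rate_gt0.
- exact: upper_rate_gt0.
move=> e' k l e'0 Nk kl hn hm; rewrite addn0 in kl.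
have hn' : 2 / n%:R ^+ l < e'.
  apply: le_lt_trans hm; rewrite ler_pM2l //; exact: expVn_mn.
have [||h _] := covering_number_upper (P := avoid Uin) n0 m0 (leqnn l) hn' hm (D0 := A) (A := A) (Y := Y).
- by move=> x xA; exists x.
- move=> y /(code l)[w wl [av hy]]; exists w => //; split=> //; exact: avoid_take.
rewrite subnn expr0 mulr1 in h; apply: (le_trans h).
rewrite -mulrA -exprD subnKC //; apply: avbound; exact: leq_trans Nk kl.
Qed.

End Upper.

Section Lower.
Hypothesis Nout : N%:R * density R Uout A N <= 16^-1.
Local Notation rho := (rate R Uout A N).

Let rho0 : 0 < rho. Proof. exact: (rho_gt0 N0 A1 Nout). Qed.

Let covered e' : 0 < e' -> ([set k%:R | k in [set k : nat | exists c : 'I_k -> R * R,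
    Y `<=` \bigcup_(i in [set: 'I_k]) torus_ball (c i) e']] : set R) !=set0.
Proof.
move=> e'0.
have [k hk] := expVn_small (2 : R) n2 e'0; have [l hl] := expVn_small (2 : R) m2 e'0.
have hkl : 2 / m%:R ^+ (k + l) < e'.
  apply: le_lt_trans hl; rewrite ler_pM2l // lef_pV2 ?posrE ?exprn_gt0 ?ltr0n //.
  by apply: ler_weXn2l; rewrite ?ler1n // leq_addl.
have [||_ //] := covering_number_upper (P := predT) n0 m0 (leq_addr l k) hk hkl
  (D0 := A) (A := A) (Y := Y).
- by move=> x xA; exists x.
- move=> y Yy; have [w wl [_ hy]] := survivor_code m2 mn hK N (k + l) Yy.
  by exists w.
Qed.

Lemma covering_lower_codes F k l e' : 0 < e' -> uniq F -> (k <= l)%N ->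
  e' <= (n%:R ^+ k)^-1 -> e' <= (m%:R ^+ l)^-1 ->
  (forall w, w \in F -> exists2 s, forall i, s i \in D &
     mkseq s l = w /\ forall L, avoid Uout (mkseq s L)) ->
  {in F &, injective (fun w => (xnum (take k w), ynum w))} ->
  (size F)%:R <= 16 * covering_number Y e'.
Proof.
move=> e'0 uF kl hn hm hF injF; apply: (covering_number_ge n0 m0 (covered e'0) uF kl hn hm) => //.
move=> w /hF[s sD [<- av]]; split; first exact: size_mkseq.
have [y Yy /(_ l)[p P hy]] := survivor_of_code m2 mn hK sD av.
by exists p => //; rewrite -hy.
Qed.

(** The marked letter x is missing from [D0], so a tail over [D0] can be continued in [D0] for ever;
    l >= k + N keeps every window ending beyond l inside the tail. The constant is 1/2 from
    [mixed_growth] times 1/16 from [covering_lower_codes]. *)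
Lemma survivor_lower_rows (D0 : seq ('I_n * 'I_m)) x k l e' : 0 < e' ->
  uniq D0 -> (0 < size D0)%N -> {subset D0 <= A} -> {in D0 &, injective snd} -> x \notin D0 ->
  marked_hole D z e N x -> (N <= k)%N -> (k + N <= l)%N ->
  e' <= (n%:R ^+ k)^-1 -> e' <= (m%:R ^+ l)^-1 ->
  1 / 32 * rho ^+ k * (size D0)%:R ^+ (l - k) <= covering_number Y e'.
Proof.
move=> e'0 uD0 D00 sD0 injD0 xD0 [t1 t1N [hmark hsum]] Nk kNl hn hm.
have kl : (k <= l)%N := leq_trans (leq_addr _ _) kNl.
have Nlk : (N <= l - k)%N by clear -kNl; lia.
have [dd ddD0] : exists dd, dd \in D0.
  by case: (D0) D00 => // a s _; exists a; rewrite mem_head.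
pose F := [seq w <- [seq u ++ v | u <- words A k, v <- words D0 (l - k)] | avoid Uout w].
have memF w : w \in F -> exists u v, [/\ w = u ++ v, size u = k /\ size v = (l - k)%N,
    all (mem A) u, all (mem D0) v & avoid Uout w].
  rewrite mem_filter => /andP[av /allpairsP[[u v] /= []]].
  by rewrite !mem_words => /andP[/eqP su uA] /andP[/eqP sv vD] wE; exists u, v.
have szF : (size F = \sum_(u <- words A k) \sum_(v <- words D0 (l - k)) avoid Uout (u ++ v))%N.
  by rewrite /F size_filter count_sum big_allpairs_dep.
have uF : uniq F.
  apply: filter_uniq; apply: allpairs_uniq; rewrite ?words_uniq ?enum_uniq //.
  move=> [u v] [u' v'] /allpairsP[[a b] /= [au bv [-> ->]]] /allpairsP[[a' b'] /= [au' bv' [-> ->]]] /eqP.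
  move: au au'; rewrite !mem_words => /andP[/eqP s1 _] /andP[/eqP s2 _].
  by rewrite eqseq_cat ?s1 ?s2 // => /andP[/eqP -> /eqP ->].
have hF w : w \in F -> exists2 s, forall i, s i \in D &
     mkseq s l = w /\ forall L, avoid Uout (mkseq s L).
  move=> /memF[u [v [-> [su sv] /allP uA /allP vD0 av]]].
  have suv : size (u ++ v) = l by rewrite size_cat su sv subnKC.
  have sk i : (k <= i)%N -> nth dd (u ++ v) i \in D0.
    move=> ki; rewrite nth_cat su ltnNge ki /=.
    by have [h|h] := ltnP (i - k) (size v); [apply: vD0; rewrite mem_nth|rewrite nth_default].
  (* The default value [dd] of [nth], a letter of [D0], provides the infinite tail. *)
  exists (nth dd (u ++ v)).
    move=> i; have [ki|ki] := leqP k i; first by have := sD0 _ (sk i ki); rewrite mem_enum.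
    have iu : (i < size u)%N by rewrite su.
    by rewrite nth_cat iu; have := uA _ (mem_nth dd iu); rewrite /= mem_enum.
  split; first by rewrite -suv mkseq_nth.
  move=> L; apply: contraT => /(not_avoidP outer_size)[i]; rewrite size_mkseq => iN Ui.
  have nthi j : (j < N)%N -> nth dd (take N (drop i (mkseq (nth dd (u ++ v)) L))) j =
      nth dd (u ++ v) (i + j).
    by move=> jN; rewrite nth_take // nth_drop nth_mkseq //; clear -jN iN; lia.
  have szb := outer_size Ui.
  have [il|il] := leqP (i + N) l.
    have := avoid_window N i av; suff <- : take N (drop i (mkseq (nth dd (u ++ v)) L)) =
       take N (drop i (u ++ v)) by rewrite Ui.
    apply: (@eq_from_nth _ dd).
      by rewrite szb size_takel // size_drop suv; clear -il; lia.
    by move=> j; rewrite szb => jN; rewrite nthi // nth_take // nth_drop.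
  have ki : (k <= i)%N by clear -il kNl; lia.
  have ballA : all (mem A) (take N (drop i (mkseq (nth dd (u ++ v)) L))).
    apply/(all_nthP dd) => j; rewrite szb => jN; rewrite nthi //.
    by apply: sD0; apply: sk; rewrite (leq_trans ki) // leq_addr.
  have := hmark dd _ ballA Ui; rewrite nthi // => hx.
  by case/negP: xD0; rewrite -hx; apply: sk; rewrite (leq_trans ki) // leq_addr.
have inj : {in F &, injective (fun w => (xnum (take k w), ynum w))}.
  move=> w w' /memF[u [v [-> [su sv] uA vD0 _]]] /memF[u' [v' [-> [su' sv'] uA' vD0' _]]].
  rewrite !take_size_cat // => -[hx hy].
  have hyd : yd (u ++ v) = yd (u' ++ v').
    apply: num_inj hy; rewrite ?all_yd // !size_yd !size_cat su sv su' sv' //.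
  move: hyd; rewrite /yd !map_cat => /eqP; rewrite eqseq_cat ?size_map ?su ?su' // => /andP[/eqP hu /eqP hv].
  have -> : u = u' by apply: xynum_inj; rewrite ?su ?su' //; rewrite /ynum /yd hu.
  congr (_ ++ _); have svv : size v = size v' by rewrite sv sv'.
  move: (v) (v') svv (allP vD0) (allP vD0') hv; elim=> [|a s IH] [|a' s'] //= [ss] h1 h2 [ha hs].
  have aA : a \in D0 by apply: h1; rewrite mem_head.
  have a'A : a' \in D0 by apply: h2; rewrite mem_head.
  have -> : a = a' by apply: injD0 => //; exact: ord_inj.
  congr cons; apply: IH => // y ys; [apply: h1|apply: h2]; by rewrite in_cons ys orbT.
have := covering_lower_codes e'0 uF kl hn hm hF inj.
have := mixed_growth N0 outer_size A1 Nout sD0 Nk Nlk xD0 t1N (hmark x) hsum.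
rewrite -szF; set c := covering_number Y e'; set p := _ ^+ (l - k); set r := _ ^+ k.
by move: ((size F)%:R : R) => sz h1 h2; lra.
Qed.

(** An avoiding word may be a dead end. Words with avoiding extensions of every length continue to
    infinite avoiding sequences, as in Koenig's lemma. *)
Let good w := forall M, exists2 v, v \in words A M & avoid Uout (w ++ v).

Let good_step w : good w -> exists2 x, x \in D & good (rcons w x).
Proof.
move=> gw; apply: contrapT => h.
have /choice[f hf] : forall x, exists M, x \in D ->
    forall v, v \in words A M -> ~~ avoid Uout (rcons w x ++ v).
  move=> x; have [xD|xD] := boolP (x \in D); last by exists 0%N.
  apply: contrapT => h2; apply: h; exists x => // M; apply: contrapT => h3; apply: h2.
  by exists M => _ v vM; apply/negP => av; apply: h3; exists v.
have [v] := gw (\max_x f x).+1; rewrite mem_words; case: v => [|x v] //= /andP[+ /andP[xA vA]].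
rewrite eqSS => /eqP sv av.
have xD : x \in D by rewrite -mem_enum.
have fx : (f x <= size v)%N by rewrite sv; apply: leq_bigmax.
have := hf x xD (take (f x) v); rewrite mem_words size_takel // eqxx /=.
have -> : all (mem A) (take (f x) v) by apply/allP => y /mem_take; exact: (allP vA).
move=> /(_ isT)/negP; apply; move: av.
by rewrite -cat_rcons -{1}(cat_take_drop (f x) v) catA; exact: avoid_catl.
Qed.

Let good_code w : all (mem A) w -> good w -> exists2 s, forall i, s i \in D &
     mkseq s (size w) = w /\ forall L, avoid Uout (mkseq s L).
Proof.
move=> wA gw.
have /choice[g hg] : forall w, exists x, good w -> x \in D /\ good (rcons w x).
  move=> w'; have [gw'|ngw'] := pselect (good w').
    by have [x xD gx] := good_step gw'; exists x.
  have [dd _] : exists dd, dd \in A by case: (A) A1 => // a ? _; exists a; rewrite mem_head.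
  by exists dd.
pose W i := iter i (fun w => rcons w (g w)) w.
have Wg i : good (W i) /\ all (mem A) (W i).
  elim: i => [//|i [IH1 IH2]]; have [gD gg] := hg _ IH1; split=> //.
  by rewrite /W iterS all_rcons IH2 andbT /= mem_enum.
have Ws i : size (W i) = (size w + i)%N.
  by elim: i => [|i IH]; rewrite ?addn0 // /W iterS size_rcons IH addnS.
have Wt i j : take (size w + i) (W (i + j)%N) = W i.
  elim: j => [|j IH]; first by rewrite addn0 -Ws take_size.
  rewrite addnS /W iterS -/(W _) -cats1 take_cat Ws.
  case: ltnP => h; first exact: IH.
  have -> : j = 0%N by clear -h; lia.
  by rewrite !addn0 subnn take0 cats0.
have [dd _] : exists dd, dd \in A by case: (A) A1 => // a ? _; exists a; rewrite mem_head.
pose s i := nth dd (W i.+1) i.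
have sE i L : (i < size w + L)%N -> nth dd (W L) i = s i.
  move=> iL; rewrite /s; have [h|h] := leqP i.+1 L.
    by rewrite -(subnKC h) -[in RHS](Wt i.+1 (L - i.+1)%N) nth_take // addnS ltnS leq_addl.
  by rewrite -[in LHS](Wt L (i.+1 - L)%N) subnKC ?nth_take // ltnW.
exists s.
  move=> i; have [_ /allP h] := Wg i.+1; have := h (s i).
  by rewrite /= mem_enum; apply; rewrite mem_nth // Ws addnS ltnS leq_addl.
split.
  apply: (@eq_from_nth _ dd); rewrite size_mkseq // => i iw.
  by rewrite nth_mkseq // -(sE i 0%N) ?addn0.
move=> L; have -> : mkseq s L = take L (W L).
  apply: (@eq_from_nth _ dd); first by rewrite size_mkseq size_takel // Ws leq_addl.
  move=> i; rewrite size_mkseq => iL; rewrite nth_mkseq // nth_take // sE //.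
  by rewrite (leq_trans iL) // leq_addl.
apply: avoid_take; have [gW _] := Wg L; have [v _ av] := gW 0%N.
exact: avoid_catl av.
Qed.

(** A word extendable by M letters has at most a M avoiding extensions of that length. So a (l + M)
    >= rho^l a M leaves at least rho^l extendable words of length l, which are good for M large. *)
Lemma survivor_lower_full k l e' : 0 < e' -> {in A &, injective snd} -> (k <= l)%N ->
  e' <= (m%:R ^+ l)^-1 ->
  1 / 16 * rho ^+ k * rho ^+ (l - k) <= covering_number Y e'.
Proof.
move=> e'0 injA kl hm.
(* The horizontal level is 0: rows determine letters, so the second coordinate alone separates the
   codes. *)
have e'1 : e' <= (n%:R ^+ 0)^-1.
  apply: (le_trans hm); rewrite expr0 invr1 invf_le1 ?exprn_gt0 ?ltr0n //.
  by rewrite -natrX ler1n expn_gt0 m0.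
pose ext M w := `[< exists2 v, v \in words A M & avoid Uout (w ++ v) >].
(* M exceeds the lengths at which the finitely many dead ends of length l stop. *)
have [M hM] : exists M, forall w, w \in words A l -> ext M w -> good w.
  have /choice[f hf] : forall w, exists M, ext M w -> good w.
    move=> w; have [gw|/existsNP[M hM]] := pselect (good w); first by exists 0%N.
    by exists M => /asboolP.
  exists (\max_(w <- words A l) f w)%N => w wl /asboolP[v + av].
  rewrite mem_words => /andP[/eqP sv vA]; apply: hf; apply/asboolP.
  have fw : (f w <= size v)%N by rewrite sv; apply: leq_bigmax_seq.
  exists (take (f w) v).
    by rewrite mem_words size_takel // eqxx /=; apply/allP => y /mem_take; exact: (allP vA).
  by move: av; rewrite -{1}(cat_take_drop (f w) v) catA; exact: avoid_catl.
pose F := [seq w <- words A l | `[< good w >]].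
have szF : rho ^+ l <= (size F)%:R.
  have hE : rho ^+ l <= (count (ext M) (words A l))%:R.
    have aM : 0 < (avcount Uout A M)%:R :> R.
      exact: lt_le_trans (exprn_gt0 M rho0) (avcount_ge N0 outer_size A1 Nout M).
    rewrite -(ler_pM2r aM); apply: (le_trans (avcount_growthX N0 outer_size A1 Nout l M)).
    rewrite -natrM ler_nat addnC /avcount !count_sum.
    rewrite -(sum_words_split _ _ _ (fun u => ext M u : nat) (fun v => avoid Uout v : nat)).
    rewrite !big_seq; apply: leq_sum => w; rewrite mem_words => /andP[/eqP sw wA].
    have [av|//] := boolP (avoid Uout w).
    have sd : size (drop l w) = M by rewrite size_drop sw addKn.
    have -> : avoid Uout (drop l w) by move: av; rewrite -{1}(cat_take_drop l w); exact: avoid_catr.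
    rewrite muln1; suff -> : ext M (take l w) by [].
    apply/asboolP; exists (drop l w); last by rewrite cat_take_drop.
    by rewrite mem_words sd eqxx /=; apply/allP => y /mem_drop; exact: (allP wA).
  apply: (le_trans hE); rewrite ler_nat size_filter !count_sum big_seq [leqRHS]big_seq.
  apply: leq_sum => w wl; have [ew|//] := boolP (ext M w).
  by rewrite asboolT //; exact: hM.
have inF w : w \in F -> w \in words A l /\ good w.
  by rewrite mem_filter => /andP[/asboolP].
have := @covering_lower_codes F 0 l e' e'0 (filter_uniq _ (words_uniq _ (enum_uniq _))) (leq0n _) e'1 hm.
suff [h1 h2] : (forall w, w \in F -> exists2 s, forall i, s i \in D &
     mkseq s l = w /\ forall L, avoid Uout (mkseq s L)) /\
  {in F &, injective (fun w => (xnum (take 0 w), ynum w))}.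
  move=> /(_ h1 h2); move: szF; rewrite -mulrA -exprD subnKC //.
  by move: ((size F)%:R : R) => sz; lra.
split.
  move=> w /inF[]; rewrite mem_words => /andP[/eqP <- wA] gw; exact: good_code.
move=> w w' /inF[+ _] /inF[+ _] [_ hy]; rewrite !mem_words => /andP[/eqP sw /allP wA] /andP[/eqP sw' /allP wA'].
have : yd w = yd w' by apply: num_inj hy; rewrite ?all_yd // !size_yd sw sw'.
have : size w = size w' by rewrite sw sw'.
move: wA wA'; rewrite /yd; clear sw sw' hy; elim: w w' => [|a s IH] [|a' s'] //= h1 h2 [ss] [ha hs].
have aA : a \in A by apply: h1; rewrite mem_head.
have a'A : a' \in A by apply: h2; rewrite mem_head.
have -> : a = a' by apply: injA => //; exact: ord_inj.
congr cons; apply: IH => // y ys; [apply: h1|apply: h2]; by rewrite in_cons ys orbT.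
Qed.

End Lower.
End SurvivorDimension.

(** * From survivor sets to the drop of dimension *)

Section DimensionDrop.
Variables (R : realType) (n m : nat).
Hypotheses (m2 : (1 < m)%N) (mn : (m < n)%N).
Variables (D : {set 'I_n * 'I_m}) (K : set (R * R)).
Hypothesis hK : is_attractor D K.
Let X := @toTorus R @` K.
Let A := enum D.
Hypothesis A1 : (1 < size A)%N.
Implicit Types (z : R * R) (e s d : R).
Local Notation survivors z e := (survivor n m X (torus_ball z e)).
Local Notation boxr Y e' := (ln (covering_number Y e') / - ln e').

Let n2 : (1 < n)%N. Proof. exact: ltn_trans mn. Qed.
Let q0 : 0 < (size A)%:R :> R. Proof. by rewrite ltr0n ltnW. Qed.

Definition section_of (D0 : seq ('I_n * 'I_m)) x :=
  [/\ uniq D0 /\ (0 < size D0)%N, {subset D0 <= A}, {in D0 &, injective snd}, x \notin D0 &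
      forall y, y \in A -> exists2 y0, y0 \in D0 & y0.2 = y.2].

Lemma survivor_bounds_rows z e N s D0 x : (0 < N)%N -> section_of D0 x -> 0 <= s <= 1 / 2 ->
  N%:R * density R (inner_hole z e N) A N <= 16^-1 ->
  N%:R * density R (outer_hole z e N) A N <= 16^-1 ->
  \sum_(1 <= i < N) (retcount (inner_hole z e N) A N i)%:R / (size A)%:R ^+ i
        <= s * (count (inner_hole z e N) (words A N))%:R ->
  marked_hole D z e N x -> forall d, 0 < d ->
  (\forall e' \near (0 : R)^'+,
     dim_value n m (rate R (outer_hole z e N) A N) (size D0)%:R - d <= boxr (survivors z e) e') /\
  (\forall e' \near (0 : R)^'+,
     boxr (survivors z e) e' <= dim_value n m (upper_rate D z e N s) (size D0)%:R + d).
Proof.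
move=> N0 [[uD0 D00] sD0 iD0 xD0 hD0] s01 hin hout hret hmark d d0.
have low e' k l := @survivor_lower_rows R n m m2 mn D K hK z e N A1 N0 hout D0 x k l e'.
have D0R : 0 < (size D0)%:R :> R by rewrite ltr0n.
have r0 : 0 < rate R (outer_hole z e N) A N by exact: rho_gt0.
split.
  apply: (@ratio_lower R n m m2 mn _ (1 / 32) _ _ N N) => //.
  by move=> e' k l e'0 Nk kl hn hm; apply: low.
apply: survivor_upper_rows => //.
(* The lower bound at the fixed levels N and 2 N gives the positivity of the covering numbers
   demanded by [ratio_upper]. *)
pose e0 : R := Num.min (n%:R ^+ N)^-1 (m%:R ^+ (N + N))^-1.
apply: (@near_right0 R _ e0); first by rewrite lt_min !invr_gt0 !exprn_gt0 // ltr0n ltnW.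
move=> e' e'0; rewrite lt_min => /andP[h1 h2].
apply: lt_le_trans (low e' N (N + N)%N e'0 uD0 D00 sD0 iD0 xD0 hmark _ _ (ltW h1) (ltW h2)) => //.
by rewrite !mulr_gt0 ?exprn_gt0 //; lra.
Qed.

Lemma survivor_bounds_full z e N s : (0 < N)%N -> {in A &, injective snd} -> 0 <= s <= 1 / 2 ->
  N%:R * density R (inner_hole z e N) A N <= 16^-1 ->
  N%:R * density R (outer_hole z e N) A N <= 16^-1 ->
  \sum_(1 <= i < N) (retcount (inner_hole z e N) A N i)%:R / (size A)%:R ^+ i
        <= s * (count (inner_hole z e N) (words A N))%:R ->
  forall d, 0 < d ->
  (\forall e' \near (0 : R)^'+,
     dim_value n m (rate R (outer_hole z e N) A N) (rate R (outer_hole z e N) A N) - d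
       <= boxr (survivors z e) e') /\
  (\forall e' \near (0 : R)^'+,
     boxr (survivors z e) e' <= dim_value n m (upper_rate D z e N s) (upper_rate D z e N s) + d).
Proof.
move=> N0 iA s01 hin hout hret d d0.
have low e' k l := @survivor_lower_full R n m m2 mn D K hK z e N A1 N0 hout k l e'.
have r0 : 0 < rate R (outer_hole z e N) A N by exact: rho_gt0.
split.
  apply: (@ratio_lower R n m m2 mn _ (1 / 16) _ _ 0 0) => //.
  by move=> e' k l e'0 _ kl _ hm; apply: low => //; rewrite -(addn0 k).
apply: survivor_upper_full => //.
apply: (@near_right0 R _ 1) => // e' e'0 e'1.
apply: lt_le_trans (low e' 0%N 0%N e'0 iA _ _) => //.
  by rewrite !mulr_gt0 ?exprn_gt0 //; lra.
by rewrite expr0 invr1 ltW.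
Qed.

Definition is_box_dim (dim : set (R * R) -> \bar R) :=
  dim = @upper_box_dim R \/ dim = @lower_box_dim R.

Lemma box_dim_bounds dim (Y : set (R * R)) (lo hi : R) : is_box_dim dim ->
  (forall d, 0 < d -> (\forall e' \near (0 : R)^'+, lo - d <= boxr Y e') /\
                      (\forall e' \near (0 : R)^'+, boxr Y e' <= hi + d)) ->
  exists v, [/\ dim Y = v%:E, lo <= v & v <= hi].
Proof.
move=> hdim h.
have h1 : (upper_box_dim Y <= hi%:E)%E by apply: limf_esup_le => d /h[].
have h2 : (lo%:E <= lower_box_dim Y)%E by apply: limf_einf_ge => d /h[].
have h3 : (lower_box_dim Y <= upper_box_dim Y)%E by exact: limf_einf_le_esup.
have [h4 h5] : (lo%:E <= dim Y)%E /\ (dim Y <= hi%:E)%E.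
  by case: hdim => ->; split=> //; [exact: le_trans h3|exact: le_trans h1].
move: h4 h5; case: (dim Y) => [v h4 h5| |]; rewrite ?leye_eq ?leeNy_eq //.
by exists v; rewrite -!lee_fin.
Qed.

(* The ball of radius 0 is empty, so the bounds for survivor sets also give the
   dimension of X. *)
Lemma survivors_empty_hole z : survivors z 0 = X.
Proof.
apply/seteqP; split => [y []//|y Xy]; split=> // k [_].
by rewrite ltNge sqrtr_ge0.
Qed.

Let empty_inner z (w : seq ('I_n * 'I_m)) : inner_hole z (0 : R) 1 w = false.
Proof.
apply/negP => /andP[_ /asboolP /(_ 0 (@unit_square0 R))].
by rewrite ltNge sqrtr_ge0.
Qed.

Let empty_outer z (w : seq ('I_n * 'I_m)) : outer_hole z (0 : R) 1 w = false.
Proof.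
apply/negP => /andP[_ /asboolP[q _]].
by rewrite ltNge sqrtr_ge0.
Qed.

Let dens_inner z : density R (inner_hole z (0 : R) 1) A 1 = 0.
Proof.
by rewrite /density (eq_count (a2 := pred0)) ?count_pred0 ?mul0r // => w; rewrite empty_inner.
Qed.

Let dens_outer z : density R (outer_hole z (0 : R) 1) A 1 = 0.
Proof.
by rewrite /density (eq_count (a2 := pred0)) ?count_pred0 ?mul0r // => w; rewrite empty_outer.
Qed.

Let rate_empty z : rate R (outer_hole z (0 : R) 1) A 1 = (size A)%:R.
Proof. by rewrite /rate /loss dens_outer mul0r subr0 mulr1. Qed.

Let upper_rate_empty z : upper_rate D z (0 : R) 1 0 = (size A)%:R.
Proof. by rewrite /upper_rate dens_inner mul0r subr0 mulr1. Qed.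

Lemma box_dim_rows D0 x : section_of D0 x ->
  box_dim X = (dim_value n m (size A)%:R (size D0)%:R)%:E.
Proof.
move=> hs; have h := @survivor_bounds_rows 0 0 1 0 D0 x (ltn0Sn 0) hs.
rewrite survivors_empty_hole rate_empty upper_rate_empty dens_inner dens_outer in h.
have {}h : forall d, 0 < d -> _ := h ltac:(lra) ltac:(by rewrite mulr0 invr_ge0)
  ltac:(by rewrite mulr0 invr_ge0) ltac:(by rewrite big_geq // mul0r) _.
(* Vacuous, because no word meets the empty ball. *)
have mk : marked_hole D (0 : R * R) 0 1 x.
  exists 0%N => //; split; first by move=> d0 w _; rewrite empty_outer.
  by rewrite big_geq //; lra.
by apply: box_dim_eq => d d0; have [] := h mk d d0.
Qed.

Lemma box_dim_full : {in A &, injective snd} ->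
  box_dim X = (dim_value n m (size A)%:R (size A)%:R)%:E.
Proof.
move=> hs; have h := @survivor_bounds_full 0 0 1 0 (ltn0Sn 0) hs.
rewrite survivors_empty_hole rate_empty upper_rate_empty dens_inner dens_outer in h.
have {}h : forall d, 0 < d -> _ := h ltac:(lra) ltac:(by rewrite mulr0 invr_ge0)
  ltac:(by rewrite mulr0 invr_ge0) ltac:(by rewrite big_geq // mul0r).
by apply: box_dim_eq => d d0; have [] := h d d0.
Qed.

Lemma ln_one_minus (x y : R) : 0 < x -> x <= y -> y < 1 ->
  x <= - ln (1 - x) /\ - ln (1 - y) <= y / (1 - y).
Proof.
move=> x0 xy y1; split.
  by rewrite lerNr; apply: (le_ln1Dx (x := - x)); lra.
have h : 0 < 1 - y by lra.
rewrite -lnV ?posrE //; rewrite [X in ln X](_ : _ = 1 + y / (1 - y)); last by field; rewrite gt_eqF.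
apply: le_ln1Dx; apply: (lt_le_trans (_ : -1 < 0)); first lra.
by rewrite divr_ge0; lra.
Qed.

(* M is the measure of the hole, mi and mo the densities of its inner and outer
   approximations by cylinders. *)
Lemma drop_estimate (mi mo M eta theta G0 v : R) N : (0 < N)%N ->
  0 < mi -> mi <= M -> M <= mo -> mo <= (1 + eta) * mi -> 0 < eta -> eta <= 1 / 100 ->
  N%:R * mo <= eta -> 0 < theta ->
  G0 + theta * ln (1 - mo * (1 + 4 * N%:R * mo)) <= v ->
  v <= G0 + theta * ln (1 - mi * (1 - 2 * eta)) ->
  `|(G0 - v) / M - theta| <= 20 * eta * theta.
Proof.
move=> N0 mi0 miM Mmo mo_mi eta0 eta1 Nmo th0 hlo hhi.
have M0 : 0 < M by lra.
have N1 : 1 <= N%:R :> R by rewrite ler1n.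
have mo_eta : mo <= eta by apply: le_trans Nmo; rewrite ler_peMl //; lra.
set y := mo * (1 + 4 * N%:R * mo) in hlo.
have yE : y <= mo * (1 + 4 * eta).
  rewrite /y; apply: ler_wpM2l; first by lra.
  by rewrite lerD2l -mulrA ler_pM2l.
have y0 : mo <= y by rewrite /y ler_peMr //; [lra|rewrite lerDl !mulr_ge0 //; lra].
have y2 : y <= 2 * eta by nra.
set x := mi * (1 - 2 * eta) in hhi.
have x0 : 0 < x by rewrite mulr_gt0 //; lra.
have xy : x <= y.
  by apply: le_trans y0; rewrite /x; nra.
have y1 : y < 1 by lra.
have [h1 h2] := ln_one_minus x0 xy y1.
have h3 : y / (1 - y) <= y * (1 + 4 * eta).
  rewrite ler_pdivrMr; last by lra.
  by rewrite -mulrA ler_peMr //; nra.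
(* The constant 20 is generous: (1 + eta) (1 + 4 eta)^2 <= 1 + 20 eta here, and (1 + eta) (1 - 20
   eta) <= 1 - 2 eta in the opposite bound. *)
have h4 : y * (1 + 4 * eta) <= M * (1 + 20 * eta).
  have hmo : mo <= (1 + eta) * M by nra.
  have hy : y <= M * ((1 + eta) * (1 + 4 * eta)).
    apply: (le_trans yE); rewrite mulrA [M * _]mulrC ler_wpM2r //; lra.
  apply: (le_trans (ler_wpM2r (_ : 0 <= 1 + 4 * eta) hy)); first by lra.
  by rewrite -mulrA ler_pM2l //; nra.
have h5 : M * (1 - 20 * eta) <= x.
  have : M <= (1 + eta) * mi by lra.
  move=> hM; rewrite /x; apply: (@le_trans _ _ ((1 + eta) * mi * (1 - 20 * eta))).
    by rewrite ler_wpM2r //; lra.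
  by rewrite mulrAC mulrC ler_pM2l //; nra.
have u1 := ler_wpM2l (ltW th0) (le_trans h2 (le_trans h3 h4)).
have u2 := ler_wpM2l (ltW th0) (le_trans h5 h1).
have e1 : (G0 - v) / M - theta = ((G0 - v) - theta * M) / M by field; rewrite gt_eqF.
rewrite e1 normrM [`|M^-1|]gtr0_norm ?invr_gt0 // ler_pdivrMr // ler_norml.
by move: u1 u2 hlo hhi; rewrite !mulrN; lra.
Qed.

Lemma cvg_fin_near (F : R -> \bar R) (L : R) :
  (forall d, 0 < d -> \forall e \near (0 : R)^'+, exists2 r, F e = r%:E & `|r - L| <= d) ->
  F e @[e --> (0 : R)^'+] --> L%:E.
Proof.
move=> h; apply/fine_cvgP; split.
  by move: (h 1 ltr01); apply: filterS => e [r -> _].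
apply/cvgrPdist_le => d d0; move: (h d d0); apply: filterS => e [r /= -> hr].
by rewrite distrC.
Qed.

Section Limit.
Variables (mu : probability (R * R)%type R) (mumax : set (R * R) -> \bar R).
Hypothesis hmu : is_self_affine_measure D mu.
Hypothesis hmumax : mumax = pushforward mu (@toTorus R).
Variables (dim : set (R * R) -> \bar R) (z : R * R) (x : 'I_n * 'I_m) (G0 theta : R).
Hypotheses (Xz : X z) (xD : x \in D) (theta0 : 0 < theta).
Hypothesis sp : spread D true \/ spread D false.
Hypothesis nonres : forall co M, spread D co -> (0 < M)%N -> cnorm (M%:R * crd co z) <> 0.
Hypothesis recur : forall k, exists2 j, (k <= j)%N & open_cell D x (iter j (@torus_map R n m) z).
Hypothesis dimX : box_dim X = G0%:E.
Hypothesis dimY : forall e N eta, (0 < N)%N -> 0 < eta -> eta <= 1 / 100 ->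
  N%:R * density R (inner_hole z e N) A N <= 16^-1 ->
  N%:R * density R (outer_hole z e N) A N <= 16^-1 ->
  \sum_(1 <= i < N) (retcount (inner_hole z e N) A N i)%:R / (size A)%:R ^+ i
        <= eta * (count (inner_hole z e N) (words A N))%:R ->
  marked_hole D z e N x ->
  exists v, [/\ dim (survivors z e) = v%:E,
    G0 + theta * ln (1 - loss N (density R (outer_hole z e N) A N)) <= v &
    v <= G0 + theta * ln (1 - density R (inner_hole z e N) A N * (1 - 2 * eta))].

(** The hypothesis [dimY] isolates what depends on the rows, so both parts of the theorem are
    instances, with theta = 1 / ln m and theta = 1 / ln n. *)
Lemma drop_ratio_limit :
  dimension_drop_ratio n m dim X mumax z e @[e --> 0^'+] --> theta%:E.
Proof.
have Tz : torus z by case: Xz => y _ <-; exact: toTorus_torus.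
apply: cvg_fin_near => d d0.
pose eta := Num.min (1 / 100) (d / (20 * theta)).
have eta0 : 0 < eta.
  by rewrite lt_min; apply/andP; split; [lra|rewrite divr_gt0 // mulr_gt0].
have eta1 : eta <= 1 / 100 by rewrite ge_min lexx.
have eta2 : 20 * eta * theta <= d.
  have : eta <= d / (20 * theta) by rewrite ge_min lexx orbT.
  by rewrite ler_pdivlMr ?mulr_gt0 //; lra.
have eta3 : 0 < eta <= 1 / 2 by rewrite eta0 /=; lra.
have [e0 e00 he0] := hole_parameters m2 mn hK Xz Tz sp nonres recur xD eta3.
apply: (@near_right0 R _ e0) => // e ep ee.
have [N [N0 cin hout hratio hret] hmark] := he0 e ep ee.
have AN : 0 < (size A)%:R ^+ N :> R by rewrite exprn_gt0.
have dio : density R (inner_hole z e N) A N <= density R (outer_hole z e N) A N.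
  rewrite /density ler_wpM2r ?invr_ge0 ?(ltW AN) // ler_nat.
  by apply: sub_count => w; exact: inner_outer.
have hout' : N%:R * density R (outer_hole z e N) A N <= 16^-1.
  by apply: (le_trans hout); apply: (le_trans eta1); lra.
have hin' : N%:R * density R (inner_hole z e N) A N <= 16^-1.
  by apply: le_trans hout'; rewrite ler_wpM2l.
have [v [hv lo hi]] := dimY N0 eta0 eta1 hin' hout' hret hmark.
have D0 : (0 < #|D|)%N by rewrite cardE ltnW.
have [b1 b2] := mumax_bounds m2 mn D0 hmu z e N.
exists ((G0 - v) / fine (mumax (torus_ball z e))).
  by rewrite /dimension_drop_ratio dimX hv -EFinB -EFinM.
apply: le_trans eta2; rewrite hmumax.
apply: (@drop_estimate (density R (inner_hole z e N) A N) (density R (outer_hole z e N) A N) _ _ _ _ _ N) => //.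
- by rewrite divr_gt0 // ltr0n.
- by rewrite /density -cardE.
- by rewrite /density -cardE.
- by rewrite /density mulrA ler_wpM2r // invr_ge0 ltW.
Qed.

End Limit.
End DimensionDrop.

Section Periods.
Variables (R : realType) (U : Type) (f : U -> U) (u : U).

Lemma period_factor_nonperiodic N : (forall p, (0 < p)%N -> iter p f u <> u) ->
  period_factor R f N u = 1.
Proof.
move=> h; rewrite /period_factor /prime_period xgetPN ?eqxx // => p [p0 hp _].
exact: h hp.
Qed.

Lemma period_factor_fixed : f u = u -> period_factor R f 1 u = 0.
Proof.
move=> h; rewrite /period_factor.
have h1 : is_prime_period f u 1 by split=> // q; rewrite ltnS; case: q.
have : prime_period f u != 0%N.
  by rewrite /prime_period; case: xgetP => [p _ [p0 _ _]|/(_ 1%N)] //; rewrite -lt0n.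
by move=> /negbTE ->; rewrite expr1n invr1 subrr.
Qed.

End Periods.

(** * The degenerate case of a single digit *)

Section SinglePoint.
Variables (R : realType) (n m : nat).
Hypotheses (m2 : (1 < m)%N) (mn : (m < n)%N).
Variables (D : {set 'I_n * 'I_m}) (K : set (R * R)).
Hypothesis hK : is_attractor D K.
Let X := @toTorus R @` K.
Hypothesis D1 : #|D| = 1%N.
Implicit Types z : R * R.

Let n2 : (1 < n)%N. Proof. exact: ltn_trans mn. Qed.
Let n0 : (0 < n)%N. Proof. exact: ltnW. Qed.
Let m0 : (0 < m)%N. Proof. exact: ltnW. Qed.

Lemma single_point z z' : X z -> X z' -> z = z'.
Proof.
move=> Xz Xz'.
have Tz : torus z by case: Xz => y _ <-; exact: toTorus_torus.
have Tz' : torus z' by case: Xz' => y _ <-; exact: toTorus_torus.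
apply: torus_dist_eq => //; apply/eqP; rewrite eq_le sqrtr_ge0 andbT.
apply: (@le_expVn R m 2) => // L; rewrite add0r.
have [c cL [k Q ->]] := code_of_point m2 mn hK L Xz.
have [c' cL' [k' Q' ->]] := code_of_point m2 mn hK L Xz'.
have cc' : c = c'.
  have : size (words (enum D) L) = 1%N by rewrite size_words -cardE D1 exp1n.
  by move: cL cL'; case: (words _ _) => [|a [|b s]] //; rewrite !inE => /eqP -> /eqP ->.
have sc : size c = L by move: cL; rewrite mem_words => /andP[/eqP].
rewrite torus_dist_toTorusl torus_dist_toTorus -cc'.
apply: (le_trans (torus_dist_leD _ _)).
have [h1 h2] := bmw_diff n0 m0 c Q Q'; rewrite sc in h1 h2.
have := le_trans (cnorm_norm _) h1; have := le_trans (cnorm_norm _) h2.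
have := expVn_mn R m2 mn L; lra.
Qed.

Lemma torus_map_attractor z : X z -> X (@torus_map R n m z).
Proof.
move=> [y Ky <-]; have [w wL [k Kk ->]] := attractor_decomp hK 1 Ky.
have sw : size w = 1%N by move: wL; rewrite mem_words => /andP[/eqP].
have [a [b hab]] := @toTorus_bmw_iter R n m n0 m0 w k; rewrite sw /= in hab.
exists k => //; rewrite -[RHS]toTorus_id; last by split; exact: frac_itv.
by rewrite hab /toTorus /= !fracDint.
Qed.

Lemma single_fixed z : X z -> @torus_map R n m z = z.
Proof. by move=> Xz; apply: single_point => //; exact: torus_map_attractor. Qed.

(** X is one fixed point, so every hole about it leaves no survivor, and the numerator is 0 - 0 for
    each e > 0. *)
Lemma single_drop dim z : is_box_dim dim -> X z -> forall mumax : set (R * R) -> \bar R,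
  dimension_drop_ratio n m dim X mumax z e @[e --> 0^'+] --> 0%:E.
Proof.
move=> hdim Xz mumax.
have XE e : 0 < e -> covering_number X e = 1.
  move=> e0; have Tz : torus z by case: Xz => y _ <-; exact: toTorus_torus.
  have zz : torus_ball z e z.
    split=> //; rewrite torus_distE !subrr.
    by rewrite (cnorm_int R 0) expr0n addr0 sqrtr0.
  have [|h1 h2] := @covering_number_le R X e [:: z].
    by move=> y Xy; exists z; rewrite ?mem_head //; rewrite (single_point Xy Xz).
  apply/eqP; rewrite eq_le h1 /=; apply: lb_le_inf; first by exists 1%N%:R.
  move=> _ [k [c hc] <-]; rewrite ler1n lt0n; apply/eqP => k0.
  by have [i _ _] := hc _ Xz; rewrite k0 in i; case: i.
have boxX : box_dim X = 0%:E.
  apply: box_dim_eq => d d0; apply: (@near_right0 R _ 1) => // e e0 _;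
    by rewrite XE // ln1 mul0r; lra.
have cov0 e : covering_number (@set0 (R * R)) e = 0.
  have [//|h1 _] := @covering_number_le R set0 e [::].
  apply/eqP; rewrite eq_le h1 /=; apply: lb_le_inf; last by move=> _ [k _ <-].
  exists 0; exists 0%N => //; exists (fun=> 0) => y //.
apply: cvg_fin_near => d d0; apply: (@near_right0 R _ 1) => // e e0 _.
have -> : dimension_drop_ratio n m dim X mumax z e = 0%:E.
  rewrite /dimension_drop_ratio.
  have -> : survivor n m X (torus_ball z e) = set0.
    apply/seteqP; split=> // y [Xy hy]; apply: (hy 0%N) => /=.
    rewrite (single_point Xy Xz); split; first by case: Xz => x _ <-; exact: toTorus_torus.
    by rewrite torus_distE !subrr (cnorm_int R 0) expr0n addr0 sqrtr0.
  have [|v [-> v0 v1]] := @box_dim_bounds R dim set0 0 0 hdim.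
    move=> d' d'0; split; apply: (@near_right0 R _ 1) => // e' e'0 _;
      by rewrite cov0 ln0 // mul0r; lra.
  have -> : v = 0 by lra.
  by rewrite boxX subee // mul0e.
by exists 0 => //; rewrite subrr normr0 ltW.
Qed.

End SinglePoint.

(** * Limits at almost every point in the two cases *)

Section Assembly.
Variables (R : realType) (n m : nat).
Hypotheses (m2 : (1 < m)%N) (mn : (m < n)%N).
Variables (D : {set 'I_n * 'I_m}) (K : set (R * R)).
Hypothesis hK : is_attractor D K.
Let X := @toTorus R @` K.
Variables (mu : probability (R * R)%type R) (mumax : set (R * R) -> \bar R).
Hypothesis hmu : is_self_affine_measure D mu.
Hypothesis hmumax : mumax = pushforward mu (@toTorus R).
Variable nu : probability (R * R)%type R.
Hypotheses (hinv : invariant_measure nu (@torus_map R n m)).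
Hypotheses (herg : ergodic_measure nu (@torus_map R n m)).
Hypothesis hsupp : torus_support nu = X.

Let n2 : (1 < n)%N. Proof. exact: ltn_trans mn. Qed.
Let lnm : 0 < ln (m%:R : R). Proof. by rewrite ln_gt0 // ltr1n. Qed.
Let lnn : 0 < ln (n%:R : R). Proof. by rewrite ln_gt0 // ltr1n. Qed.

(** Here only the first k letters feel the hole, in [dim_value_fullM] all l letters do: hence the
    slopes 1 / ln n and 1 / ln m. *)
Lemma dim_value_rowsM (q t p : R) : 0 < q -> 0 < t ->
  dim_value n m (q * t) p = dim_value n m q p + (ln n%:R)^-1 * ln t.
Proof. by move=> q0 t0; rewrite /dim_value lnM ?posrE //; ring. Qed.

Lemma dim_value_fullM (q t : R) : 0 < q -> 0 < t ->
  dim_value n m (q * t) (q * t) = dim_value n m q q + (ln m%:R)^-1 * ln t.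
Proof. by move=> q0 t0; rewrite /dim_value lnM ?posrE //; ring. Qed.

Lemma enum_spread : (1 < #|D|)%N -> spread D true \/ spread D false.
Proof.
rewrite cardE => D2; have := enum_uniq D.
case E : (enum D) D2 => [|a [|b s]] // _ /andP[+ _]; rewrite inE negb_or => /andP[ab _].
have aD : a \in enum D by rewrite E mem_head.
have bD : b \in enum D by rewrite E !inE eqxx orbT.
have [e1|ne1] := eqVneq (dg true a) (dg true b); last by left; exists a, b.
have [e2|ne2] := eqVneq (dg false a) (dg false b); last by right; exists a, b.
case/eqP: ab; move: e1 e2; rewrite /dg.
by case: (a) (b) => [i j] [i' j'] /= /ord_inj -> /ord_inj ->.
Qed.

Lemma limit_full dim : is_box_dim dim -> (1 < #|D|)%N -> {in enum D &, injective snd} ->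
  {ae nu, forall z : R * R, X z ->
      dimension_drop_ratio n m dim X mumax z e @[e --> 0^'+] --> ((ln m%:R)^-1)%:E}.
Proof.
move=> hdim D2 iA; have sp := enum_spread D2.
have A1 : (1 < size (enum D))%N by rewrite -cardE.
have q0 : 0 < (size (enum D))%:R :> R by rewrite ltr0n ltnW.
have [x xD] : exists x, x \in D by apply/set0Pn; rewrite -card_gt0 ltnW.
have := recurrence_ae m2 mn hK hinv herg hsupp xD.
have := nonresonant_ae m2 mn hK hinv herg hsupp.
apply: filterS2 => z nonres recur Xz.
apply: (drop_ratio_limit m2 mn hK A1 hmu hmumax Xz xD _ sp nonres recur
   (box_dim_full m2 mn hK A1 iA)); first by rewrite invr_gt0.
move=> e N eta N0 eta0 eta1 hin hout hret _.
have eta2 : 0 <= eta <= 1 / 2 by rewrite (ltW eta0) /=; lra.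
have hb := survivor_bounds_full m2 mn hK A1 N0 iA eta2 hin hout hret.
have [v [hv lo hi]] := box_dim_bounds hdim hb; exists v; split=> //.
  rewrite -dim_value_fullM //.
  by have := rho_gt0 N0 A1 hout; rewrite /rate pmulr_rgt0.
rewrite -dim_value_fullM //.
by have := upper_rate_gt0 A1 N0 eta2 hin; rewrite /upper_rate pmulr_rgt0.
Qed.

Lemma limit_rows dim (D0 : seq ('I_n * 'I_m)) x : is_box_dim dim -> (1 < #|D|)%N ->
  x \in D -> section_of D D0 x ->
  {ae nu, forall z : R * R, X z ->
      dimension_drop_ratio n m dim X mumax z e @[e --> 0^'+] --> ((ln n%:R)^-1)%:E}.
Proof.
move=> hdim D2 xD hs; have sp := enum_spread D2.
have A1 : (1 < size (enum D))%N by rewrite -cardE.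
have q0 : 0 < (size (enum D))%:R :> R by rewrite ltr0n ltnW.
have := recurrence_ae m2 mn hK hinv herg hsupp xD.
have := nonresonant_ae m2 mn hK hinv herg hsupp.
apply: filterS2 => z nonres recur Xz.
apply: (drop_ratio_limit m2 mn hK A1 hmu hmumax Xz xD _ sp nonres recur
   (box_dim_rows m2 mn hK A1 hs)); first by rewrite invr_gt0.
move=> e N eta N0 eta0 eta1 hin hout hret hmark.
have eta2 : 0 <= eta <= 1 / 2 by rewrite (ltW eta0) /=; lra.
have hb := survivor_bounds_rows m2 mn hK A1 N0 hs eta2 hin hout hret hmark.
have [v [hv lo hi]] := box_dim_bounds hdim hb; exists v; split=> //.
  rewrite -dim_value_rowsM //.
  by have := rho_gt0 N0 A1 hout; rewrite /rate pmulr_rgt0.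
rewrite -dim_value_rowsM //.
by have := upper_rate_gt0 A1 N0 eta2 hin; rewrite /upper_rate pmulr_rgt0.
Qed.

Lemma iter_circle_map p z : iter p (@circle_map R m) z.2 = (iter p (@torus_map R n m) z).2.
Proof. by elim: p => //= p ->. Qed.

Lemma d_B_ae : (1 < #|D|)%N ->
  {ae nu, forall z : R * R, d_B D z = 1 /\ (spread D false -> d_B_tilde D z = 1)}.
Proof.
move=> D2; have sp := enum_spread D2.
have := nonresonant_ae m2 mn hK hinv herg hsupp.
apply: filterS => z nonres.
have np co p : spread D co -> (0 < p)%N -> crd co (iter p (@torus_map R n m) z) <> crd co z.
  move=> sco p0 h; apply: (nonresonant_nonperiodic m2 mn p0 sco (nonres co ^~ sco)).
  by rewrite h subrr; exact: (cnorm_int R 0).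
split.
  apply: period_factor_nonperiodic => p p0 h.
  by case: sp => sco; apply: (np _ p sco p0); rewrite h.
move=> sf; apply: period_factor_nonperiodic => p p0; rewrite iter_circle_map.
exact: np false p sf p0.
Qed.

End Assembly.

Theorem theorem1p3 (R : realType) (n m : nat) (hm : (2 <= m)%N)
    (hmn : (m < n)%N) (D : {set 'I_n * 'I_m}) (hD : D != finset.set0)
    (K : set (R * R)) (hK : is_attractor D K)
    (X : set (R * R)) (hX : X = @toTorus R @` K)
    (mu : probability (R * R)%type R) (hmu : is_self_affine_measure D mu)
    (mumax : set (R * R) -> \bar R)
    (hmumax : mumax = pushforward mu (@toTorus R))
    (nu : probability (R * R)%type R) (hnuT : nu (@torus R) = 1%E)
    (hinv : invariant_measure nu (@torus_map R n m))
    (herg : ergodic_measure nu (@torus_map R n m))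
    (hsupp : torus_support nu = X)
    (hloc : X (0, 0) -> (0 < lower_local_dim (pushforward nu snd) 0)%E) :
  ((forall j : 'I_m, (row_count D j <= 1)%N) ->
    {ae nu, forall z : R * R, X z ->
      dimension_drop_ratio n m (@upper_box_dim R) X mumax z e @[e --> 0^'+] -->
      ((ln m%:R)^-1 * (bm_eta R n m * d_B D z + (1 - bm_eta R n m) * d_B_tilde D z))%:E}
    /\
    {ae nu, forall z : R * R, X z ->
      dimension_drop_ratio n m (@lower_box_dim R) X mumax z e @[e --> 0^'+] -->
      ((ln m%:R)^-1 * (bm_eta R n m * d_B D z + (1 - bm_eta R n m) * d_B_tilde D z))%:E})
  /\
  ((exists j : 'I_m, (1 < row_count D j)%N) ->
    {ae nu, forall z : R * R, X z ->
      dimension_drop_ratio n m (@upper_box_dim R) X mumax z e @[e --> 0^'+] -->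
      (bm_eta R n m * d_B D z / ln m%:R)%:E}
    /\
    {ae nu, forall z : R * R, X z ->
      dimension_drop_ratio n m (@lower_box_dim R) X mumax z e @[e --> 0^'+] -->
      (bm_eta R n m * d_B D z / ln m%:R)%:E}).
Proof.
have lnm : 0 < ln (m%:R : R) by rewrite ln_gt0 // ltr1n.
have lnn : 0 < ln (n%:R : R) by rewrite ln_gt0 // ltr1n (ltn_trans hm).
rewrite hX in hsupp * => {X hX hloc hnuT}.
split=> [rows|[j rowj]].
  have main dim : is_box_dim dim -> {ae nu, forall z : R * R, (@toTorus R @` K) z ->
      dimension_drop_ratio n m dim (@toTorus R @` K) mumax z e @[e --> 0^'+] -->
      ((ln m%:R)^-1 * (bm_eta R n m * d_B D z + (1 - bm_eta R n m) * d_B_tilde D z))%:E}.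
    move=> hdim; have D0 : (0 < #|D|)%N by rewrite card_gt0.
    have [D1|D2] := leqP #|D| 1.
      have {D0}D1 : #|D| = 1%N by apply/eqP; rewrite eqn_leq D1.
      apply: aeW => z Xz.
      have fz := single_fixed hm hmn hK D1 Xz.
      have -> : d_B D z = 0 by rewrite /d_B D1 period_factor_fixed.
      have row1 : #|row_proj D| = 1%N.
        apply/eqP; rewrite eqn_leq -{1}D1 leq_imset_card card_gt0 /=.
        by apply/set0Pn; move/set0Pn: hD => [d dD]; exists d.2; apply: imset_f.
      have -> : d_B_tilde D z = 0.
        by rewrite /d_B_tilde row1 period_factor_fixed // -[in RHS]fz.
      by rewrite !mulr0 addr0 mulr0; exact: (single_drop hm hmn hK D1).
    have iA : {in enum D &, injective snd}.
      move=> [i j] [i' j']; rewrite !mem_enum => d1 d2 /= jj'; rewrite -jj' in d2 *.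
      congr pair; have /card_le1_eqP := rows j; apply; by rewrite inE.
    have sf : spread D false.
      have [[d [d' [dD d'D dd']]]|//] := enum_spread D2.
      exists d, d'; split=> //; apply: contra dd' => /eqP h.
      by rewrite (iA d d' dD d'D (ord_inj h)).
    have := d_B_ae hm hmn hK hinv herg hsupp D2.
    have := limit_full hm hmn hK hmu hmumax hinv herg hsupp hdim D2 iA.
    apply: filterS2 => z h [dB /(_ sf) dBt] Xz.
    rewrite dB dBt !mulr1 addrC subrK mulr1; exact: h.
  by split; apply: main; [left|right].
have /card_gt1P[i1 [i2 []]] := rowj; rewrite !inE => d1 d2 i12.
have D2 : (1 < #|D|)%N.
  apply/card_gt1P; exists (i1, j), (i2, j); split=> //.
  by apply: contra i12 => /eqP[->].
have [f hf] : exists f : 'I_m -> 'I_n * 'I_m, forall j', j' \in row_proj D ->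
    [/\ f j' \in D, (f j').2 = j' & f j' != (i1, j)].
  have /choice[f hf] : forall j', exists d, j' \in row_proj D ->
      [/\ d \in D, d.2 = j' & d != (i1, j)].
    move=> j'; have [/imsetP[d dD ->]|nj'] := boolP (j' \in row_proj D); last by exists (i1, j).
    have [e1|ne1] := eqVneq d.2 j; last first.
      exists d => _; split=> //; apply: contra ne1 => /eqP -> //.
    (* Row j has a second digit i2, so the section can omit (i1, j). *)
    exists (i2, j) => _; split=> //.
    by apply: contra i12 => /eqP[->].
  by exists f.
pose S := map f (enum (row_proj D)).
have hs : section_of D S (i1, j).
  split.
  - split.
      rewrite map_inj_in_uniq ?enum_uniq // => a b; rewrite !mem_enum => /hf[_ ha _] /hf[_ hb _] e.
      by rewrite -ha -hb e.
    rewrite size_map -cardE card_gt0; apply/set0Pn; exists j; apply/imsetP.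
    by exists (i1, j).
  - by move=> _ /mapP[a + ->]; rewrite !mem_enum => /hf[].
  - move=> _ _ /mapP[a + ->] /mapP[b + ->]; rewrite !mem_enum => /hf[_ ha _] /hf[_ hb _] /=.
    by rewrite ha hb => ->.
  - by apply/mapP => -[a]; rewrite mem_enum => /hf[_ _ /eqP h] e; apply: h.
  - move=> y; rewrite mem_enum => yD.
    have yr : y.2 \in row_proj D by apply/imsetP; exists y.
    have [h1 h2 h3] := hf _ yr; exists (f y.2) => //.
    by apply/mapP; exists y.2; rewrite ?mem_enum.
have main dim : is_box_dim dim -> {ae nu, forall z : R * R, (@toTorus R @` K) z ->
      dimension_drop_ratio n m dim (@toTorus R @` K) mumax z e @[e --> 0^'+] -->
      (bm_eta R n m * d_B D z / ln m%:R)%:E}.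
  move=> hdim; have := d_B_ae hm hmn hK hinv herg hsupp D2.
  have := limit_rows hm hmn hK hmu hmumax hinv herg hsupp hdim D2 d1 hs.
  apply: filterS2 => z h [dB _] Xz; rewrite dB mulr1 /bm_eta.
  (* By the definition of eta, eta / ln m = 1 / ln n. *)
  rewrite mulrAC divff ?gt_eqF // mul1r; exact: h.
by split; apply: main; [left|right].
Qed.
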